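(* Suppose that $M\subset\mathbb{C}^{n+1}$, $n\ge 2$, is a germ at the origin of a real-analytic submanifold of real codimension 2, CR singular at the origin, written in coordinates $(z,w)\in\mathbb{C}^n\times\mathbb{C}$ as $$w=A(z,\bar z)+B(\bar z,\bar z)+O(3),$$ where $A(z,\bar z)=\sum_{j,k}a_{jk}\bar z_jz_k$ and $B(\bar z,\bar z)=\sum_{j,k}b_{jk}\bar z_j\bar z_k$ are quadratic forms with complex coefficients and $A+B\not\equiv 0$. Suppose that $M$ is Levi-flat. Consider the list of quadrics \begin{align*} \text{(A.}k\text{)}\quad & w=\bar z_1^2+\bar z_2^2+\cdots+\bar z_k^2, && k=1,\dots,n,\\ \text{(B.}\gamma\text{)}\quad & w=|z_1|^2+\gamma\bar z_1^2, && \gamma\ge 0,\\ \text{(C.0)}\quad & w=\bar z_1z_2,\\ \text{(C.1)}\quad & w=\bar z_1z_2+\bar z_1^2. \end{align*} (i) If $M$ is a quadric (that is, $M$ is given by $w=A(z,\bar z)+B(\bar z,\bar z)$), then $M$ is locally biholomorphically equivalent to one and exactly one of the quadrics in the list. (ii) If $M$ is real-analytic, then the quadric $w=A(z,\bar z)+B(\bar z,\bar z)$ is Levi-flat, and can be put via a biholomorphic transformation into exactly one of the forms in the list.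
   Context: For a real submanifold $M$ of complex Euclidean space with complex structure $J$, $T^c_pM=T_pM\cap J(T_pM)$ is the largest $J$-invariant subspace of $T_pM$. $M$ is CR at $p$ if $\dim T^c_qM$ is constant for $q\in M$ near $p$; $M_{CR}$ is the set of such points; $M$ is CR singular at $p$ if $p\notin M_{CR}$. A CR submanifold is Levi-flat if its Levi-map vanishes identically (equivalently, the distribution $T^cM$ is involutive, so that $M$ is foliated by complex submanifolds tangent to $T^cM$). A CR singular submanifold $M$ is called Levi-flat if $M_{CR}$ is Levi-flat. $O(k)$ denotes terms vanishing to order at least $k$ at the origin. Local equivalence means by a germ of biholomorphism of $\mathbb{C}^{n+1}$ fixing the origin. *)

(* Defs.v *)
From mathcomp Require Import all_boot all_order all_algebra.
From mathcomp Require Import complex.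
From mathcomp Require Import all_classical all_reals all_analysis.

Set Implicit Arguments.
Unset Strict Implicit.
Unset Printing Implicit Defensive.

Import Order.TTheory GRing.Theory Num.Theory.
Import numFieldNormedType.Exports.

Local Open Scope classical_set_scope.
Local Open Scope ring_scope.

(* The complex numbers R[i], typed as a numClosedFieldType so that they and
   the row vectors over them receive the normed topology of
   numFieldNormedType. *)
Definition CC (R : realType) : numClosedFieldType := R[i].

Definition rtoC {R : realType} (t : R) : CC R := real_complex R t.

(* C^{n+1}, a point being row_mx z w%:M with z in C^n and w in C. *)
Notation Cn1 R n := 'rV[CC R]_(n + 1).

Definition zpart {R : realType} {n : nat} (p : Cn1 R n) : 'rV[CC R]_n :=
  lsubmx p.
Definition wpart {R : realType} {n : nat} (p : Cn1 R n) : CC R :=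
  rsubmx p 0 0.

Section PowerSeries.
Variables (R : realType) (N : nat).

Definition mindex := {ffun 'I_N -> nat}.

Definition mdegree (al : mindex) : nat := (\sum_(i < N) al i)%N.

Definition monomial (x : 'rV[CC R]_N) (al : mindex) : CC R :=
  \prod_(i < N) x 0 i ^+ al i.

Definition mindex_of d (m : {ffun 'I_N -> 'I_d}) : mindex :=
  [ffun i => m i : nat].

(* Partial sum over the cube of multi-indices with all entries < d. *)
Definition psum (c : mindex -> CC R) (d : nat) (x : 'rV[CC R]_N) : CC R :=
  \sum_(m : {ffun 'I_N -> 'I_d}) c (mindex_of m) * monomial x (mindex_of m).

(* On the polydisc of polyradius (r, ..., r), f is the sum of the power
   series with coefficients c, which converges absolutely at (r, ..., r).
   Absolute convergence makes the limit independent of the order of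
   summation. *)
Definition pseries_on (c : mindex -> CC R) (r : R) (f : 'rV[CC R]_N -> CC R) :
    Prop :=
  [/\ 0 < r,
      exists K : R, forall d : nat,
        \sum_(m : {ffun 'I_N -> 'I_d})
          `|c (mindex_of m)| * rtoC (r ^+ mdegree (mindex_of m)) <= rtoC K
    & forall x : 'rV[CC R]_N, (forall i, `|x 0 i| < rtoC r) ->
        psum c d x @[d --> \oo] --> f x].

Definition holomorphic_at0 (f : 'rV[CC R]_N -> CC R) : Prop :=
  exists (c : mindex -> CC R) (r : R), pseries_on c r f.

Definition holomorphic_map_at0 (F : 'rV[CC R]_N -> 'rV[CC R]_N) : Prop :=
  forall i : 'I_N, holomorphic_at0 (fun x => F x 0 i).

Definition biholomorphic_germ (F : 'rV[CC R]_N -> 'rV[CC R]_N) : Prop :=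
  [/\ holomorphic_map_at0 F, F 0 = 0
    & exists G : 'rV[CC R]_N -> 'rV[CC R]_N,
        [/\ holomorphic_map_at0 G, G 0 = 0,
            \forall x \near (0 : 'rV[CC R]_N), G (F x) = x
          & \forall x \near (0 : 'rV[CC R]_N), F (G x) = x]].

Definition locally_equivalent (M M' : set 'rV[CC R]_N) : Prop :=
  exists2 F : 'rV[CC R]_N -> 'rV[CC R]_N, biholomorphic_germ F
    & \forall p \near (0 : 'rV[CC R]_N), M p <-> M' (F p).

Definition same_germ0 (M M' : set 'rV[CC R]_N) : Prop :=
  \forall p \near (0 : 'rV[CC R]_N), M p <-> M' p.

End PowerSeries.

(* A real-analytic function of z near 0 is a power series in (z, zbar), i.e.
   the restriction of a convergent power series in 2n complex variables to
   {(z, conj z)}; it is O(k) when all coefficients of degree < k vanish. *)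
Definition real_analytic_O {R : realType} {n : nat} (k : nat)
    (f : 'rV[CC R]_n -> CC R) : Prop :=
  exists (c : mindex (n + n) -> CC R) (r : R) (P : 'rV[CC R]_(n + n) -> CC R),
    [/\ pseries_on c r P,
        forall al, (mdegree al < k)%N -> c al = 0
      & \forall z \near (0 : 'rV[CC R]_n),
          f z = P (row_mx z (map_mx Num.conj z))].

Section CRGeometry.
Variables (R : realType) (N : nat).
Local Notation V := 'rV[CC R]_N.
Implicit Types (M : set V) (p q v : V).

(* Real derivative at the real parameter 0 of a curve in C^N. *)
Definition is_velocity (g : R -> V) (v : V) : Prop :=
  (rtoC t)^-1 *: (g t - g 0) @[t --> (0 : R)^'] --> v.

Definition tangent M p : set V :=
  [set v | M p /\ exists g : R -> V,
     [/\ g 0 = p, \forall t \near (0 : R), M (g t) & is_velocity g v]].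

(* T^c_p M = T_p M \cap J (T_p M), J being multiplication by 'i. *)
Definition ctangent M p : set V :=
  tangent M p `&` [set 'i *: u | u in tangent M p].

(* The J-invariant space T^c_q M is compared with a complex subspace, so k is
   its complex dimension; its real dimension is 2 k. *)
Definition CR_at M p : Prop :=
  M p /\ exists k : nat, \forall q \near p, M q ->
    exists2 W : {vspace V}, \dim W = k & ctangent M q = [set` W].

Definition CR_points M : set V := [set p | CR_at M p].

Definition CR_singular_at M p : Prop := M p /\ ~ CR_at M p.

(* X is a C^1 real vector field near p on C^N = R^{2N}, and DX q v is its
   real derivative at q along v. *)
Definition C1_field_at (X : V -> V) (DX : V -> V -> V) (p : V) : Prop :=
  \forall q \near p, forall v,
    is_velocity (fun t : R => X (q + rtoC t *: v)) (DX q v) /\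
    {for q, continuous (fun q' => DX q' v)}.

(* Vanishing at p of the Levi-map T^c_p M x T^c_p M -> T_p M / T^c_p M,
   (X, Y) |-> [X, Y] mod T^c_p M, i.e. involutivity of T^c M at p.
   Sections of T^c M are extended to ambient vector fields, for which
   [X, Y] = DY X - DX Y; at p this depends on X and Y along M only. *)
Definition Levi_map_vanishes_at M p : Prop :=
  forall (X Y : V -> V) (DX DY : V -> V -> V),
    C1_field_at X DX p -> C1_field_at Y DY p ->
    (\forall q \near p, M q -> ctangent M q (X q)) ->
    (\forall q \near p, M q -> ctangent M q (Y q)) ->
    ctangent M p (DY p (X p) - DX p (Y p)).

Definition Levi_flat M : Prop :=
  forall p, CR_points M p -> Levi_map_vanishes_at M p.

Definition Levi_flat_germ0 M : Prop :=
  \forall p \near (0 : V), CR_points M p -> Levi_map_vanishes_at M p.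

End CRGeometry.

Section Quadrics.
Variables (R : realType) (n : nat).
Implicit Types (a b : 'M[CC R]_n) (z : 'rV[CC R]_n).

Definition A_form a z : CC R :=
  \sum_(j < n) \sum_(k < n) a j k * Num.conj (z 0 j) * z 0 k.

Definition B_form b z : CC R :=
  \sum_(j < n) \sum_(k < n) b j k * Num.conj (z 0 j) * Num.conj (z 0 k).

Definition graph_of (f : 'rV[CC R]_n -> CC R) : set (Cn1 R n) :=
  [set p | wpart p = f (zpart p)].

Definition quadric a b : set (Cn1 R n) :=
  graph_of (fun z => A_form a z + B_form b z).

Inductive normal_form : Type :=
| NF_A of nat
| NF_B of R
| NF_C0
| NF_C1.

Definition in_list (q : normal_form) : Prop :=
  match q with
  | NF_A k => (1 <= k <= n)%N
  | NF_B gam => 0 <= gam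
  | NF_C0 | NF_C1 => True
  end.

(* zc z j is the mathematical coordinate z_j, numbered from 1
   (and 0 when j is out of range). *)
Definition zc z (j : nat) : CC R :=
  if j is i.+1 then oapp (z 0) 0 (insub i : option 'I_n) else 0.

Definition nf_quadric (q : normal_form) : set (Cn1 R n) :=
  graph_of (fun z =>
    match q with
    | NF_A k => \sum_(1 <= j < k.+1) Num.conj (zc z j) ^+ 2
    | NF_B gam => `|zc z 1| ^+ 2 + rtoC gam * Num.conj (zc z 1) ^+ 2
    | NF_C0 => Num.conj (zc z 1) * zc z 2
    | NF_C1 => Num.conj (zc z 1) * zc z 2 + Num.conj (zc z 1) ^+ 2
    end).

End Quadrics.

(* Main.v *)
Require Import Defs.
From HB Require Import structures.
From mathcomp Require Import all_boot all_order all_algebra.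
From mathcomp Require Import complex.
From mathcomp Require Import all_classical all_reals all_analysis.
From mathcomp Require Import ring lra zify.

(** Near the origin [M] is the graph [w = rho z] of [rho = A + B + E], and all
    of its CR geometry is read off the gradients [rho_z] and [rho_zbar] (row
    vectors). A vector [(v, s)] is tangent iff
    [s = v . rho_z + conj v . rho_zbar], and complex tangent iff
    [conj v . rho_zbar = 0] and [s = v . rho_z] ([ctangent_graph]). Where
    [rho_zbar] is nonzero the space of such vectors has dimension [n - 1], so
    [M] is CR there.

    From Levi-flatness to algebra. For an alternating matrix [S] the vector
    [rho_zbar S] is killed by [rho_zbar], so [v = conj (rho_zbar S)] gives a
    complex tangent field [X], and [i X] is another one. Tangency of the
    bracket [[X, i X]] says that the form with matrix [rho_{zbar z}] vanishes
    on [rho_zbar S] ([levi_identity]). Replacing [z] by [t z] and letting [t]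
    tend to zero, only the quadratic part survives: the matrix [a] of [A]
    vanishes, as a sesquilinear form, on every [ell z S], where [ell] is the
    [zbar]-gradient of [A + B]. This is the condition [levi_null].

    Normal forms. Put [B = b + b^T]. Replacing [z] by [omega z] with [omega]
    on the unit circle separates the bidegrees of [levi_null], and linear
    algebra then shows that [a] has rank at most one, [a = p^T c], and that
    [B] is a multiple of [p^T p] unless [a = 0]. So the quadric is the sum of
    [conj (p' z)] times [c z] and a multiple of [conj (p' z)] squared, where
    [p'] is the conjugate of [p]; it becomes a quadric of the list once the
    independent ones among these linear forms are taken as coordinates. If
    [a = 0], the symmetric matrix [B] is diagonalized instead
    ([levi_null_normal_form]). Linearly equivalent quadrics of the list
    coincide ([nf_fun_inj]): the mixed and the pure part are transformed
    separately, and the rank of the pure part, the zeros of the mixed part and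
    the value of [gamma] distinguish them.

    From algebra to Levi-flatness. Differentiating the equations of [T^c]
    along curves in the quadric computes the bracket of two sections at a
    point, and [levi_null] is what makes it complex tangent
    ([levi_null_flat]). Curves in the quadric are not lines, while the fields
    are only given to be continuously differentiable along lines; [C1_hdiff]
    bridges the gap.

    Uniqueness. A local biholomorphism between a quadric and one of the list
    sends points [(t z, t^2 w)] of the first to points of the second. Comparing
    the terms of order two in [t] gives a linear equivalence up to a quadratic
    polynomial in [z] alone, which has bidegree (2,0) and must vanish since
    neither quadric has terms of that bidegree ([locally_lin_equiv]).

    The analytic input is elementary. Power series are differentiated term by
    term through majorants along complex lines ([monomial_taylor],
    [gser_taylor]); this gives continuous first and second derivatives of [E]
    with their orders of vanishing ([real_analytic_O3_C2]), and the second
    order expansion of a holomorphic germ ([holomorphic_second_order]). *)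

Set Implicit Arguments.
Unset Strict Implicit.
Unset Printing Implicit Defensive.

Import Order.TTheory GRing.Theory Num.Theory.
Import numFieldNormedType.Exports.

Local Open Scope classical_set_scope.
Local Open Scope ring_scope.

(** * Bilinear pairing and symmetric forms *)

Section Pairing.
Variable C : numClosedFieldType.

Definition cmx m n (A : 'M[C]_(m, n)) := map_mx Num.conj A.

(** Without conjugation: hermitian pairings are written [dt u (cmx v)]. *)
Definition dt n (u v : 'rV[C]_n) : C := (u *m v^T) 0 0.

Lemma dtE n (u v : 'rV[C]_n) : dt u v = \sum_k u 0 k * v 0 k.
Proof. by rewrite /dt mxE; apply: eq_bigr => k _; rewrite mxE. Qed.

Lemma dtC n (u v : 'rV[C]_n) : dt u v = dt v u.
Proof. by rewrite !dtE; apply: eq_bigr => k _; rewrite mulrC. Qed.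

Lemma dtDl n (u v w : 'rV[C]_n) : dt (u + v) w = dt u w + dt v w.
Proof. by rewrite /dt mulmxDl mxE. Qed.

Lemma dtZl n s (u v : 'rV[C]_n) : dt (s *: u) v = s * dt u v.
Proof. by rewrite /dt -scalemxAl mxE. Qed.

Lemma dtDr n (u v w : 'rV[C]_n) : dt u (v + w) = dt u v + dt u w.
Proof. by rewrite ![dt u _]dtC dtDl. Qed.

Lemma dtZr n s (u v : 'rV[C]_n) : dt u (s *: v) = s * dt u v.
Proof. by rewrite ![dt u _]dtC dtZl. Qed.

Lemma dt0l n (v : 'rV[C]_n) : dt 0 v = 0.
Proof. by rewrite /dt mul0mx mxE. Qed.

Lemma dt0r n (v : 'rV[C]_n) : dt v 0 = 0.
Proof. by rewrite dtC dt0l. Qed.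

Lemma dtNl n (u v : 'rV[C]_n) : dt (- u) v = - dt u v.
Proof. by rewrite -scaleN1r dtZl mulN1r. Qed.

Lemma dtNr n (u v : 'rV[C]_n) : dt u (- v) = - dt u v.
Proof. by rewrite dtC dtNl dtC. Qed.

Lemma dt_mulmx m n (u : 'rV[C]_m) (A : 'M[C]_(m, n)) v :
  dt (u *m A) v = dt u (v *m A^T).
Proof. by rewrite /dt trmx_mul trmxK mulmxA. Qed.

Lemma dt_delta n (u : 'rV[C]_n) j : dt u (delta_mx 0 j) = u 0 j.
Proof.
rewrite dtE (bigD1 j) //= mxE !eqxx mulr1 big1 ?addr0 // => k kj.
by rewrite mxE (negPf kj) andbF mulr0.
Qed.

Lemma dt_scal n (u v : 'rV[C]_n) : u *m v^T = (dt u v)%:M.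
Proof. by rewrite [LHS]mx11_scalar. Qed.

Lemma cmxD m n (A B : 'M[C]_(m, n)) : cmx (A + B) = cmx A + cmx B.
Proof. exact: map_mxD. Qed.

Lemma cmxZ m n s (A : 'M[C]_(m, n)) : cmx (s *: A) = s^* *: cmx A.
Proof. exact: map_mxZ. Qed.

Lemma cmxN m n (A : 'M[C]_(m, n)) : cmx (- A) = - cmx A.
Proof. exact: map_mxN. Qed.

Lemma cmx0 m n : cmx (0 : 'M[C]_(m, n)) = 0.
Proof. exact: map_mx0. Qed.

Lemma cmxM m n p (A : 'M[C]_(m, n)) (B : 'M[C]_(n, p)) :
  cmx (A *m B) = cmx A *m cmx B.
Proof. exact: map_mxM. Qed.

Lemma cmxK m n : involutive (@cmx m n).
Proof. by move=> A; apply/matrixP=> i j; rewrite !mxE conjCK. Qed.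

Lemma dt_conj n (u v : 'rV[C]_n) : (dt u v)^* = dt (cmx u) (cmx v).
Proof.
by rewrite !dtE rmorph_sum; apply: eq_bigr => k _; rewrite rmorphM !mxE.
Qed.

Lemma dt_cmx_eq0 n (z : 'rV[C]_n) : dt z (cmx z) = 0 -> z = 0.
Proof.
rewrite dtE => /eqP; rewrite psumr_eq0 => [/allP z0|k _]; last first.
  by rewrite mxE -normCK exprn_ge0.
apply/rowP=> k; have := z0 k (mem_index_enum _); rewrite mxE -normCK.
by rewrite expf_eq0 normr_eq0 /= mxE => /eqP.
Qed.

Lemma dt_dual n (x : 'rV[C]_n) : x != 0 -> exists w, dt w x = 1.
Proof.
move=> x0; exists ((dt (cmx x) x)^-1 *: cmx x).
rewrite dtZl mulVf //; apply: contra x0 => /eqP xx.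
by rewrite (dt_cmx_eq0 (etrans (dtC _ _) xx)).
Qed.

Lemma dt_eq0P n (x : 'rV[C]_n) : (forall u, dt u x = 0) -> x = 0.
Proof. by move=> x0; apply/rowP=> k; rewrite mxE -dt_delta dtC. Qed.

(** With [w] such that [w . x = 1], each [u] differs from [(u . x) w] by a
    vector orthogonal to [x], so [u a = (u . x) (w a)]: take [c = w a]. *)
Lemma dt_ann n m (x : 'rV[C]_n) (a : 'M[C]_(n, m)) : x != 0 ->
  (forall u, dt u x = 0 -> u *m a = 0) -> exists c : 'rV_m, a = x^T *m c.
Proof.
move=> /dt_dual[w wx] xa; exists (w *m a); apply/row_matrixP => i.
rewrite !rowE mulmxA dt_scal mul_scalar_mx scalemxAl.
apply/eqP; rewrite -subr_eq0 -mulmxBl; apply/eqP/xa.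
by rewrite dtDl dtNl dtZl wx mulr1 subrr.
Qed.

End Pairing.
Arguments cmx {C m n} A.
Arguments dt {C n} u v.

Section SymmetricForms.
Variables (C : numClosedFieldType) (n : nat).
Implicit Types (B : 'M[C]_n).

Lemma dt_symC B (u v : 'rV_n) : B^T = B -> dt (u *m B) v = dt (v *m B) u.
Proof. by move=> Bs; rewrite dt_mulmx Bs dtC. Qed.

(** By polarization. *)
Lemma sym_quad_eq0 B : B^T = B -> (forall v, dt (v *m B) v = 0) -> B = 0.
Proof.
move=> Bs B0; have P u v : dt (u *m B) v = 0.
  have := B0 (u + v); rewrite mulmxDl dtDl !dtDr !B0 add0r addr0.
  rewrite [dt (v *m B) u]dt_symC // -mulr2n => /eqP.
  by rewrite mulrn_eq0 => /eqP.
apply/row_matrixP => i; rewrite row0 rowE.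
by apply: dt_eq0P => u; rewrite dtC P.
Qed.

Lemma sym_anisotropic B : B^T = B -> B != 0 ->
  exists v, dt (v *m B) v != 0.
Proof.
move=> Bs /eqP B0; apply/not_existsP => H; apply: B0; apply: sym_quad_eq0 => //.
by move=> v; apply/eqP; apply: contrapT => /negP/(H v).
Qed.

(** Over an algebraically closed field, a symmetric matrix of rank [r] is the
    sum of squares of [r] linear forms: splitting off the square of [v B],
    where [v B v^T = 1], lowers the rank by one, since [v] joins the kernel. *)
Lemma sym_sum_squares r B : B^T = B -> \rank B = r ->
  exists L : 'M[C]_(r, n), B = L^T *m L.
Proof.
elim: r B => [|r IH] B Bs rB.
  by exists 0; rewrite mulmx0; apply/eqP; rewrite -mxrank_eq0 rB.
have B0 : B != 0 by rewrite -mxrank_eq0 rB.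
have [v0 v0B] := sym_anisotropic Bs B0.
set s := sqrtC (dt (v0 *m B) v0); pose v := s^-1 *: v0.
have s0 : s != 0 by rewrite sqrtC_eq0.
have vB : dt (v *m B) v = 1.
  rewrite -scalemxAl dtZl dtZr mulrA -expr2 exprVn sqrtCK mulVf //.
pose l := v *m B; pose B' := B - l^T *m l.
have lT : l^T = B *m v^T by rewrite /l trmx_mul Bs.
have B's : B'^T = B' by rewrite /B' linearB /= trmx_mul trmxK Bs.
have B'v : B' *m v^T = 0.
  by rewrite /B' mulmxBl -mulmxA dt_scal vB mulmx1 lT subrr.
have sub1 : (B' <= B)%MS.
  rewrite /B' lT /l mulmxA -{1}[B]mul1mx -mulmxBl; exact: submxMl.
have nsub : ~~ (B <= B')%MS.
  apply/negP => /submxP[D BD]; have : B *m v^T = 0.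
    by rewrite BD -mulmxA B'v mulmx0.
  move=> Bv; move/eqP: vB; rewrite dtC /dt trmx_mul Bs Bv mulmx0 mxE.
  by rewrite eq_sym oner_eq0.
have lt : (\rank B' < r.+1)%N.
  by rewrite -rB; have := ltmxErank B' B; rewrite sub1 /= => <-; rewrite /ltmx sub1.
have ge : (r.+1 <= \rank B' + 1)%N.
  rewrite -rB -{1}[B](subrK (l^T *m l)) (leq_trans (mxrank_add _ _)) //.
  by rewrite leq_add2l (leq_trans (mxrankM_maxr _ _)) // rank_leq_row.
have rB' : \rank B' = r.
  by apply/eqP; move: lt ge; rewrite addn1 !ltnS eqn_leq => -> ->.
have [L BL] := IH _ B's rB'.
have BE : (col_mx l L)^T *m col_mx l L = B.
  by rewrite tr_col_mx mul_row_col -BL /B' addrC subrK.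
by exists (col_mx l L : 'M[C]_(1 + r, n)); rewrite -[LHS]BE.
Qed.

(** Independent rows are part of a basis: as coordinate functions, [k]
    independent linear forms can be taken as the first [k] coordinates. *)
Lemma complete_rows k (L : 'M[C]_(k, n)) : row_free L ->
  exists2 T, T \in unitmx & L = pid_mx k *m T.
Proof.
move=> Lf; have kn : (k <= n)%N by rewrite -(eqP Lf) rank_leq_col.
have UL : (pid_mx k : 'M[C]_(k, n)) *m (pid_mx k *m L) = L.
  by rewrite mulmxA mul_pid_mx minnn (minn_idPr kn) pid_mx_1 mul1mx.
have rk : \rank ((pid_mx k : 'M[C]_(k, n)) *m (pid_mx k *m L)) =
            \rank (pid_mx k : 'M[C]_(k, n)).
  by rewrite UL (eqP Lf) rank_pid_mx.
have [T T1 T2] := complete_unitmx rk.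
by exists T => //; rewrite -T2 UL.
Qed.

Lemma sym_diagonalize B : B^T = B ->
  exists2 T, T \in unitmx & B = T^T *m pid_mx (\rank B) *m T.
Proof.
move=> Bs; have [L BL] := sym_sum_squares Bs erefl.
have Lf : row_free L.
  rewrite /row_free eqn_leq rank_leq_row /= {1}BL; exact: mxrankM_maxr.
have [T T1 T2] := complete_rows Lf; exists T => //.
rewrite {1}BL {1 2}T2 trmx_mul mulmxA; congr (_ *m _).
by rewrite -mulmxA tr_pid_mx mul_pid_mx minnn (minn_idPr _) // rank_leq_col.
Qed.

End SymmetricForms.

(** * The algebraic Levi condition on a quadric *)

Section LeviCondition.
Variable C : numClosedFieldType.

(** Under [z |-> w z] with [|w| = 1] the parts of bidegree (2,0), (1,1) and
    (0,2) of a quadratic form in [z, zbar] have the weights [w^2], [1] and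
    [conj w ^ 2]. The values [w = 1], [i] and a square root of [i] already
    give independent equations. *)
Lemma three_weights (P Q R : C) :
  (forall w, `|w| = 1 -> w ^+ 2 * P + Q + w^* ^+ 2 * R = 0) ->
  [/\ P = 0, Q = 0 & R = 0].
Proof.
move=> H.
have w1 : `|1 : C| = 1 by rewrite normr1.
have wi : `|'i : C| = 1 by rewrite normCi.
have ws : `|sqrtC 'i : C| = 1.
  by apply/eqP; rewrite -(@eqrXn2 _ 2) // -normrX sqrtCK normCi expr1n.
have := H _ w1; have := H _ wi; have := H _ ws.
rewrite -rmorphXn /= sqrtCK conjCi sqrrN !sqrCi conjC1 expr1n !mulN1r !mul1r.
move=> E3 E2 E1.
have Q0 : Q = 0.
  apply/eqP; suff : Q *+ 2 == 0 by rewrite mulrn_eq0.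
  apply/eqP; transitivity ((P + Q + R) + (- P + Q - R)); first by ring.
  by rewrite E1 E2 addr0.
have R_ : R = - P by move/eqP: E1; rewrite Q0 addr0 addr_eq0 => /eqP->; rewrite opprK.
have P0 : P = 0.
  move: E3; rewrite Q0 R_ addr0 mulrNN -mulr2n => /eqP.
  by rewrite mulrn_eq0 mulf_eq0 (negPf (neq0Ci C)) => /eqP.
by rewrite R_ P0 oppr0.
Qed.

Variable n : nat.
Implicit Types (a B S : 'M[C]_n) (u v x y z : 'rV[C]_n).

Definition sesq a u v := dt (u *m a) (cmx v).

Lemma sesqDl a u v w : sesq a (u + v) w = sesq a u w + sesq a v w.
Proof. by rewrite /sesq mulmxDl dtDl. Qed.

Lemma sesqDr a u v w : sesq a w (u + v) = sesq a w u + sesq a w v.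
Proof. by rewrite /sesq cmxD dtDr. Qed.

Lemma sesqZl a s u v : sesq a (s *: u) v = s * sesq a u v.
Proof. by rewrite /sesq -scalemxAl dtZl. Qed.

Lemma sesqZr a s u v : sesq a u (s *: v) = s^* * sesq a u v.
Proof. by rewrite /sesq cmxZ dtZr. Qed.

Lemma sesq_polar a u v : sesq a u u = 0 -> sesq a v v = 0 ->
  sesq a (u + v) (u + v) = 0 -> sesq a (u + 'i *: v) (u + 'i *: v) = 0 ->
  sesq a u v = 0.
Proof.
rewrite !sesqDl !sesqDr !sesqZl !sesqZr => -> ->; rewrite !mulr0 conjCi.
rewrite !add0r !addr0 mulNr -mulrN -mulrDr => E1 /eqP.
rewrite mulf_eq0 (negPf (neq0Ci C)) /= addrC subr_eq0 => /eqP E2.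
by move: E1 => /eqP; rewrite E2 -mulr2n mulrn_eq0 => /eqP.
Qed.

Lemma sesq_eq0 a : (forall u, sesq a u u = 0) -> a = 0.
Proof.
move=> a0; have P u v : sesq a u v = 0 by apply: sesq_polar.
apply/row_matrixP => i; rewrite row0 rowE; apply: dt_eq0P => u.
by rewrite dtC -[u]cmxK; apply: P.
Qed.

(** The gradient in [zbar] of [A + B], where [B = b + b^T]. *)
Definition ell a B z := z *m a^T + cmx z *m B.

(** Vanishing of the Levi form: the vectors [conj (ell a B z *m S)] with [S]
    alternating span the complex tangent directions at [z]. *)
Definition levi_null a B := forall S, S^T = - S -> forall z,
  sesq a (ell a B z *m S) (ell a B z *m S) = 0.

(** Every [u] orthogonal to [x] arises: [S = w^T u - u^T w] where
    [w . x = 1]. *)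
Lemma alt_image x u : x != 0 -> dt u x = 0 ->
  exists2 S : 'M[C]_n, S^T = - S & u = x *m S.
Proof.
move=> /dt_dual[w wx] ux; exists (w^T *m u - u^T *m w).
  by rewrite linearB /= !trmx_mul !trmxK opprB.
rewrite mulmxBr !mulmxA !dt_scal ![dt x _]dtC wx ux.
by rewrite mul_scalar_mx scale1r mul_scalar_mx scale0r subr0.
Qed.

Lemma dt_alt x S : S^T = - S -> dt (x *m S) x = 0.
Proof.
move=> Sa; have : dt (x *m S) x = - dt (x *m S) x.
  by rewrite {1}dt_mulmx Sa mulmxN dtNr dtC.
by move/eqP; rewrite -addr_eq0 -mulr2n mulrn_eq0 => /eqP.
Qed.

Section Types.
Variables (a B : 'M[C]_n).
Hypothesis LN : levi_null a B.

Lemma levi_null_polar S S' z : S^T = - S -> S'^T = - S' ->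
  sesq a (ell a B z *m S) (ell a B z *m S') = 0.
Proof.
move=> Sa S'a; apply: sesq_polar; rewrite ?scalemxAr -?mulmxDr; apply: LN => //.
  by rewrite linearD /= Sa S'a opprD.
by rewrite linearD /= linearZ /= Sa S'a scalerN opprD.
Qed.

Lemma levi_null_perp z u v : dt u (ell a B z) = 0 -> dt v (ell a B z) = 0 ->
  ell a B z != 0 -> sesq a u v = 0.
Proof.
move=> u0 v0 l0; have [S Sa ->] := alt_image l0 u0.
have [S' S'a ->] := alt_image l0 v0; exact: levi_null_polar.
Qed.

Lemma levi_null_types S S' z : S^T = - S -> S'^T = - S' ->
  sesq a (z *m a^T *m S) (cmx z *m B *m S') = 0 /\
  sesq a (z *m a^T *m S) (z *m a^T *m S') +
    sesq a (cmx z *m B *m S) (cmx z *m B *m S') = 0.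
Proof.
move=> Sa S'a.
have [|-> ->] // := @three_weights
  (sesq a (z *m a^T *m S) (cmx z *m B *m S'))
  (sesq a (z *m a^T *m S) (z *m a^T *m S') +
    sesq a (cmx z *m B *m S) (cmx z *m B *m S'))
  (sesq a (cmx z *m B *m S) (z *m a^T *m S')).
move=> w w1; have := levi_null_polar (w *: z) Sa S'a.
rewrite /ell cmxZ -!scalemxAl !mulmxDl -!scalemxAl !sesqDl !sesqDr.
rewrite !sesqZl !sesqZr conjCK !expr2.
have ww : w * w^* = 1 by rewrite -normCK w1 expr1n.
have ww' : w^* * w = 1 by rewrite mulrC.
rewrite !mulrA ww ww' !mul1r => <-; ring.
Qed.

Lemma perp_types_zz z u v : z *m a^T != 0 -> cmx z *m B != 0 ->
  dt u (z *m a^T) = 0 -> dt v (cmx z *m B) = 0 -> sesq a u v = 0.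
Proof.
move=> x0 y0 ux vy; have [S Sa ->] := alt_image x0 ux.
by have [S' S'a ->] := alt_image y0 vy; case: (levi_null_types z Sa S'a).
Qed.

Lemma perp_types_mixed z u v : B = 0 -> z *m a^T != 0 ->
  dt u (z *m a^T) = 0 -> dt v (z *m a^T) = 0 -> sesq a u v = 0.
Proof.
move=> B0 x0 ux vx; have [S Sa ->] := alt_image x0 ux.
have [S' S'a ->] := alt_image x0 vx; have [_] := levi_null_types z Sa S'a.
by rewrite B0 mulmx0 !mul0mx [X in _ + X]/sesq mul0mx dt0l addr0.
Qed.

(** If [a] pairs [x^perp] with [y^perp] to zero, where [x = z a^T], and
    [zbar] is not in [y^perp], then [a] has rank one: a vector [u] killing
    [x] pairs to zero with [zbar] as well, hence with everything. *)
Lemma rank_one_of_perp z y : z *m a^T != 0 -> dt (cmx z) y != 0 ->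
  (forall u v, dt u (z *m a^T) = 0 -> dt v y = 0 -> sesq a u v = 0) ->
  exists p c : 'rV[C]_n, p != 0 /\ a = p^T *m c.
Proof.
move=> x0 zy H; have [|c ac] := @dt_ann _ _ _ (z *m a^T) a x0; last first.
  by exists (z *m a^T), c.
move=> u ux; apply: dt_eq0P => v; rewrite dtC -[v]cmxK -/(sesq _ _ _).
set v' := cmx v; pose s := dt v' y / dt (cmx z) y.
rewrite -[v'](subrK (s *: cmx z)) sesqDr sesqZr.
rewrite H //; last by rewrite dtDl dtNl dtZl /s divfK // subrr.
by rewrite /sesq cmxK dt_mulmx ux mulr0 addr0.
Qed.

Hypothesis Bs : B^T = B.

(** By [rank_one_of_perp] it suffices to find one good [z]. If [B = 0], the
    part of bidegree (1,1) of the Levi condition applies with [y = x], and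
    [z] must satisfy [A (z, zbar) <> 0]. Otherwise the part of bidegree (2,0)
    applies with [y = zbar B], and [z] must satisfy both [z a^T <> 0] and
    [zbar B zbar^T <> 0]: two nonzero polynomial conditions, met on the line
    through a [z] satisfying the first in the direction of a [v] satisfying
    the second. *)
Lemma levi_null_rank_one : a != 0 ->
  exists p c : 'rV[C]_n, [/\ p != 0, c != 0 & a = p^T *m c].
Proof.
move=> a0.
suff [p [c [p0 ac]]] : exists p c : 'rV[C]_n, p != 0 /\ a = p^T *m c.
  exists p, c; split => //; apply: contra a0 => /eqP c0.
  by rewrite ac c0 mulmx0.
have [B0|B0] := eqVneq B 0.
  have [z za] : exists z, sesq a z z != 0.
    apply/not_existsP => H; move/eqP: a0; apply; apply: sesq_eq0 => u.
    by apply/eqP; apply: contrapT => /negP /(H u).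
  have zx : dt (cmx (cmx z)) (cmx z *m a^T) != 0.
    by rewrite cmxK -dt_mulmx.
  have x0 : cmx z *m a^T != 0.
    by apply: contra zx => /eqP->; rewrite dt0r.
  apply: (rank_one_of_perp x0 zx) => u v; exact: perp_types_mixed.
have [z [za zB]] : exists z, z *m a^T != 0 /\ dt (cmx z) (cmx z *m B) != 0.
  have [v vB] := sym_anisotropic Bs B0.
  have [va|va] := eqVneq (cmx v *m a^T) 0; last first.
    by exists (cmx v); rewrite cmxK dtC.
  have [z za] : exists z, z *m a^T != 0.
    apply/not_existsP => H; move/eqP: a0; apply; apply: trmx_inj.
    apply/row_matrixP => i; rewrite trmx0 row0 rowE.
    by apply/eqP; apply: contrapT => /negP /H.
  pose q w := dt (w *m B) w.
  have qE s : q (cmx z + s *: v) =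
      q (cmx z) + s * (2 * dt (v *m B) (cmx z)) + s ^+ 2 * q v.
    rewrite /q mulmxDl !dtDl !dtDr -scalemxAl !dtZl !dtZr.
    rewrite [dt (cmx z *m B) v]dt_symC //; ring.
  have [z0|z0] := eqVneq (q (cmx z)) 0; last by exists z; rewrite dtC.
  have [z1|z1] := eqVneq (q (cmx z + 1 *: v)) 0; last first.
    exists (z + cmx v); rewrite mulmxDl va addr0; split => //.
    by rewrite cmxD cmxK dtC -[v]scale1r.
  exists (z - cmx v); rewrite mulmxBl va subr0; split => //.
  rewrite cmxD cmxN cmxK dtC -scaleN1r -/(q _) qE.
  move: z1; rewrite qE z0 !add0r mulN1r sqrrN !expr1n !mul1r => /eqP.
  rewrite addr_eq0 => /eqP->; rewrite opprK -mulr2n mulrn_eq0 /=; exact: vB.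
have y0 : cmx z *m B != 0 by apply: contra zB => /eqP->; rewrite dt0r.
apply: (rank_one_of_perp za zB) => u v; exact: perp_types_zz.
Qed.

(** The Levi condition at [z] now says that [ell z = (c . z) p + zbar B] is a
    multiple of [p] or of [conj c]. If [zbar B] is not a multiple of [p], the
    same holds at [i z], so both [ell z] and [ell (i z)] are multiples of
    [conj c]; hence so is [i ell z + ell (i z) = 2 i (c . z) p], which forces
    [c . z = 0]. But the [z] with [zbar B] not in [C p] form the complement of
    a linear subspace, which lies in the hyperplane [c . z = 0] only if it is
    empty. So the rows of [B] are multiples of [p], and [B] is symmetric. *)
Lemma levi_null_pure (p c : 'rV_n) : p != 0 -> c != 0 -> a = p^T *m c ->
  exists be : C, B = be *: (p^T *m p).
Proof.
move=> p0 c0 ac.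
have lE z : ell a B z = dt c z *: p + cmx z *m B.
  by rewrite /ell ac trmx_mul trmxK mulmxA dt_scal mul_scalar_mx dtC.
have sE u v : sesq a u v = dt u p * dt c (cmx v).
  by rewrite /sesq ac mulmxA dt_scal mul_scalar_mx dtZl.
have par z : (ell a B z <= p)%MS \/ (ell a B z <= cmx c)%MS.
  have [->|l0] := eqVneq (ell a B z) 0; first by left; rewrite sub0mx.
  have swap (t : 'rV[C]_n) : t != 0 ->
      (forall u, dt u (ell a B z) = 0 -> dt u t = 0) -> (ell a B z <= t)%MS.
    move=> t0 H; have [|r tr] := @dt_ann _ _ _ (ell a B z) t^T l0.
      by move=> u /H; rewrite dt_scal => ->; rewrite raddf0.
    have tE : t = r 0 0 *: ell a B z.
      by apply: trmx_inj; rewrite tr linearZ /= [r]mx11_scalar mul_mx_scalar mxE eqxx mulr1n.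
    have r0 : r 0 0 != 0 by apply: contra t0 => /eqP r0; rewrite tE r0 scale0r.
    apply/sub_rVP; exists (r 0 0)^-1.
    by rewrite tE scalerA mulVf // scale1r.
  have [H|/existsNP[u /not_implyP[u1 /eqP u2]]] :=
    pselect (forall u, dt u (ell a B z) = 0 -> dt u p = 0).
    by left; apply: swap.
  right; apply: swap => [|v vl].
    by apply: contra c0 => /eqP cc; rewrite -[c]cmxK cc cmx0.
  have := levi_null_perp u1 vl l0; rewrite sE => /eqP.
  rewrite mulf_eq0 (negPf u2) /= => /eqP cv; apply/eqP.
  by rewrite -conjC_eq0 dt_conj cmxK dtC cv.
have subD z : (ell a B z <= p)%MS = (cmx z *m B <= p)%MS.
  rewrite lE; apply/idP/idP => [H|H].
    rewrite -[cmx z *m B](addrK (dt c z *: p)) [cmx z *m B + _]addrC.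
    by rewrite addmx_sub // eqmx_opp scalemx_sub.
  by rewrite addmx_sub // scalemx_sub.
have ND z : ~~ (cmx z *m B <= p)%MS -> dt c z = 0.
  move=> zD; have [|l1] := par z; first by rewrite subD (negPf zD).
  have [|l2] := par ('i *: z).
    rewrite subD cmxZ -scalemxAl eqmx_scale ?conjC_eq0 ?neq0Ci //.
    by rewrite (negPf zD).
  have : ((2 * 'i * dt c z) *: p <= cmx c)%MS.
    rewrite (_ : _ *: p = 'i *: ell a B z + ell a B ('i *: z)).
      by rewrite addmx_sub // scalemx_sub.
    rewrite !lE cmxZ conjCi dtZr scalerDr scalerA -scalemxAl scaleNr.
    by rewrite addrACA subrr addr0 -scalerDl; congr (_ *: _); ring.
  have [->//|cz] := eqVneq (dt c z) 0.
  have k0 : 2 * 'i * dt c z != 0.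
    by rewrite !mulf_eq0 pnatr_eq0 (negPf (neq0Ci C)) (negPf cz).
  rewrite eqmx_scale // => /sub_rVP[s ps].
  have s0 : s != 0 by apply: contra p0 => /eqP s0; rewrite ps s0 scale0r.
  case/negP: zD; rewrite -subD ps eqmx_scale //.
have D z : (cmx z *m B <= p)%MS.
  apply: contrapT => /negP zD; have [w wc] := dt_dual c0.
  have wD : (cmx w *m B <= p)%MS.
    apply: contrapT => /negP /ND; rewrite dtC wc => /eqP.
    by rewrite oner_eq0.
  have := ND (z + w); rewrite cmxD mulmxDl dtDr (ND _ zD) [dt c w]dtC wc add0r.
  move=> H; suff F : ~~ ((cmx z *m B + cmx w *m B)%R <= p)%MS.
    by have /eqP := H F; rewrite oner_eq0.
  apply: contra zD => H'; rewrite -[cmx z *m B](addrK (cmx w *m B)).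
  by rewrite addmx_sub // eqmx_opp.
have /submxP[d dB] : (B <= p)%MS.
  by apply/row_subP => i; rewrite rowE -[delta_mx _ _]cmxK; apply: D.
have [w wp] := dt_dual p0; exists (dt w d^T).
have : B *m w^T = B^T *m w^T by rewrite Bs.
rewrite dB trmx_mul -!mulmxA dt_scal dtC wp mulmx1 => dE.
have dwE : d^T *m w^T = (dt w d^T)%:M by rewrite -[d^T]/(d^T) dtC -dt_scal.
by rewrite {1}dE dwE mul_mx_scalar scalemxAl.
Qed.
End Types.
End LeviCondition.

(** * Normal forms of quadrics under linear changes *)

Local Arguments zc : simpl never.

Section NormalForms.
Variables (R : realType) (n : nat).
Local Notation C := (CC R).
Implicit Types (a b : 'M[C]_n) (z : 'rV[C]_n) (f g : 'rV[C]_n -> C).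

Lemma rtoC_ge0 (t : R) : (0 <= rtoC t) = (0 <= t).
Proof. by rewrite /rtoC ler0c. Qed.

Lemma rtoC_Re (x : C) : x \is Num.real -> rtoC (complex.Re x) = x.
Proof. exact: RRe_real. Qed.

Lemma nonneg_rtoC (x : C) : 0 <= x -> exists2 t : R, 0 <= t & x = rtoC t.
Proof.
move=> x0; exists (complex.Re x); last by rewrite rtoC_Re // ger0_real.
by rewrite -rtoC_ge0 rtoC_Re // ger0_real.
Qed.

Lemma norm_rtoC (x : C) : exists2 t : R, 0 <= t & `|x| = rtoC t.
Proof. exact: nonneg_rtoC. Qed.

Lemma A_formE a z : A_form a z = dt (cmx z *m a) z.
Proof.
rewrite /A_form dtE exchange_big /=; apply: eq_bigr => k _.
rewrite mxE big_distrl /=; apply: eq_bigr => j _.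
by rewrite mxE [a j k * _]mulrC.
Qed.

Lemma B_formE b z : B_form b z = dt (cmx z *m b) (cmx z).
Proof.
rewrite /B_form dtE exchange_big /=; apply: eq_bigr => k _.
rewrite mxE big_distrl /=; apply: eq_bigr => j _.
by rewrite !mxE [b j k * _]mulrC.
Qed.

Lemma B_form_sym b z :
  B_form b z *+ 2 = dt (cmx z *m (b + b^T)) (cmx z).
Proof. by rewrite B_formE mulmxDr dtDl [X in _ + X]dt_mulmx trmxK [X in _ + X]dtC mulr2n. Qed.

Definition qfun a b z : C := A_form a z + B_form b z.

(** The graphs [w = f z] and [w = g z] correspond under
    [(z, w) |-> (z T, mu w)]. *)
Definition lin_equiv f g := exists T : 'M[C]_n, exists mu : C,
  [/\ T \in unitmx, mu != 0 & forall z, g (z *m T) = mu * f z].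

Lemma lin_equiv_sym f g : lin_equiv f g -> lin_equiv g f.
Proof.
move=> [T [mu [Tu mu0 H]]]; exists (invmx T), mu^-1.
split; rewrite ?unitmx_inv ?invr_eq0 // => z.
by rewrite -{2}[z](mulmxKV Tu) H mulKf.
Qed.

Lemma lin_equiv_trans f g h : lin_equiv f g -> lin_equiv g h -> lin_equiv f h.
Proof.
move=> [T [mu [Tu mu0 H]]] [T' [mu' [Tu' mu0' H']]].
exists (T *m T'), (mu' * mu); split; rewrite ?unitmx_mul ?Tu ?mulf_neq0 //.
by move=> z; rewrite mulmxA H' H mulrA.
Qed.

Definition nfA (q : normal_form R) z : C :=
  match q with
  | NF_A _ => 0
  | NF_B _ => `|zc z 1| ^+ 2
  | NF_C0 | NF_C1 => Num.conj (zc z 1) * zc z 2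
  end.

Definition nfB (q : normal_form R) z : C :=
  match q with
  | NF_A k => \sum_(1 <= j < k.+1) Num.conj (zc z j) ^+ 2
  | NF_B gam => rtoC gam * Num.conj (zc z 1) ^+ 2
  | NF_C0 => 0
  | NF_C1 => Num.conj (zc z 1) ^+ 2
  end.

Definition nf_fun q z : C := nfA q z + nfB q z.

Lemma nf_quadricE q : nf_quadric q = graph_of (nf_fun q).
Proof.
by rewrite /nf_quadric; congr graph_of; apply/funext => z;
  case: q => [k|g||]; rewrite /nf_fun /= ?add0r ?addr0.
Qed.

Lemma zc_ord z (i : 'I_n) : zc z i.+1 = z 0 i.
Proof. by rewrite /zc valK. Qed.

Lemma zcZ (s : C) z j : zc (s *: z) j = s * zc z j.
Proof.
rewrite /zc; case: j => [|j]; first by rewrite mulr0.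
by case: (insub j : option 'I_n) => [i|] /=; rewrite ?mulr0 // mxE.
Qed.

(** [nfA] has bidegree (1,1) and [nfB] has bidegree (0,2). *)
Lemma nfA_rot q w z : `|w| = 1 -> nfA q (w *: z) = nfA q z.
Proof.
move=> w1; case: q => [k|g||] //=; rewrite !zcZ ?normrM ?w1 ?mul1r //;
by rewrite rmorphM mulrACA [w^* * _]mulrC -normCK w1 expr1n mul1r.
Qed.

Lemma nfB_rot q w z : nfB q (w *: z) = w^* ^+ 2 * nfB q z.
Proof.
case: q => [k|g||] /=; rewrite ?mulr0 //.
- rewrite big_distrr /=; apply: eq_bigr => j _.
  by rewrite zcZ rmorphM exprMn.
- by rewrite zcZ rmorphM exprMn mulrCA.
- by rewrite zcZ rmorphM exprMn.
Qed.

Lemma lin_equiv_types q q' : lin_equiv (nf_fun q) (nf_fun q') ->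
  exists T : 'M[C]_n, exists mu : C, [/\ T \in unitmx, mu != 0,
    forall z, nfA q' (z *m T) = mu * nfA q z &
    forall z, nfB q' (z *m T) = mu * nfB q z].
Proof.
move=> [T [mu [Tu mu0 H]]]; exists T, mu.
suff E z : nfA q' (z *m T) - mu * nfA q z = 0 /\
           nfB q' (z *m T) - mu * nfB q z = 0.
  by split => // z; have [/eqP E1 /eqP E2] := E z; apply/eqP; rewrite -subr_eq0.
have [|_ -> ->] // := @three_weights C 0
  (nfA q' (z *m T) - mu * nfA q z) (nfB q' (z *m T) - mu * nfB q z).
move=> w w1; have /eqP := H (w *: z).
rewrite -scalemxAl /nf_fun !nfA_rot // !nfB_rot -subr_eq0 => /eqP E.
by rewrite mulr0 add0r -[RHS]E; ring.
Qed.

Lemma nfB_A_pid k z : (k <= n)%N ->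
  nfB (NF_A R k) z = dt (cmx z *m pid_mx k) (cmx z).
Proof.
move=> kn; rewrite /= big_add1 big_mkord dtE.
rewrite (big_ord_widen n (fun j => (zc z j.+1)^* ^+ 2)) // big_mkcond /=.
apply: eq_bigr => i _; rewrite zc_ord [in RHS]mxE (bigD1 i) //= big1 => [|j ji].
  by rewrite !mxE eqxx addr0 /=; case: ifP; rewrite ?mulr1 -?expr2 // mulr0 mul0r.
by rewrite !mxE (inj_eq val_inj) (negPf ji) mulr0.
Qed.

Section Distinct.
Hypothesis n_ge2 : (2 <= n)%N.
Let i0 : 'I_n := Ordinal (ltnW n_ge2).
Let i1 : 'I_n := Ordinal n_ge2.

Lemma zc1 z : zc z 1 = z 0 i0. Proof. exact: (zc_ord z i0). Qed.
Lemma zc2 z : zc z 2 = z 0 i1. Proof. exact: (zc_ord z i1). Qed.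

Let zcE := (zc1, zc2).

Lemma e01 : exists e0 e1 : 'rV[C]_n,
  [/\ e0 0 i0 = 1, e0 0 i1 = 0, e1 0 i0 = 0 & e1 0 i1 = 1].
Proof. by exists (delta_mx 0 i0), (delta_mx 0 i1); rewrite !mxE. Qed.

Lemma nfA_eq0 q : (forall z, nfA q z = 0) -> exists k, q = NF_A R k.
Proof.
have [e0 [e1 [E1 E2 E3 E4]]] := e01.
case: q => [k|g||] H; first by exists k.
all: have := H (e0 + e1); rewrite /= !zcE !mxE ?E1 ?E2 ?E3 ?E4 /=.
all: by rewrite ?addr0 ?add0r ?normr1 ?conjC1 ?expr1n ?mulr1 => /eqP; rewrite oner_eq0.
Qed.

(** The sums of squares are the normal forms without mixed part, and the
    number of squares is the rank of the pure part. *)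
Lemma lin_equiv_A_l k q : in_list n (NF_A R k) -> in_list n q ->
  lin_equiv (nf_fun (NF_A R k)) (nf_fun q) -> NF_A R k = q.
Proof.
move=> /= /andP[_ kn] qL /lin_equiv_types[T [mu [Tu mu0 HA HB]]].
have [k' qE] : exists k', q = NF_A R k'.
  by apply: nfA_eq0 => z; rewrite -[z](mulmxKV Tu) HA mulr0.
rewrite {}qE in qL HA HB *; move: qL => /= /andP[_ kn'].
congr NF_A; set T' := (cmx T)%R.
have E : T' *m pid_mx k' *m T'^T = mu *: (pid_mx k : 'M[C]_n).
  apply/eqP; rewrite -subr_eq0; apply/eqP/sym_quad_eq0.
    by rewrite linearB linearZ /= !trmx_mul !tr_pid_mx trmxK mulmxA.
  move=> v; rewrite mulmxBr dtDl dtNl -scalemxAr dtZl !mulmxA.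
  rewrite [dt (_ *m T'^T) _]dt_mulmx trmxK -[v]cmxK -cmxM.
  by rewrite -!nfB_A_pid // HB subrr.
have Tu' : T' \in unitmx by rewrite map_unitmx.
have := mxrank_scale_nz (pid_mx k : 'M[C]_n) mu0; rewrite -E.
rewrite mxrankMfree ?row_free_unit ?unitmx_tr //.
have T'f : row_full T' by rewrite row_full_unit.
by rewrite (eqmxMfull _ T'f) !rank_pid_mx // => ->.
Qed.

(** The form [conj z_1 z_2] vanishes on the first two coordinate vectors but
    not on their sum; the zeros of [|z_1|^2] are a linear subspace. *)
Lemma B_C_not_equiv gam q : q = NF_C0 R \/ q = NF_C1 R ->
  ~ lin_equiv (nf_fun q) (nf_fun (NF_B gam)).
Proof.
have [e0 [e1 [E1 E2 E3 E4]]] := e01.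
move=> qC /lin_equiv_types[T [mu [_ mu0 HA _]]].
have {}HA z : `|(z *m T) 0 i0| ^+ 2 = mu * ((z 0 i0)^* * z 0 i1).
  by rewrite -!zcE -[LHS]/(nfA (NF_B gam) _) HA; case: qC => ->.
have /eqP := HA e0; have /eqP := HA e1; have := HA (e0 + e1).
have -> : ((e0 + e1) *m T) 0 i0 = (e0 *m T) 0 i0 + (e1 *m T) 0 i0.
  by rewrite mulmxDl mxE.
rewrite ![(e0 + e1) _ _]mxE E1 E2 E3 E4 addr0 add0r conjC1 conjC0 !mulr1.
rewrite !mulr0 !expf_eq0 /= !normr_eq0 => muE /eqP T1 /eqP T0.
by rewrite -muE T1 T0 addr0 normr0 expr0n /= eqxx in mu0.
Qed.

(** Two of the quadrics with a term [|z_1|^2] are compared at a vector with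
    first coordinate [1]: there the mixed part gives [mu > 0], and the modulus
    of the pure part gives [gamma]. *)
Lemma nf_fun_inj q q' : in_list n q -> in_list n q' ->
  lin_equiv (nf_fun q) (nf_fun q') -> q = q'.
Proof.
have [e0 [e1 [E1 E2 E3 E4]]] := e01.
have BC gam q1 : q1 = NF_C0 R \/ q1 = NF_C1 R ->
    lin_equiv (nf_fun (NF_B gam)) (nf_fun q1) -> False.
  by move=> /B_C_not_equiv H /lin_equiv_sym /H.
have C01 : ~ lin_equiv (nf_fun (NF_C0 R)) (nf_fun (NF_C1 R)).
  move=> /lin_equiv_types[T [mu [Tu _ _ /(_ (e0 *m invmx T))]]].
  rewrite mulmxKV //= zc1 E1 conjC1 expr1n mulr0 => /eqP.
  by rewrite oner_eq0.
case: q => [k|gam||] qL; first by apply: lin_equiv_A_l.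
all: case: q' => [k'|gam'||] qL' E //.
- by rewrite (lin_equiv_A_l qL' qL (lin_equiv_sym E)).
- congr NF_B; have [T [mu [Tu mu0 /(_ e0) HA /(_ e0) HB]]] := lin_equiv_types E.
  move: HA HB; rewrite /= !zc1 E1 normr1 conjC1 !expr1n !mulr1 => HA HB.
  have := congr1 Num.norm HB; rewrite normrM [`|mu * _|]normrM normrX norm_conjC HA.
  have -> : `|mu| = mu by rewrite -HA ger0_norm ?exprn_ge0.
  rewrite mulrC => /(mulfI mu0); rewrite !ger0_norm ?rtoC_ge0 //.
  by move=> /complexI.
- by case: (BC _ _ (or_introl erefl) E).
- by case: (BC _ _ (or_intror erefl) E).
- by rewrite (lin_equiv_A_l qL' qL (lin_equiv_sym E)).
- by case: (B_C_not_equiv (or_introl erefl) E).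
- by rewrite (lin_equiv_A_l qL' qL (lin_equiv_sym E)).
- by case: (B_C_not_equiv (or_intror erefl) E).
- by case: (C01 (lin_equiv_sym E)).
Qed.

Lemma row_free_pair (u v : 'rV[C]_n) : u != 0 -> ~~ (v <= u)%MS ->
  row_free (col_mx u v).
Proof.
move=> u0 vu; rewrite -kermx_eq0; apply/rowV0P => w /sub_kermxP.
rewrite -[w]hsubmxK mul_row_col [lsubmx w]mx11_scalar [rsubmx w]mx11_scalar.
rewrite !mul_scalar_mx; set s := lsubmx w 0 0; set t := rsubmx w 0 0 => E.
have t0 : t = 0.
  apply/eqP; apply: contraNT vu => t0; apply/sub_rVP; exists (- (t^-1 * s)).
  have /eqP := E; rewrite addrC addr_eq0 => /eqP tv.
  by rewrite -[v]scale1r -(mulVf t0) -scalerA tv scalerN scalerA scaleNr.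
move: E; rewrite t0 scale0r addr0 => /eqP; rewrite scaler_eq0 (negPf u0) orbF.
by move=> /eqP ->; rewrite raddf0 row_mx0.
Qed.

Lemma complete1 (u : 'rV[C]_n) : u != 0 ->
  exists2 T : 'M[C]_n, T \in unitmx & forall z, (z *m T) 0 i0 = dt z u.
Proof.
move=> u0; have uf : row_free u by rewrite /row_free rank_rV u0.
have [T Tu uT] := complete_rows uf; exists T^T; first by rewrite unitmx_tr.
move=> z; rewrite -dt_delta dt_mulmx trmxK uT; congr (dt _ (_ *m _)).
by apply/rowP=> j; rewrite !mxE /= -val_eqE /= eq_sym andbT.
Qed.

Lemma complete2 (u v : 'rV[C]_n) : u != 0 -> ~~ (v <= u)%MS ->
  exists2 T : 'M[C]_n, T \in unitmx &
    forall z, (z *m T) 0 i0 = dt z u /\ (z *m T) 0 i1 = dt z v.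
Proof.
move=> u0 vu; have [T Tu uT] := complete_rows (row_free_pair u0 vu).
exists T^T; first by rewrite unitmx_tr.
move=> z; rewrite -!dt_delta !dt_mulmx trmxK; split; congr (dt _ _).
  rewrite -[u](@col_mxKu _ 1 1 _ _ v) uT -mul_usub_mx; congr (_ *m _).
  by apply/rowP=> j; rewrite !mxE /= -val_eqE /= eq_sym andbT.
rewrite -[v](@col_mxKd _ 1 1 _ u) uT -mul_dsub_mx; congr (_ *m _).
by apply/rowP=> j; rewrite !mxE /= -val_eqE /= eq_sym andbT.
Qed.

(** When [a <> 0], the quadric is [conj (u . z) (c . z) + be' conj (u . z)^2]
    with [u = conj p]. If [c] and [u] are independent, they become the first
    two coordinates, and [be'], if it is not zero, is absorbed in the second
    coordinate and in [w]. If [c] is a multiple of [u], the mixed part is a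
    multiple of [|u . z|^2], and rotating the first coordinate makes the
    coefficient of the pure part nonnegative. *)
Lemma levi_null_normal_form a b : levi_null a (b + b^T) ->
  (exists z, qfun a b z != 0) ->
  exists2 q, in_list n q & lin_equiv (qfun a b) (nf_fun q).
Proof.
set B := b + b^T => LN [z0 q0].
have Bs : B^T = B by rewrite /B linearD /= trmxK addrC.
have qE z : qfun a b z = dt (cmx z *m a) z + dt (cmx z *m B) (cmx z) / 2.
  rewrite /qfun A_formE -B_form_sym -[B_form b z *+ 2]mulr_natr mulfK //.
have [a0|a0] := eqVneq a 0.
  have B0 : B != 0.
    by apply: contra q0 => /eqP B0; rewrite qE a0 B0 !mulmx0 !dt0l mul0r addr0.
  have [T Tu BT] := sym_diagonalize Bs.
  have rn : (\rank B <= n)%N by exact: rank_leq_row.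
  exists (NF_A R (\rank B)); first by rewrite /= lt0n mxrank_eq0 B0.
  exists (cmx T^T), 2; split; rewrite ?map_unitmx ?unitmx_tr ?pnatr_eq0 // => z.
  rewrite qE a0 mulmx0 dt0l add0r mulrC divfK ?pnatr_eq0 //.
  rewrite /nf_fun nfB_A_pid //= add0r cmxM cmxK {2}BT.
  by rewrite !mulmxA [RHS]dt_mulmx.
have [p [c [p0 c0 ac]]] := levi_null_rank_one LN Bs a0.
have [be BE] := levi_null_pure LN Bs p0 c0 ac.
set be' := be / 2; pose u := cmx p.
have u0 : u != 0 by apply: contra p0 => /eqP u0; rewrite -[p]cmxK -/u u0 cmx0.
have {}qE z : qfun a b z = (dt z u)^* * dt z c + be' * (dt z u)^* ^+ 2.
  rewrite qE ac BE -scalemxAr dtZl !mulmxA !dt_scal !mul_scalar_mx !dtZl.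
  rewrite dt_conj cmxK.
  by rewrite [dt p _]dtC [dt c z]dtC /be' expr2; ring.
have [cu|cu] := boolP (c <= u)%MS; last first.
  have [be0|be0] := eqVneq be' 0.
    have [T Tu TE] := complete2 u0 cu; exists (NF_C0 R) => //.
    exists T, 1; split; rewrite ?oner_eq0 // => z; have [T1 T2] := TE z.
    by rewrite /nf_fun /= zc1 zc2 T1 T2 qE be0 mul0r mul1r.
  have [|T Tu TE] := complete2 (v := be'^-1 *: c) u0.
    by rewrite eqmx_scale ?invr_eq0.
  exists (NF_C1 R) => //.
  exists T, be'^-1; split; rewrite ?invr_eq0 // => z; have [T1 T2] := TE z.
  by rewrite /nf_fun /= zc1 zc2 T1 T2 qE dtZr mulrDr mulKf // mulrCA.
have [k cE] := sub_rVP cu.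
have k0 : k != 0 by apply: contra c0 => /eqP k0; rewrite cE k0 scale0r.
have [gam gam0 gamE] := norm_rtoC (be' / k).
have [tau tau1 tauE] : exists2 tau : C, `|tau| = 1 &
    `|be' / k| * tau^* ^+ 2 = be' / k.
  have [be0|be0] := eqVneq (be' / k) 0.
    by exists 1; rewrite ?normr1 // be0 normr0 mul0r.
  exists (sqrtC (be' / k / `|be' / k|))^*.
    rewrite norm_conjC; apply/eqP; rewrite -(@eqrXn2 _ 2) // -normrX sqrtCK.
    by rewrite normf_div normr_id divff ?normr_eq0 // expr1n.
  by rewrite conjCK sqrtCK mulrC divfK // normr_eq0.
have tau0 : tau != 0 by rewrite -normr_eq0 tau1 oner_eq0.
have [|T Tu TE] := @complete1 (tau *: u).
  by rewrite scaler_eq0 negb_or tau0.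
exists (NF_B gam) => //.
exists T, k^-1; split; rewrite ?invr_eq0 // => z.
rewrite /nf_fun /= zc1 TE -gamE dtZr normrM tau1 mul1r rmorphM exprMn mulrA.
rewrite tauE qE cE dtZr normCK mulrDr; congr (_ + _).
  by rewrite mulrCA mulKf // mulrC.
by rewrite mulrA [k^-1 * _]mulrC.
Qed.
End Distinct.
End NormalForms.

(** * Taylor estimates for monomials along complex lines *)

Section Majorants.
Variable C : numClosedFieldType.
Implicit Types p q P Q : {poly C}.

Definition majorizes P p := forall k, `|p`_k| <= P`_k.

Lemma majorizes1 : majorizes 1 1.
Proof. by move=> k; rewrite coef1 normr_nat. Qed.

Lemma majorizesM P p Q q : majorizes P p -> majorizes Q q ->
  majorizes (P * Q) (p * q).
Proof.
move=> Pp Qq k; rewrite !coefM (le_trans (ler_norm_sum _ _ _)) //.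
by apply: ler_sum => j _; rewrite normrM ler_pM.
Qed.

Lemma majorizesX P p k : majorizes P p -> majorizes (P ^+ k) (p ^+ k).
Proof.
move=> Pp; elim: k => [|k IH]; first by rewrite !expr0; apply: majorizes1.
by rewrite !exprS; apply: majorizesM.
Qed.

Lemma majorizes_prod (I : finType) (P p : I -> {poly C}) :
  (forall i, majorizes (P i) (p i)) -> majorizes (\prod_i P i) (\prod_i p i).
Proof.
move=> H; elim/big_ind2: _ => [|P1 p1 P2 p2|i _ //]; first exact: majorizes1.
exact: majorizesM.
Qed.

Lemma majorizes_line (a b A B : C) : `|a| <= A -> `|b| <= B ->
  majorizes (A%:P + B *: 'X) (a%:P + b *: 'X).
Proof.
move=> aA bB k; rewrite !coefD !coefC !coefZ !coefX.
case: k => [|[|k]] /=; rewrite ?mulr0 ?mulr1 ?addr0 ?add0r //.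
by rewrite normr0.
Qed.

Lemma majorizes_horner1 P p k : majorizes P p ->
  `|p`_k| <= P.[1] /\ \sum_(k <= i < maxn (size p) (size P) + k.+2) P`_i <= P.[1].
Proof.
move=> Pp; have P0 i : 0 <= P`_i by apply: le_trans (Pp i).
set n := (_ + k.+2)%N.
have E : P.[1] = \sum_(0 <= i < n) P`_i.
  rewrite (@horner_coef_wide _ n) ?big_mkord; last first.
    by rewrite /n (leq_trans (leq_maxr (size p) _)) // leq_addr.
  by apply: eq_bigr => i _; rewrite expr1n mulr1.
have kn : (k < n)%N by rewrite /n; lia.
rewrite E (@big_cat_nat _ _ _ k) //=; last exact: ltnW.
have G : 0 <= \sum_(0 <= i < k) P`_i by rewrite sumr_ge0.
split; last by rewrite lerDr.
rewrite (le_trans (Pp k)) // (@big_cat_nat _ _ _ k.+1 k n) //= big_nat1 addrCA.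
by rewrite lerDl addr_ge0 ?sumr_ge0.
Qed.

(** The tail of order [k] of [p.[t]] is at most [|t|^k] times the sum of the
    coefficients of the majorant [P], which is [P.[1]]. *)
Lemma majorizes_taylor P p t : majorizes P p -> `|t| <= 1 ->
  [/\ `|p.[t]| <= P.[1], `|p.[t] - p`_0| <= `|t| * P.[1] &
      `|p.[t] - p`_0 - t * p`_1| <= `|t| ^+ 2 * P.[1]].
Proof.
move=> Pp t1; have P0 i : 0 <= P`_i by apply: le_trans (Pp i).
have tail k : `|p.[t] - \sum_(0 <= i < k) p`_i * t ^+ i| <= `|t| ^+ k * P.[1].
  have [_] := majorizes_horner1 k Pp; set n := (_ + k.+2)%N => H.
  have kn : (k <= n)%N by rewrite /n; lia.
  rewrite (@horner_coef_wide _ n p t); last first.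
    by rewrite /n (leq_trans (leq_maxl _ (size P))) // leq_addr.
  rewrite -(big_mkord xpredT (fun i => p`_i * t ^+ i)) (@big_cat_nat _ _ _ k) //=.
  rewrite addrAC subrr add0r (le_trans (ler_norm_sum _ _ _)) //.
  apply: le_trans (ler_wpM2l _ H); last by rewrite exprn_ge0.
  rewrite big_distrr /= big_nat_cond [leRHS]big_nat_cond.
  apply: ler_sum => i /andP[/andP[ki _] _].
  rewrite normrM normrX mulrC ler_pM ?exprn_ge0 //.
  by rewrite -(subnKC ki) exprD ler_piMr ?exprn_ge0 // exprn_ile1.
have := (tail 0, tail 1, tail 2)%N; rewrite !big_nat_recr ?big_geq //=.
rewrite add0r subr0 !expr0 mul1r mulr1 expr1 => -[[H0 H1] H2]; split => //.
by move: H2; rewrite expr1 opprD addrA [t * _]mulrC.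
Qed.

End Majorants.

Lemma deriv_prod (A : comNzRingType) (I : eqType) (r : seq I)
    (F : I -> {poly A}) : uniq r ->
  (\prod_(i <- r) F i)^`() =
  \sum_(i <- r) (F i)^`() * \prod_(j <- r | j != i) F j.
Proof.
elim: r => [|i r IH]; first by rewrite !big_nil derivC.
move=> /andP[ir ur]; rewrite !big_cons derivM (IH ur) eqxx /=; congr (_ + _).
  congr (_ * _); rewrite big_seq [RHS]big_seq_cond; apply: eq_bigl => j.
  by case jr: (j \in r) => //=; apply/esym; apply: contraNneq ir => <-.
rewrite big_distrr /= big_seq [RHS]big_seq; apply: eq_bigr => j jr.
rewrite big_cons; case: eqP => [ij|_]; first by rewrite ij jr in ir.
by rewrite mulrCA.
Qed.

Section Monomials.
Variables (R : realType) (N : nat).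
Local Notation C := (CC R).
Implicit Types (x u : 'rV[C]_N) (al : mindex N).

(** The restriction of a monomial to the complex line through [x] in the
    direction [u] ([line_polyE]). *)
Definition line_poly x u al : {poly C} :=
  \prod_(i < N) ((x 0 i)%:P + u 0 i *: 'X) ^+ al i.

Lemma line_polyE x u al t : (line_poly x u al).[t] = monomial (x + t *: u) al.
Proof.
rewrite /line_poly horner_prod; apply: eq_bigr => i _.
by rewrite horner_exp hornerD hornerC hornerZ hornerX !mxE mulrC.
Qed.

(** Lowering the [i]-th exponent; the coefficient [al i] of the derivative
    makes the truncation harmless. *)
Definition mlower (i : 'I_N) al : mindex N := [ffun j => (al j - (j == i))%N].

Lemma line_poly_coef1 x u al : (line_poly x u al)`_1 =
  \sum_i u 0 i * ((al i)%:R * monomial x (mlower i al)).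
Proof.
have -> : (line_poly x u al)`_1 = (line_poly x u al)^`().[0].
  by rewrite horner_coef0 coef_deriv mulr1n.
rewrite /line_poly deriv_prod ?index_enum_uniq // horner_sum.
apply: eq_bigr => i _; rewrite hornerM horner_prod deriv_exp.
rewrite hornerMn hornerM horner_exp !derivD derivC derivZ derivX add0r.
rewrite !hornerD !hornerZ hornerX !hornerC mulr0 addr0 mulr1.
rewrite /monomial [\prod_(k < N) _](bigD1 i) //= ffunE eqxx subn1.
rewrite -[u 0 i * x 0 i ^+ _ *+ _]mulr_natl -!mulrA mulrCA; congr (_ * (_ * (_ * _))).
apply: eq_bigr => j ji; rewrite ffunE (negPf ji) subn0.
by rewrite horner_exp hornerD hornerC hornerZ hornerX mulr0 addr0.
Qed.

(** The majorant replaces each factor [x_i + u_i t] by [r/2 + (r/2) t]. Its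
    value at [1] is [r^|al|], the weight under which the power series is
    absolutely summable. *)
Lemma line_poly_major x u al (r : R) :
  (forall i, `|x 0 i| <= rtoC (r / 2)) -> (forall i, `|u 0 i| <= rtoC (r / 2)) ->
  exists2 P : {poly C}, majorizes P (line_poly x u al) &
    P.[1] = rtoC (r ^+ mdegree al).
Proof.
move=> xr ur; set h := rtoC (r / 2).
exists (\prod_(i < N) (h%:P + h *: 'X) ^+ al i).
  by apply: majorizes_prod => i; apply/majorizesX/majorizes_line.
rewrite horner_prod.
under eq_bigr => i _ do rewrite horner_exp hornerD hornerC hornerZ hornerX mulr1.
have -> : h + h = rtoC r by rewrite /h /rtoC -rmorphD /= -splitr.
by rewrite prodrXr /rtoC rmorphXn.
Qed.

Lemma monomial_taylor x u al (r : R) t :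
  (forall i, `|x 0 i| <= rtoC (r / 2)) -> (forall i, `|u 0 i| <= rtoC (r / 2)) ->
  `|t| <= 1 ->
  [/\ `|monomial (x + t *: u) al - monomial x al|
        <= `|t| * rtoC (r ^+ mdegree al) &
      `|monomial (x + t *: u) al - monomial x al -
        t * \sum_i u 0 i * ((al i)%:R * monomial x (mlower i al))|
        <= `|t| ^+ 2 * rtoC (r ^+ mdegree al)].
Proof.
move=> xr ur t1; have [P Pp PE] := line_poly_major al xr ur.
have [_ H1 H2] := majorizes_taylor Pp t1.
have E0 : (line_poly x u al)`_0 = monomial x al.
  by rewrite -horner_coef0 line_polyE scale0r addr0.
by move: H1 H2; rewrite E0 line_poly_coef1 line_polyE PE.
Qed.

Lemma mdegree_lowerE i al : (0 < al i)%N ->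
  mdegree al = (mdegree (mlower i al)).+1.
Proof.
move=> ai; rewrite /mdegree (bigD1 i) //= [in RHS](bigD1 i) //= ffunE eqxx subn1.
rewrite -addSn prednK //; congr (_ + _)%N.
by apply: eq_bigr => j ji; rewrite ffunE (negPf ji) subn0.
Qed.

Lemma monomial_le x al (r : R) : (forall i, `|x 0 i| <= rtoC r) ->
  `|monomial x al| <= rtoC (r ^+ mdegree al).
Proof.
move=> xr; rewrite /monomial normr_prod /rtoC rmorphXn /= -prodrXr.
by apply: ler_prod => i _; rewrite normr_ge0 normrX lerXn2r ?nnegrE // (le_trans _ (xr i)).
Qed.

Lemma monomialZ s x al : monomial (s *: x) al = s ^+ mdegree al * monomial x al.
Proof.
rewrite /monomial /mdegree -prodrXr -big_split /=.
by apply: eq_bigr => i _; rewrite mxE exprMn.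
Qed.

End Monomials.

(** * Limits of complex sequences *)

Section ComplexLimits.
Variable R : realType.
Local Notation C := (CC R).

Lemma rtoCD (x y : R) : rtoC (x + y) = rtoC x + rtoC y.
Proof. exact: rmorphD. Qed.

Lemma rtoCB (x y : R) : rtoC (x - y) = rtoC x - rtoC y.
Proof. exact: rmorphB. Qed.

Lemma rtoCN (x : R) : rtoC (- x) = - rtoC x.
Proof. exact: rmorphN. Qed.

Lemma rtoCM (x y : R) : rtoC (x * y) = rtoC x * rtoC y.
Proof. exact: rmorphM. Qed.

Lemma rtoCX (x : R) k : rtoC (x ^+ k) = rtoC x ^+ k.
Proof. exact: rmorphXn. Qed.

Lemma rtoCV (x : R) : rtoC x^-1 = (rtoC x)^-1.
Proof. exact: fmorphV. Qed.

Lemma rtoC0 : rtoC (0 : R) = 0. Proof. exact: rmorph0. Qed.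

Lemma rtoC1 : rtoC (1 : R) = 1. Proof. exact: rmorph1. Qed.

Lemma rtoC_nat k : rtoC (k%:R : R) = k%:R.
Proof. exact: rmorph_nat. Qed.

Lemma rtoC_le (x y : R) : (rtoC x <= rtoC y) = (x <= y).
Proof. exact: lecR. Qed.

Lemma rtoC_lt (x y : R) : (rtoC x < rtoC y) = (x < y).
Proof. exact: ltcR. Qed.

Lemma rtoC_gt0 (x : R) : (0 < rtoC x) = (0 < x).
Proof. by rewrite -rtoC0 rtoC_lt. Qed.

Lemma rtoC_eq0 (x : R) : (rtoC x == 0) = (x == 0).
Proof. exact: fmorph_eq0. Qed.

Lemma norm_rtoCE (x : R) : `|rtoC x| = rtoC `|x|.
Proof. by rewrite normc_def /= expr0n addr0 sqrtr_sqr. Qed.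

Lemma conj_rtoC (x : R) : (rtoC x)^* = rtoC x.
Proof. by rewrite conj_Creal //; apply/complex_realP; exists x. Qed.

Lemma posC (e : C) : 0 < e -> exists2 t : R, 0 < t & e = rtoC t.
Proof.
move=> e0; exists (complex.Re e); last by rewrite rtoC_Re // gtr0_real.
by rewrite -rtoC_gt0 rtoC_Re // gtr0_real.
Qed.

Lemma cvg_rtoC (T : Type) (F : set_system T) (FF : Filter F) (f : T -> R) (l : R) :
  f x @[x --> F] --> l -> rtoC (f x) @[x --> F] --> rtoC l.
Proof.
move=> /cvgrPdist_lt H; apply/cvgrPdist_lt => e /posC[t t0 ->].
have := H t t0; apply: filterS => x.
by rewrite -rtoCB norm_rtoCE rtoC_lt.
Qed.

Lemma cvg_conj (T : Type) (F : set_system T) (FF : Filter F) (f : T -> C) (l : C) :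
  f x @[x --> F] --> l -> (f x)^* @[x --> F] --> l^*.
Proof.
move=> /cvgrPdist_lt H; apply/cvgrPdist_lt => e /H; apply: filterS => x.
by rewrite -rmorphB norm_conjC.
Qed.

Lemma cvgC_sum (T : Type) (F : set_system T) (FF : Filter F) (I : Type)
    (r : seq I) (f : I -> T -> C) (l : I -> C) :
  (forall i, f i x @[x --> F] --> l i) ->
  \sum_(i <- r) f i x @[x --> F] --> \sum_(i <- r) l i.
Proof.
move=> H; elim: r => [|i r IH].
  rewrite big_nil (_ : (fun x => _) = fun=> 0); first exact: cvg_cst.
  by apply/funext => x; rewrite big_nil.
rewrite big_cons (_ : (fun x => _) = fun x => f i x + \sum_(j <- r) f j x).
  by apply: cvgD; [apply: H|apply: IH].
by apply/funext => x; rewrite big_cons.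
Qed.

Lemma norm_lim_le (T : Type) (F : set_system T) (FF : ProperFilter F)
    (f : T -> C) (l : C) (M : R) :
  f x @[x --> F] --> l -> (\forall x \near F, `|f x| <= rtoC M) ->
  `|l| <= rtoC M.
Proof.
move=> fl fM; have [t t0 lt] := norm_rtoC l.
rewrite lt rtoC_le leNgt; apply/negP => Mt.
have e0 : 0 < rtoC (t - M) by rewrite rtoC_gt0 subr_gt0.
move/cvgrPdist_lt: fl => /(_ _ e0) fl.
have H : \forall x \near F, `|l - f x| < rtoC (t - M) /\ `|f x| <= rtoC M.
  exact: filterI.
have [x [H1 H2]] := filter_ex H.
have : `|l| < rtoC t.
  rewrite -[l](subrK (f x)) (le_lt_trans (ler_normD _ _)) //.
  have -> : rtoC t = rtoC (t - M) + rtoC M by rewrite -rtoCD subrK.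
  exact: ltr_leD.
by rewrite lt ltxx.
Qed.

Lemma Re_norm_le (x : C) (t : R) : `|x| <= rtoC t -> `|complex.Re x| <= t.
Proof. by move=> H; rewrite -rtoC_le (le_trans (normc_ge_Re x)). Qed.

(** Domination by [S] makes [Re u + S] nondecreasing and bounded, so it
    converges, as does [S]. *)
Lemma cvg_Re_dominated (u : nat -> C) (S : nat -> R) (K : R) :
  (forall m n, (m <= n)%N -> `|u n - u m| <= rtoC (S n - S m)) ->
  (forall n, S n <= K) ->
  exists l : R, complex.Re (u n) @[n --> \oo] --> l.
Proof.
move=> uS SK.
have ReB m n : (m <= n)%N -> `|complex.Re (u n) - complex.Re (u m)| <= S n - S m.
  by move=> mn; have := Re_norm_le (uS _ _ mn); rewrite raddfB.
have Sm m n : (m <= n)%N -> S m <= S n.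
  by move=> mn; rewrite -subr_ge0 (le_trans _ (ReB _ _ mn)).
have S_cvg : cvgn S.
  apply: nondecreasing_is_cvgn; first by move=> m n; exact: Sm.
  by exists K => _ [n _ <-].
have T_cvg : cvgn (fun n => complex.Re (u n) + S n).
  apply: nondecreasing_is_cvgn => [m n mn|].
    have := ReB _ _ mn; rewrite ler_norml => /andP[H _]; lra.
  exists (complex.Re (u 0%N) - S 0%N + K + K) => _ [n _ <-].
  have := ReB _ _ (leq0n n); rewrite ler_norml => /andP[_ H].
  have := SK n; lra.
exists (limn (fun n => complex.Re (u n) + S n) - limn S).
rewrite (_ : (fun n => _) = (fun n => (complex.Re (u n) + S n) - S n)).
  exact: cvgB.
by apply/funext => n; rewrite addrK.
Qed.

(** The imaginary part of [u] is the real part of [- i u]. *)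
Lemma cvg_dominated (u : nat -> C) (S : nat -> R) (K : R) :
  (forall m n, (m <= n)%N -> `|u n - u m| <= rtoC (S n - S m)) ->
  (forall n, S n <= K) -> exists l : C, u n @[n --> \oo] --> l.
Proof.
move=> uS SK; have [l1 H1] := cvg_Re_dominated uS SK.
have [|l2 H2] := @cvg_Re_dominated (fun n => - 'i%C * u n) S K _ SK.
  move=> m n mn; rewrite -mulrBr normrM (_ : `|- 'i%C| = 1) ?mul1r ?uS //.
  by rewrite normrN normc_def /= expr0n add0r expr1n sqrtr1.
exists (rtoC l1 + 'i%C * rtoC l2).
rewrite (_ : (fun n => _) =
  (fun n => rtoC (complex.Re (u n)) + 'i%C * rtoC (complex.Re (- 'i%C * u n)))).
  by apply: cvgD; [exact: cvg_rtoC|apply: cvgMr; exact: cvg_rtoC].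
apply/funext => n; rewrite {1}[u n]complexE; congr (_ + _ * rtoC _).
by rewrite mulNr raddfN /= mulrC ReiNIm opprK.
Qed.
End ComplexLimits.

(** * Term-by-term differentiation of power series *)

Section GeneralizedSeries.
Variables (R : realType) (N : nat).
Local Notation C := (CC R).
Implicit Types (x u : 'rV[C]_N) (al m : mindex N).

Definition csum (F : mindex N -> C) d : C :=
  \sum_(m : {ffun 'I_N -> 'I_d}) F (mindex_of m).

Definition widen_cube d D (dD : (d <= D)%N) (m : {ffun 'I_N -> 'I_d}) :
  {ffun 'I_N -> 'I_D} := [ffun i => widen_ord dD (m i)].

Lemma csum_widen F d D (dD : (d <= D)%N) : csum F d =
  \sum_(m : {ffun 'I_N -> 'I_D} | [forall i, (m i < d)%N]) F (mindex_of m).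
Proof.
pose h := widen_cube dD.
have hI : injective h.
  move=> m m' /ffunP E; apply/ffunP => i; have := E i; rewrite !ffunE.
  by move/(congr1 val) => /= /val_inj.
have -> : csum F d = \sum_(m in [set: {ffun 'I_N -> 'I_d}]%SET) F (mindex_of (h m)).
  rewrite /csum; apply: eq_big => [m|m _]; first by rewrite inE.
  by congr F; apply/ffunP => i; rewrite !ffunE.
rewrite -(big_imset (fun m : {ffun 'I_N -> 'I_D} => F (mindex_of m))) /=; last by move=> ? ? _ _; apply: hI.
apply: eq_bigl => m; apply/imsetP/forallP => [[m' _ ->] i|H].
  by rewrite ffunE /=.
exists [ffun i => Ordinal (H i)]; first by rewrite inE.
by apply/ffunP => i; rewrite !ffunE; apply: val_inj.
Qed.

(** The increments of the partial sums of [F] are thus dominated by those of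
    any majorant of [F]. *)
Lemma csum_sub F d D : (d <= D)%N -> csum F D - csum F d =
  \sum_(m : {ffun 'I_N -> 'I_D} | ~~ [forall i, (m i < d)%N]) F (mindex_of m).
Proof.
move=> dD; rewrite (csum_widen F dD) {1}/csum (bigID (fun m : {ffun 'I_N -> 'I_D} => [forall i, (m i < d)%N])) /=.
by rewrite addrAC subrr add0r.
Qed.

Lemma csum_cvg (F B : mindex N -> C) (K : R) :
  (forall m, `|F m| <= B m) -> (forall d, csum B d <= rtoC K) ->
  exists2 l, csum F d @[d --> \oo] --> l & `|l| <= rtoC K.
Proof.
move=> FB BK.
have B0 m : 0 <= B m by apply: le_trans (FB m).
have BR d : rtoC (complex.Re (csum B d)) = csum B d.
  by rewrite rtoC_Re // ger0_real // sumr_ge0.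
have [| |l Fl] := @cvg_dominated R (csum F) (fun d => complex.Re (csum B d)) K.
- move=> m n mn; rewrite rtoCB !BR !csum_sub // (le_trans (ler_norm_sum _ _ _)) //.
  exact: ler_sum.
- by move=> d; rewrite -rtoC_le BR.
exists l => //; apply: norm_lim_le Fl _; near=> d.
by rewrite (le_trans (ler_norm_sum _ _ _)) // (le_trans _ (BK d)) // ler_sum.
Unshelve. all: by end_near.
Qed.

Lemma csumD F G d : csum (fun m => F m + G m) d = csum F d + csum G d.
Proof. exact: big_split. Qed.

Lemma csumZ s F d : csum (fun m => s * F m) d = s * csum F d.
Proof. by rewrite /csum big_distrr. Qed.

Lemma csumB F G d : csum (fun m => F m - G m) d = csum F d - csum G d.
Proof. exact: sumrB. Qed.

Lemma csum_lim_norm (F B : mindex N -> C) (K : R) (l : C) :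
  (forall m, `|F m| <= B m) -> (forall d, csum B d <= rtoC K) ->
  csum F d @[d --> \oo] --> l -> `|l| <= rtoC K.
Proof.
move=> FB BK Fl; have [l' Fl' l'K] := csum_cvg FB BK.
by rewrite (cvg_unique _ Fl Fl').
Qed.

(** A power series whose [m]-th term is a multiple of the monomial of exponent
    [e m]: differentiating term by term changes the exponents but keeps the
    index set, so that no rearrangement is needed. *)
Definition gser (c : mindex N -> C) (e : mindex N -> mindex N) (r K : R)
    (f : 'rV[C]_N -> C) : Prop :=
  [/\ 0 < r,
      forall d, csum (fun m => `|c m| * rtoC (r ^+ mdegree (e m))) d <= rtoC K
    & forall x, (forall i, `|x 0 i| < rtoC r) ->
        csum (fun m => c m * monomial x (e m)) d @[d --> \oo] --> f x].

Lemma pseries_gser c r f : pseries_on c r f -> exists K, gser c id r K f.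
Proof. by move=> [r0 [K HK] H]; exists K. Qed.

Section Fixed.
Variables (c : mindex N -> C) (e : mindex N -> mindex N) (r K : R).
Variable f : 'rV[C]_N -> C.
Hypothesis fE : gser c e r K f.

Let r0 : 0 < r. Proof. by case: fE. Qed.

Lemma gser_K_ge0 : 0 <= K.
Proof.
case: fE => _ H _; rewrite -rtoC_ge0; apply: le_trans (H 0%N).
by apply: sumr_ge0 => m _; rewrite mulr_ge0 // rtoC_ge0 exprn_ge0 // ltW.
Qed.

(** Differentiating in [x_i] costs half of the radius: the factor [al_i] is at
    most [2^|al|], and is absorbed when [r] is replaced by [r / 2]. *)
Lemma gser_partial i : exists g,
  gser (fun m => c m * (e m i)%:R) (fun m => mlower i (e m)) (r / 2) (K * (2 / r)) g.
Proof.
have [_ bK _] := fE; have r20 : 0 < r / 2 by rewrite divr_gt0.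
have key m : `|c m * (e m i)%:R| * rtoC ((r / 2) ^+ mdegree (mlower i (e m)))
    <= rtoC (2 / r) * (`|c m| * rtoC (r ^+ mdegree (e m))).
  rewrite normrM normr_nat mulrCA -mulrA ler_wpM2l //.
  have [->|ei] := posnP (e m i).
    by rewrite mul0r -rtoCM rtoC_ge0 mulr_ge0 ?exprn_ge0 ?divr_ge0 // ltW.
  rewrite (mdegree_lowerE ei) -rtoC_nat -!rtoCM.
  rewrite rtoC_le expr_div_n exprS.
  set k := mdegree _.
  have -> : 2 / r * (r * r ^+ k) = r ^+ k * 2.
    by rewrite mulrA divfK ?gt_eqF // mulrC.
  rewrite mulrCA ler_wpM2l ?exprn_ge0 ?(ltW r0) //.
  have e2 : (e m i <= 2 * 2 ^ k)%N.
    rewrite (leq_trans (ltnW (ltn_expl _ (ltnSn 1)))) // -expnS leq_exp2l //.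
    rewrite /k -(mdegree_lowerE ei) /mdegree (bigD1 i) //=; exact: leq_addr.
  rewrite ler_pdivrMr ?exprn_gt0 //.
  by rewrite -natrX -natrM ler_nat.
have bound d : csum (fun m => `|c m * (e m i)%:R| *
    rtoC ((r / 2) ^+ mdegree (mlower i (e m)))) d <= rtoC (K * (2 / r)).
  apply: (@le_trans _ _ (csum (fun m => rtoC (2 / r) *
      (`|c m| * rtoC (r ^+ mdegree (e m)))) d)); first by apply: ler_sum => m _.
  rewrite csumZ mulrC rtoCM ler_wpM2r // rtoC_ge0 divr_ge0 // ltW //.
have cvgx x : exists l : C, (forall i, `|x 0 i| < rtoC (r / 2)) ->
    csum (fun m => c m * (e m i)%:R * monomial x (mlower i (e m))) d @[d --> \oo] --> l.
  have [xr|xr] := pselect (forall i, `|x 0 i| < rtoC (r / 2)); last by exists (0 : C).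
  have dom m : `|c m * (e m i)%:R * monomial x (mlower i (e m))| <=
      `|c m * (e m i)%:R| * rtoC ((r / 2) ^+ mdegree (mlower i (e m))).
    by rewrite normrM ler_wpM2l // monomial_le // => j; exact: ltW.
  by have [l Hl _] := csum_cvg dom bound; exists l.
have [g Hg] := choice cvgx; exists g; split => // x; exact: Hg.
Qed.

(** The estimates [monomial_taylor] are summed. They need [x] and [u] in the
    half polydisc, so that [x + t u] stays in the polydisc of summability, and
    are uniform in [x], which gives continuity as well as differentiability. *)
Lemma gser_taylor (g : 'I_N -> 'rV[C]_N -> C) x u t :
  (forall i, gser (fun m => c m * (e m i)%:R) (fun m => mlower i (e m))
    (r / 2) (K * (2 / r)) (g i)) ->
  (forall i, `|x 0 i| < rtoC (r / 2)) -> (forall i, `|u 0 i| <= rtoC (r / 2)) ->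
  `|t| <= 1 ->
  `|f (x + t *: u) - f x| <= `|t| * rtoC K /\
  `|f (x + t *: u) - f x - t * \sum_i u 0 i * g i x| <= `|t| ^+ 2 * rtoC K.
Proof.
move=> gE xr ur t1; have [_ bK fcvg] := fE.
have r2 : rtoC (r / 2) + rtoC (r / 2) = rtoC r by rewrite -rtoCD -splitr.
have fx : csum (fun m => c m * monomial x (e m)) d @[d --> \oo] --> f x.
  apply: fcvg => i; rewrite (lt_le_trans (xr i)) // rtoC_le; have := r0; lra.
have fxt : csum (fun m => c m * monomial (x + t *: u) (e m)) d @[d --> \oo] -->
    f (x + t *: u).
  apply: fcvg => i; rewrite !mxE -r2 (le_lt_trans (ler_normD _ _)) //.
  by rewrite ltr_leD // normrM (le_trans _ (ur i)) // ler_piMl.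
have gx : csum (fun m => c m * \sum_i u 0 i * ((e m i)%:R * monomial x (mlower i (e m)))) d
    @[d --> \oo] --> \sum_i u 0 i * g i x.
  rewrite (_ : (fun d => _) = (fun d => \sum_i u 0 i *
    csum (fun m => c m * (e m i)%:R * monomial x (mlower i (e m))) d)); last first.
    apply/funext => d; under [RHS]eq_bigr => i _ do rewrite -csumZ.
    rewrite [RHS]exchange_big /=; apply: eq_bigr => m _.
    rewrite big_distrr /=; apply: eq_bigr => i _.
    by rewrite mulrCA !mulrA.
  apply: cvgC_sum => i; apply: cvgMr; have [_ _ H] := gE i; exact: H.
have T m := monomial_taylor (e m) (fun i => ltW (xr i)) ur t1.
have [s s0 st] := norm_rtoC t; split.
  have E : `|t| * rtoC K = rtoC (s * K) by rewrite rtoCM st.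
  rewrite E; apply: (csum_lim_norm (F := fun m => c m * monomial (x + t *: u) (e m) -
      c m * monomial x (e m)) (B := fun m => `|t| * (`|c m| * rtoC (r ^+ mdegree (e m))))).
  - by move=> m; rewrite -mulrBr normrM mulrCA ler_wpM2l //; case: (T m).
  - by move=> d; rewrite csumZ -E ler_wpM2l.
  - rewrite (_ : (fun d => _) = (fun d => csum (fun m => c m * monomial (x + t *: u) (e m)) d
      - csum (fun m => c m * monomial x (e m)) d)); first by apply: cvgB; [apply: fxt|apply: fx].
    by apply/funext => d; rewrite csumB.
have E : `|t| ^+ 2 * rtoC K = rtoC (s ^+ 2 * K) by rewrite rtoCM rtoCX st.
rewrite E; apply: (csum_lim_norm (F := fun m => c m * monomial (x + t *: u) (e m) -
      c m * monomial x (e m) -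
      t * (c m * \sum_i u 0 i * ((e m i)%:R * monomial x (mlower i (e m)))))
    (B := fun m => `|t| ^+ 2 * (`|c m| * rtoC (r ^+ mdegree (e m))))).
- move=> m; rewrite [t * (_ * _)]mulrCA -!mulrBr normrM mulrCA ler_wpM2l //.
  by case: (T m).
- by move=> d; rewrite csumZ -E ler_wpM2l // exprn_ge0.
- rewrite (_ : (fun d => _) = (fun d => csum (fun m => c m * monomial (x + t *: u) (e m)) d
      - csum (fun m => c m * monomial x (e m)) d -
      t * csum (fun m => c m * \sum_i u 0 i * ((e m i)%:R * monomial x (mlower i (e m)))) d)).
    apply: cvgB; first by apply: cvgB; [apply: fxt|apply: fx].
    by apply: cvgMr; apply: gx.
  by apply/funext => d; rewrite csumB csumB csumZ.
Qed.

(** In degree [d >= k], [s^d = (s/r)^d r^d] is at most [(s/r)^k r^d], and the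
    terms of degree [d], weighted by [r^d], sum up to at most [K]. *)
Lemma gser_small k x (s : R) :
  (forall m, (mdegree (e m) < k)%N -> c m = 0) ->
  0 <= s -> s < r -> (forall i, `|x 0 i| <= rtoC s) ->
  `|f x| <= rtoC ((s / r) ^+ k * K).
Proof.
move=> c0 s0 sr xs; have [_ bK fcvg] := fE.
have sr1 : s / r <= 1 by rewrite ler_pdivrMr // mul1r ltW.
have sr0 : 0 <= s / r by rewrite divr_ge0 // ltW.
apply: (csum_lim_norm (F := fun m => c m * monomial x (e m))
  (B := fun m => rtoC ((s / r) ^+ k) * (`|c m| * rtoC (r ^+ mdegree (e m))))).
- move=> m; rewrite normrM mulrCA; have [mk|km] := ltnP (mdegree (e m)) k.
    by rewrite c0 // normr0 !mul0r.
  rewrite ler_wpM2l // (le_trans (monomial_le _ xs)) // -rtoCM rtoC_le.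
  have -> : s ^+ mdegree (e m) = (s / r) ^+ mdegree (e m) * r ^+ mdegree (e m).
    by rewrite -exprMn divfK // gt_eqF.
  rewrite ler_wpM2r ?exprn_ge0 ?(ltW r0) // -(subnKC km) exprD.
  by rewrite ler_piMr ?exprn_ge0 // exprn_ile1.
- by move=> d; rewrite csumZ rtoCM ler_wpM2l // rtoC_ge0 exprn_ge0.
- by apply: fcvg => i; rewrite (le_lt_trans (xs i)) // rtoC_lt.
Qed.

End Fixed.
End GeneralizedSeries.

(** * Velocities and differentiability along curves *)

Section Velocities.
Variable R : realType.
Local Notation C := (CC R).

Lemma cvg_rowP N (T : Type) (F : set_system T) (FF : Filter F)
    (f : T -> 'rV[C]_N) (l : 'rV[C]_N) :
  f x @[x --> F] --> l <-> forall i, f x 0 i @[x --> F] --> l 0 i.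
Proof.
split=> [H i|H]; apply/cvg_ballP => e e0.
  by move/cvg_ballP: H => /(_ e e0); apply: filterS => x [_ Hx]; apply: Hx.
have {}H i : \forall x \near F, ball (l 0 i) e (f x 0 i).
  by move: e e0; apply/cvg_ballP; apply: H.
have {}H := filter_forall FF H; apply: filterS H => x Hx; split => // i j.
by rewrite !ord1; apply: Hx.
Qed.

Lemma near_rowP N (p : 'rV[C]_N) (P : 'rV[C]_N -> Prop) :
  (\forall z \near p, P z) <->
  exists2 d : R, 0 < d & forall z : 'rV[C]_N, (forall i, `|z 0 i - p 0 i| < rtoC d) -> P z.
Proof.
split=> [/nbhs_ballP[e /= e0 H]|[d d0 H]].
  have [d d0 ed] := posC e0; exists d => // z zp; apply: H; split => // i j.
  by rewrite !ord1 ed /ball /= distrC.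
apply/nbhs_ballP; exists (rtoC d); first by rewrite /= rtoC_gt0.
by move=> z [_ zp]; apply: H => i; rewrite distrC; apply: zp.
Qed.

(** The scalar counterpart of [is_velocity]. *)
Definition svel (g : R -> C) (d : C) : Prop :=
  (rtoC t)^-1 * (g t - g 0) @[t --> (0 : R)^'] --> d.

Lemma is_velocityP N (g : R -> 'rV[C]_N) v :
  is_velocity g v <-> forall i, svel (fun t => g t 0 i) (v 0 i).
Proof.
rewrite /is_velocity cvg_rowP; split=> H i; have := H i; rewrite /svel;
  set f1 := (X in X x @[x --> _] --> _ -> _); set f2 := (X in _ -> X x @[x --> _] --> _);
  suff -> : f1 = f2 by [].
all: by apply/funext => t; rewrite /f1 /f2 !mxE.
Qed.

Lemma svel_unique g d d' : svel g d -> svel g d' -> d = d'.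
Proof. by move=> H H'; apply: cvg_unique H H'. Qed.

Lemma rtoC_cvg0 : rtoC t @[t --> (0 : R)^'] --> (0 : C).
Proof. by rewrite -(rtoC0 R); apply: cvg_rtoC; apply: cvg_within. Qed.

Lemma near_neq0 : \forall t \near (0 : R)^', t != 0.
Proof. by rewrite near_withinE; near=> t. Unshelve. all: by end_near. Qed.

Lemma svel_cvg g d : svel g d -> g t @[t --> (0 : R)^'] --> g 0.
Proof.
move=> H; have E : rtoC t * ((rtoC t)^-1 * (g t - g 0)) + g 0 @[t --> (0 : R)^']
    --> 0 * d + g 0.
  by apply: cvgD; [apply: cvgM; [apply: rtoC_cvg0|apply: H]|apply: cvg_cst].
rewrite mul0r add0r in E; apply: cvg_trans E; apply: near_eq_cvg.
apply: filterS near_neq0 => t t0.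
by rewrite mulVKf ?rtoC_eq0 // subrK.
Qed.

Lemma svel_near (g h : R -> C) d : g 0 = h 0 ->
  (\forall t \near (0 : R)^', g t = h t) -> svel g d -> svel h d.
Proof.
move=> g0 gh; apply: cvg_trans; apply: near_eq_cvg.
by apply: filterS gh => t ->; rewrite g0.
Qed.

Lemma svel_cst c : svel (fun=> c) 0.
Proof.
rewrite /svel (_ : (fun _ => _) = fun=> 0); first exact: cvg_cst.
by apply/funext => t; rewrite subrr mulr0.
Qed.

Lemma svel_id : svel (fun t => rtoC t) 1.
Proof.
have E : (fun=> 1 : C) t @[t --> (0 : R)^'] --> (1 : C) by exact: cvg_cst.
apply: cvg_trans E; apply: near_eq_cvg.
by apply: filterS near_neq0 => t t0; rewrite rtoC0 subr0 mulVf // rtoC_eq0.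
Qed.

Lemma svelD g h a b : svel g a -> svel h b -> svel (fun t => g t + h t) (a + b).
Proof.
move=> H1 H2; rewrite /svel (_ : (fun t => _) =
  fun t => (rtoC t)^-1 * (g t - g 0) + (rtoC t)^-1 * (h t - h 0)).
  by apply: cvgD; [apply: H1|apply: H2].
by apply/funext => t; rewrite -mulrDr opprD addrACA.
Qed.

Lemma svelM g h a b : svel g a -> svel h b ->
  svel (fun t => g t * h t) (a * h 0 + g 0 * b).
Proof.
move=> H1 H2.
rewrite /svel (_ : (fun t => _) = fun t =>
    (rtoC t)^-1 * (g t - g 0) * h t + g 0 * ((rtoC t)^-1 * (h t - h 0))).
  apply: cvgD; first by apply: cvgM; [apply: H1|apply: svel_cvg H2].
  by apply: cvgMr; apply: H2.
apply/funext => t; rewrite [X in _ = _ + X]mulrCA -[X in _ = X + _]mulrA -mulrDr; congr (_ * _).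
by rewrite mulrBl mulrBr addrA subrK.
Qed.

Lemma svelZ s g a : svel g a -> svel (fun t => s * g t) (s * a).
Proof. by move=> H; have := svelM (svel_cst s) H; rewrite mul0r add0r. Qed.

Lemma svel_conj g a : svel g a -> svel (fun t => (g t)^*) (a^*).
Proof.
move=> H; rewrite /svel (_ : (fun t => _) = fun t => ((rtoC t)^-1 * (g t - g 0))^*).
  by apply: cvg_conj; apply: H.
by apply/funext => t; rewrite -rtoCV -[in LHS]rmorphB -{1}(conj_rtoC t^-1) rmorphM.
Qed.

Lemma svel_sum (I : Type) (r : seq I) (g : I -> R -> C) (d : I -> C) :
  (forall i, svel (g i) (d i)) ->
  svel (fun t => \sum_(i <- r) g i t) (\sum_(i <- r) d i).
Proof.
move=> H; elim: r => [|i r IH].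
  rewrite big_nil (_ : (fun t => _) = fun=> 0); first exact: svel_cst.
  by apply/funext => t; rewrite big_nil.
rewrite big_cons (_ : (fun t => _) = fun t => g i t + \sum_(j <- r) g j t).
  by apply: svelD; [apply: H|apply: IH].
by apply/funext => t; rewrite big_cons.
Qed.

Lemma is_velocity_line N (p v : 'rV[C]_N) : is_velocity (fun t => p + rtoC t *: v) v.
Proof.
apply/is_velocityP => i.
rewrite (_ : (fun t => _) = (fun t => p 0 i + rtoC t * v 0 i)); last first.
  by apply/funext => t; rewrite !mxE.
rewrite -[v 0 i]add0r; apply: svelD; first exact: svel_cst.
have := svelM svel_id (svel_cst (v 0 i)).
by rewrite mulr0 addr0 mul1r add0r.
Qed.

Lemma is_velocity_cvg N (g : R -> 'rV[C]_N) v : is_velocity g v ->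
  g t @[t --> (0 : R)^'] --> g 0.
Proof.
by move=> /is_velocityP H; apply/cvg_rowP => i; apply: svel_cvg (H i).
Qed.

Lemma cvg_Ot (f g : R -> C) (l : C) (K : R) :
  (\forall t \near (0 : R)^', `|f t - g t| <= rtoC (`|t| * K)) ->
  g t @[t --> (0 : R)^'] --> l -> f t @[t --> (0 : R)^'] --> l.
Proof.
move=> fg gl; have fg0 : f t - g t @[t --> (0 : R)^'] --> (0 : C).
  apply/cvgrPdist_lt => _ /posC[e e0 ->].
  have K1 : 0 < `|K| + 1 by rewrite ltr_wpDl.
  have eK : 0 < e / (`|K| + 1) by rewrite divr_gt0.
  apply: filterS2 fg (@dnbhs0_lt R R _ eK) => t H te.
  rewrite sub0r normrN (le_lt_trans H) // rtoC_lt.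
  rewrite (le_lt_trans (ler_wpM2l _ (ler_norm K))) //.
  move: te; rewrite ltr_pdivlMr // => /le_lt_trans -> //.
  by rewrite ler_wpM2l // lerDl.
rewrite (_ : f = fun t => (f t - g t) + g t); last first.
  by apply/funext => t; rewrite subrK.
by rewrite -[l]add0r; apply: cvgD; [apply: fg0|apply: gl].
Qed.

(** Hadamard differentiability. Curves other than lines are needed because
    tangent vectors are velocities of curves contained in [M]. *)
Definition hdiff N (f : 'rV[C]_N -> C) (x : 'rV[C]_N) (D : 'rV[C]_N -> C) :=
  forall g v, g 0 = x -> is_velocity g v -> svel (fun t => f (g t)) (D v).

Lemma hdiff_near N (f h : 'rV[C]_N -> C) x D :
  (\forall y \near x, f y = h y) -> hdiff f x D -> hdiff h x D.
Proof.
move=> fh H g v g0 gv; apply: (svel_near _ _ (H g v g0 gv)).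
  by rewrite g0; apply: (nbhs_singleton fh).
have := is_velocity_cvg gv; rewrite g0 => /(_ _ fh); exact.
Qed.

(** Along a curve [g t = x + t q t] the estimate applies with [u] a fixed
    multiple of [q t], which stays bounded since it converges. *)
Lemma hdiff_taylor N (f : 'rV[C]_N -> C) (x d : 'rV[C]_N) (del K : R) :
  0 < del ->
  (forall (u : 'rV[C]_N) (t : C), (forall i, `|u 0 i| <= rtoC del) -> `|t| <= 1 ->
    `|f (x + t *: u) - f x - t * dt u d| <= `|t| ^+ 2 * rtoC K) ->
  hdiff f x (fun v => dt v d).
Proof.
move=> del0 H g v g0 gv.
pose q t := (rtoC t)^-1 *: (g t - g 0).
have qv : q t @[t --> (0 : R)^'] --> v by [].
have [B B0 vB] : exists2 B : R, 0 < B & forall i, `|v 0 i| < rtoC B.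
  exists (\sum_i complex.Re `|v 0 i| + 1); last first.
    move=> i; rewrite (bigD1 i) // -addrA rtoCD rtoC_Re ?normr_real // ltrDl.
    rewrite rtoC_gt0 ltr_wpDl ?ltr01 // sumr_ge0 // => j _.
    by rewrite -rtoC_ge0 rtoC_Re ?normr_real.
  rewrite ltr_wpDl ?ltr01 // sumr_ge0 // => j _.
  by rewrite -rtoC_ge0 rtoC_Re ?normr_real.
have qB : \forall t \near (0 : R)^', forall i, `|q t 0 i| <= rtoC B.
  apply: filter_forall => i.
  have e0 : 0 < rtoC B - `|v 0 i| by rewrite subr_gt0.
  have qi : q t 0 i @[t --> (0 : R)^'] --> v 0 i by move/cvg_rowP: qv; apply.
  move/cvgrPdist_lt: qi => /(_ _ e0).
  apply: filterS => t /ltW Ht.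
  rewrite -[q t 0 i](subrK (v 0 i)) (le_trans (ler_normD _ _)) // distrC.
  by rewrite -lerBrDr.
set s := del / B; have s0 : 0 < s by rewrite divr_gt0.
have ts : \forall t \near (0 : R)^', `|t| <= s.
  apply: filterS (@dnbhs0_lt R R s s0) => t; exact: ltW.
have est : \forall t \near (0 : R)^',
    `|(rtoC t)^-1 * (f (g t) - f (g 0)) - dt (q t) d| <= rtoC (`|t| * (K / s ^+ 2)).
  near=> t.
  have t0 : t != 0 by near: t; exact: near_neq0.
  have tC0 : rtoC t != 0 by rewrite rtoC_eq0.
  have sC0 : rtoC s != 0 by rewrite rtoC_eq0 gt_eqF.
  have gE : g t = x + (rtoC t / rtoC s) *: (rtoC s *: q t).
    by rewrite scalerA divfK // /q scalerA divff // scale1r g0 addrC subrK.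
  have H1 i : `|(rtoC s *: q t) 0 i| <= rtoC del.
    rewrite mxE normrM norm_rtoCE (gtr0_norm s0).
    rewrite (le_trans (ler_wpM2l _ (_ : _ <= rtoC B))) ?rtoC_ge0 ?(ltW s0) //.
      by have : forall i, `|q t 0 i| <= rtoC B by near: t.
    by rewrite -rtoCM /s divfK // gt_eqF.
  have H2 : `|rtoC t / rtoC s| <= 1.
    rewrite -rtoCV -rtoCM norm_rtoCE -rtoC1 rtoC_le normrM normfV (gtr0_norm s0).
    by rewrite ler_pdivrMr // mul1r; near: t.
  have := H _ _ H1 H2; rewrite -gE g0 dtZl mulrA divfK // => H3.
  rewrite -[_ - dt (q t) d](mulKf tC0) normrM normfV mulrBr mulVKf //.
  rewrite ler_pdivrMl ?normr_gt0 //; apply: le_trans H3 _.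
  have E1 : `|rtoC t / rtoC s| = rtoC (`|t| / s).
    by rewrite -rtoCV -rtoCM norm_rtoCE normrM normfV (gtr0_norm s0).
  rewrite E1 norm_rtoCE -rtoCX -!rtoCM rtoC_le expr_div_n.
  by rewrite [leRHS](_ : _ = `|t| ^+ 2 / s ^+ 2 * K) // expr2; ring.
apply: cvg_Ot est _; rewrite dtE.
rewrite (_ : (fun t => _) = fun t => \sum_i q t 0 i * d 0 i); last first.
  by apply/funext => t; rewrite dtE.
apply: cvgC_sum => i; apply: cvgMl; move: i; by apply/cvg_rowP.
Unshelve. all: by end_near.
Qed.
End Velocities.

(** * Real derivatives of functions of z and its conjugate *)

Section VelocityCalculus.
Variable R : realType.
Local Notation C := (CC R).

Lemma is_velocityD N (g h : R -> 'rV[C]_N) u v :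
  is_velocity g u -> is_velocity h v -> is_velocity (fun t => g t + h t) (u + v).
Proof.
move=> /is_velocityP gu /is_velocityP hv; apply/is_velocityP => i.
rewrite mxE (_ : (fun t => _) = fun t => g t 0 i + h t 0 i).
  by apply: svelD; [apply: gu|apply: hv].
by apply/funext => t; rewrite mxE.
Qed.

Lemma is_velocityZ N s (g : R -> 'rV[C]_N) u :
  is_velocity g u -> is_velocity (fun t => s *: g t) (s *: u).
Proof.
move=> /is_velocityP gu; apply/is_velocityP => i.
rewrite mxE (_ : (fun t => _) = fun t => s * g t 0 i).
  by apply: svelZ; apply: gu.
by apply/funext => t; rewrite mxE.
Qed.

Lemma is_velocity_cmx N (g : R -> 'rV[C]_N) u :
  is_velocity g u -> is_velocity (fun t => cmx (g t)) (cmx u).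
Proof.
move=> /is_velocityP gu; apply/is_velocityP => i.
rewrite mxE (_ : (fun t => _) = fun t => (g t 0 i)^*).
  by apply: svel_conj; apply: gu.
by apply/funext => t; rewrite mxE.
Qed.

Lemma svel_dt N (g h : R -> 'rV[C]_N) u v :
  is_velocity g u -> is_velocity h v ->
  svel (fun t => dt (g t) (h t)) (dt u (h 0) + dt (g 0) v).
Proof.
move=> /is_velocityP gu /is_velocityP hv.
rewrite (_ : (fun t => _) = fun t => \sum_i g t 0 i * h t 0 i); last first.
  by apply/funext => t; rewrite dtE.
rewrite !dtE -big_split /=; apply: svel_sum => i.
by apply: svelM; [apply: gu|apply: hv].
Qed.

Lemma is_velocity_mulmx N m (A : 'M[C]_(N, m)) (g : R -> 'rV[C]_N) u :
  is_velocity g u -> is_velocity (fun t => g t *m A) (u *m A).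
Proof.
move=> /is_velocityP gu; apply/is_velocityP => i.
rewrite mxE (_ : (fun t => _) = fun t => \sum_j g t 0 j * A j i).
  apply: svel_sum => j; have := svelM (gu j) (svel_cst (A j i)).
  by rewrite mulr0 addr0.
by apply/funext => t; rewrite mxE.
Qed.

Lemma is_velocity_row_mx N m (g : R -> 'rV[C]_N) (h : R -> 'rV[C]_m) u v :
  is_velocity g u -> is_velocity h v ->
  is_velocity (fun t => row_mx (g t) (h t)) (row_mx u v).
Proof.
move=> /is_velocityP gu /is_velocityP hv; apply/is_velocityP => i.
case: (splitP i) => j ij.
  have -> : i = lshift m j by apply: val_inj.
  rewrite row_mxEl (_ : (fun t => _) = fun t => g t 0 j); first exact: gu.
  by apply/funext => t; rewrite row_mxEl.
have -> : i = rshift N j by apply: val_inj.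
rewrite row_mxEr (_ : (fun t => _) = fun t => h t 0 j); first exact: hv.
by apply/funext => t; rewrite row_mxEr.
Qed.

Lemma is_velocity_lsubmx N m (g : R -> 'rV[C]_(N + m)) u :
  is_velocity g u -> is_velocity (fun t => lsubmx (g t)) (lsubmx u).
Proof.
move=> /is_velocityP gu; apply/is_velocityP => i.
rewrite mxE (_ : (fun t => _) = fun t => g t 0 (lshift m i)); first exact: gu.
by apply/funext => t; rewrite mxE.
Qed.

Lemma is_velocity_rsubmx N m (g : R -> 'rV[C]_(N + m)) u :
  is_velocity g u -> is_velocity (fun t => rsubmx (g t)) (rsubmx u).
Proof.
move=> /is_velocityP gu; apply/is_velocityP => i.
rewrite mxE (_ : (fun t => _) = fun t => g t 0 (rshift N i)); first exact: gu.
by apply/funext => t; rewrite mxE.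
Qed.

Lemma is_velocity_unique N (g : R -> 'rV[C]_N) u v :
  is_velocity g u -> is_velocity g v -> u = v.
Proof.
move=> /is_velocityP H /is_velocityP H'; apply/rowP => i.
exact: svel_unique (H i) (H' i).
Qed.

Lemma is_velocity_scalar (g : R -> C) u :
  svel g u -> is_velocity (fun t => (g t)%:M : 'rV[C]_1) u%:M.
Proof.
move=> gu; apply/is_velocityP => i.
rewrite (_ : (fun t => _) = g); first by rewrite !ord1 mxE mulr1n.
by apply/funext => t; rewrite !ord1 mxE mulr1n.
Qed.

Lemma is_velocity_near N (g h : R -> 'rV[C]_N) u : g 0 = h 0 ->
  (\forall t \near (0 : R)^', g t = h t) -> is_velocity g u -> is_velocity h u.
Proof.
move=> g0 gh /is_velocityP H; apply/is_velocityP => i.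
apply: (svel_near _ _ (H i)); first by rewrite g0.
by apply: filterS gh => t ->.
Qed.

(** The graph of the conjugation, along which real-analytic functions are
    restrictions of holomorphic ones. *)
Definition zz N (z : 'rV[C]_N) : 'rV[C]_(N + N) := row_mx z (cmx z).

Lemma dt_row_mx N m (u v : 'rV[C]_N) (u' v' : 'rV[C]_m) :
  dt (row_mx u u') (row_mx v v') = dt u v + dt u' v'.
Proof. by rewrite /dt tr_row_mx mul_row_col mxE. Qed.

Lemma dt_zz N (v : 'rV[C]_N) (L : 'rV[C]_(N + N)) :
  dt (zz v) L = dt v (lsubmx L) + dt (cmx v) (rsubmx L).
Proof. by rewrite -{1}[L]hsubmxK dt_row_mx. Qed.

Lemma zz_norm N (z : 'rV[C]_N) (P : C -> Prop) :
  (forall i, P `|z 0 i|) -> forall i, P `|zz z 0 i|.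
Proof.
move=> H i; case: (splitP i) => j ij.
  have -> : i = lshift N j by apply: val_inj.
  by rewrite /zz row_mxEl.
have -> : i = rshift N j by apply: val_inj.
by rewrite /zz row_mxEr mxE norm_conjC.
Qed.

Lemma is_velocity_zz N (g : R -> 'rV[C]_N) u :
  is_velocity g u -> is_velocity (fun t => zz (g t)) (zz u).
Proof. by move=> gu; apply: is_velocity_row_mx; [apply: gu|apply: is_velocity_cmx gu]. Qed.

(** [L] is the row of Wirtinger derivatives of [f] at [z], first in [z], then
    in [zbar]. *)
Definition rdiff N (f : 'rV[C]_N -> C) z (L : 'rV[C]_(N + N)) :=
  hdiff f z (fun v => dt (zz v) L).

Lemma rdiff_comp N (P : 'rV[C]_(N + N) -> C) z (L : 'rV[C]_(N + N)) :
  hdiff P (zz z) (fun v => dt v L) -> rdiff (fun z => P (zz z)) z L.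
Proof.
move=> H g v g0 gv; apply: (H (fun t => zz (g t))); last exact: is_velocity_zz.
by rewrite g0.
Qed.

Lemma rdiffD N (f h : 'rV[C]_N -> C) z L L' :
  rdiff f z L -> rdiff h z L' -> rdiff (fun z => f z + h z) z (L + L').
Proof.
move=> H H' g v g0 gv; rewrite dtDr; apply: svelD; [exact: H|exact: H'].
Qed.

Lemma zz_cont N (z : 'rV[C]_N) : zz y @[y --> z] --> zz z.
Proof.
have FF : Filter (nbhs z) by exact: nbhs_filter.
apply/(@cvg_rowP R _ _ _ FF) => i; case: (splitP i) => j ij.
  have -> : i = lshift N j by apply: val_inj.
  rewrite /zz row_mxEl (_ : (fun y => _) = fun y : 'rV[C]_N => y 0 j).
    exact: coord_continuous.
  by apply/funext => t; rewrite row_mxEl.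
have -> : i = rshift N j by apply: val_inj.
rewrite /zz row_mxEr mxE (_ : (fun y => _) = fun y : 'rV[C]_N => (y 0 j)^*).
  by apply: cvg_conj; apply: coord_continuous.
by apply/funext => t; rewrite row_mxEr mxE.
Qed.

End VelocityCalculus.

Section SeriesCalculus.
Variables (R : realType) (N : nat).
Local Notation C := (CC R).

Lemma gser_hdiff c e (r K : R) (f : 'rV[C]_N -> C) (g : 'I_N -> 'rV[C]_N -> C)
    (x : 'rV[C]_N) :
  gser c e r K f ->
  (forall i, gser (fun m => c m * (e m i)%:R) (fun m => mlower i (e m))
    (r / 2) (K * (2 / r)) (g i)) ->
  (forall i, `|x 0 i| < rtoC (r / 2)) ->
  hdiff f x (fun v => dt v (\row_i g i x)).
Proof.
move=> fE gE xr; have [r0 _ _] := fE.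
apply: (@hdiff_taylor R N f x _ (r / 2) K); first by rewrite divr_gt0.
move=> u t ur t1; have [_] := gser_taylor fE gE xr ur t1.
by rewrite dtE; under [X in t * X]eq_bigr do rewrite mxE.
Qed.

Lemma gser_cont c e (r K : R) (f : 'rV[C]_N -> C) (x : 'rV[C]_N) :
  gser c e r K f -> (forall i, `|x 0 i| < rtoC (r / 2)) ->
  f y @[y --> x] --> f x.
Proof.
move=> fE xr; have [r0 _ _] := fE; have [g gE] := choice (gser_partial fE).
have K0 := gser_K_ge0 fE.
have FF : Filter (nbhs x) by exact: nbhs_filter.
apply/(cvgrPdist_lt (FF := FF)) => _ /posC[eps eps0 ->].
pose t := Num.min 1 (eps / (K + 1)).
have K1 : 0 < K + 1 by rewrite ltr_wpDl.
have t0 : 0 < t by rewrite lt_min ltr01 divr_gt0.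
have t1 : t <= 1 by rewrite ge_min lexx.
apply/near_rowP; exists (t * (r / 2)); first by rewrite mulr_gt0 ?divr_gt0.
move=> y yx; have tC0 : rtoC t != 0 by rewrite rtoC_eq0 gt_eqF.
pose u := (rtoC t)^-1 *: (y - x).
have yE : y = x + rtoC t *: u by rewrite /u scalerA divff // scale1r addrC subrK.
have [||H _] := @gser_taylor _ _ _ _ _ _ _ fE g x u (rtoC t) gE xr.
- move=> i; rewrite !mxE normrM normfV norm_rtoCE (gtr0_norm t0).
  by rewrite ler_pdivrMl ?rtoC_gt0 // -rtoCM ltW.
- by rewrite norm_rtoCE (gtr0_norm t0) -rtoC1 rtoC_le.
rewrite distrC yE (le_lt_trans H) // norm_rtoCE (gtr0_norm t0) -rtoCM rtoC_lt.
apply: (@lt_le_trans _ _ (t * (K + 1))); first by rewrite ltr_pM2l // ltrDl.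
by rewrite -ler_pdivlMr // ge_min lexx orbT.
Qed.

End SeriesCalculus.

Section SmoothRemainder.
Variables (R : realType) (n : nat).
Local Notation C := (CC R).

Lemma near_polydisc (z : 'rV[C]_n) (d : R) : (forall i, `|z 0 i| < rtoC d) ->
  \forall y \near z, forall i, `|(y : 'rV[C]_n) 0 i| < rtoC d.
Proof.
move=> zd; have FF : Filter (nbhs z) by exact: nbhs_filter.
apply: (filter_forall FF) => i.
have e0 : 0 < rtoC d - `|z 0 i| by rewrite subr_gt0.
have zi : (y : 'rV[C]_n) 0 i @[y --> z] --> z 0 i by exact: coord_continuous.
move/(cvgrPdist_lt (FF := FF)): zi => /(_ _ e0); apply: filterS => y yz.
rewrite -[y 0 i](subrK (z 0 i)) (le_lt_trans (ler_normD _ _)) // distrC.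
by rewrite -ltrBrDr.
Qed.

(** [G] is the Wirtinger gradient and [H] the Hessian of [E]; row [i] of [H]
    is the gradient of the [i]-th component of [G]. They are the derived
    series of the series of [E] in [2n] variables, restricted to the graph of
    the conjugation. Every derivation lowers the degrees, and so the order of
    vanishing, by one. *)
Lemma real_analytic_O3_C2 (E : 'rV[C]_n -> C) : real_analytic_O 3 E ->
  exists (del M : R) (G : 'rV[C]_n -> 'rV[C]_(n + n))
    (H : 'rV[C]_n -> 'M[C]_(n + n)), 0 < del /\
  forall z : 'rV[C]_n, (forall i, `|z 0 i| < rtoC del) ->
  [/\ rdiff E z (G z),
      forall i, rdiff (fun y => G y 0 i) z (row i (H z)),
      forall i, G y 0 i @[y --> z] --> G z 0 i,
      forall i j, H y i j @[y --> z] --> H z i j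
    & forall s : R, 0 <= s -> (forall i, `|z 0 i| <= rtoC s) ->
      [/\ `|E z| <= rtoC (M * s), forall i, `|G z 0 i| <= rtoC (M * s ^+ 2)
        & forall i j, `|H z i j| <= rtoC (M * s)] ].
Proof.
move=> [c [r [P [/pseries_gser[K PE] c0 EP]]]].
have [r0 _ _] := PE; have K0 := gser_K_ge0 PE.
have [g gE] := choice (gser_partial PE).
have hex i : exists f : 'I_(n + n) -> 'rV[C]_(n + n) -> C, forall j,
    gser (fun m : mindex (n + n) => c m * (m i)%:R * (mlower i m j)%:R)
      (fun m => mlower j (mlower i m)) (r / 2 / 2)
      (K * (2 / r) * (2 / (r / 2))) (f j).
  by have [f Hf] := choice (gser_partial (gE i)); exists f.
have [h hE] := choice hex.
have [d d0 Ed] := (near_rowP _ _).1 EP.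
have r20 : 0 < r / 2 by rewrite divr_gt0.
have r40 : 0 < r / 2 / 2 by rewrite divr_gt0.
have r80 : 0 < r / 2 / 2 / 2 by rewrite divr_gt0.
(* sums of the first and second derived series, as in [gser_partial] *)
pose K1 := K * (2 / r); pose K2 := K1 * (2 / (r / 2)).
have K10 : 0 <= K1 by rewrite mulr_ge0 // divr_ge0 // ltW.
have K20 : 0 <= K2 by rewrite mulr_ge0 // divr_ge0 // ltW.
exists (Num.min d (r / 2 / 2 / 2)), (K / r + K1 / (r / 2) ^+ 2 + K2 / (r / 2 / 2)).
exists (fun z => \row_i g i (zz z)), (fun z => \matrix_(i, j) h i j (zz z)).
split; first by rewrite lt_min d0.
move=> z zd; have zd1 i : `|z 0 i| < rtoC d.
  by rewrite (lt_le_trans (zd i)) // rtoC_le ge_min lexx.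
have zr i : `|zz z 0 i| < rtoC (r / 2 / 2 / 2).
  apply: (zz_norm (P := fun x => x < _)) => j.
  by rewrite (lt_le_trans (zd j)) // rtoC_le ge_min lexx orbT.
have zr4 i : `|zz z 0 i| < rtoC (r / 2 / 2).
  by rewrite (lt_le_trans (zr i)) // rtoC_le ler_pdivrMr // ler_peMr ?ltW // ltr1n.
have zr2 i : `|zz z 0 i| < rtoC (r / 2).
  by rewrite (lt_le_trans (zr4 i)) // rtoC_le ler_pdivrMr // ler_peMr ?ltW // ltr1n.
split.
- apply: (@hdiff_near _ _ (fun z => P (zz z))).
    apply: filterS (near_polydisc zd1) => y yd.
    by rewrite -[LHS]/(P (row_mx y _)) Ed // => i; rewrite mxE subr0; apply: yd.
  by apply: rdiff_comp; apply: gser_hdiff PE gE zr2.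
- move=> i; rewrite (_ : (fun y => _) = fun y => g i (zz y)); last first.
    by apply/funext => y; rewrite mxE.
  rewrite (_ : row i _ = \row_j h i j (zz z)); last first.
    by apply/rowP => j; rewrite !mxE.
  apply: rdiff_comp; exact: (gser_hdiff (gE i) (hE i)).
- move=> i; rewrite mxE (_ : (fun y => _) = fun y => g i (zz y)); last first.
    by apply/funext => y; rewrite mxE.
  apply: (cvg_comp _ _ (zz_cont (z := z))); exact: gser_cont (gE i) _.
- move=> i j; rewrite mxE (_ : (fun y => _) = fun y => h i j (zz y)); last first.
    by apply/funext => y; rewrite mxE.
  apply: (cvg_comp _ _ (zz_cont (z := z))); exact: gser_cont (hE i j) _.
- move=> s s0 zs; pose s' := Num.min s (r / 2 / 2 / 2).
  have s'0 : 0 <= s' by rewrite le_min s0 ltW.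
  have s's : s' <= s by rewrite ge_min lexx.
  have s'r : s' <= r / 2 / 2 / 2 by rewrite ge_min lexx orbT.
  have zs' i : `|zz z 0 i| <= rtoC s'.
    have := zr i; have := zz_norm (P := fun x => x <= _) zs i.
    have [t t0 ->] := norm_rtoC (zz z 0 i).
    by rewrite !rtoC_le rtoC_lt le_min => -> /ltW ->.
  have t1 : 0 <= K / r by rewrite divr_ge0 // ltW.
  have t2 : 0 <= K1 / (r / 2) ^+ 2 by rewrite divr_ge0 // exprn_ge0 // ltW.
  have t3 : 0 <= K2 / (r / 2 / 2) by rewrite divr_ge0 // ltW.
  split.
  + have -> : E z = P (zz z).
      by rewrite Ed // => i; rewrite mxE subr0; apply: zd1.
    have [sr0 sr1] : 0 <= s' / r /\ s' / r <= 1.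
      rewrite divr_ge0 ?(ltW r0) // ler_pdivrMr //; lra.
    have sr : s' < r by lra.
    apply: le_trans (gser_small PE c0 s'0 sr zs') _; rewrite rtoC_le.
    apply: (@le_trans _ _ (K / r * s')).
      have -> : K / r * s' = (s' / r) ^+ 1 * K by ring.
      by rewrite ler_wpM2r // ler_wiXn2l.
    apply: ler_pM => //; lra.
  + move=> i; rewrite mxE.
    have c1 m : (mdegree (mlower i m) < 2)%N -> c m * (m i)%:R = 0.
      have [->|mi] := posnP (m i); first by rewrite mulr0.
      by move=> H; rewrite c0 ?mul0r // (mdegree_lowerE mi).
    have sr : s' < r / 2 by lra.
    apply: le_trans (gser_small (gE i) c1 s'0 sr zs') _; rewrite rtoC_le.
    rewrite -/K1; have -> : (s' / (r / 2)) ^+ 2 * K1 = K1 / (r / 2) ^+ 2 * s' ^+ 2.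
      by rewrite expr_div_n; ring.
    apply: ler_pM; rewrite ?exprn_ge0 //; first by lra.
    by rewrite lerXn2r.
  + move=> i j; rewrite mxE.
    have c2 m : (mdegree (mlower j (mlower i m)) < 1)%N ->
        c m * (m i)%:R * (mlower i m j)%:R = 0.
      have [->|mi] := posnP (m i); first by rewrite mulr0 mul0r.
      have [->|mj] := posnP (mlower i m j); first by rewrite mulr0.
      move=> H; rewrite c0 ?mul0r // (mdegree_lowerE mi) (mdegree_lowerE mj).
      by rewrite !ltnS.
    have sr : s' < r / 2 / 2 by lra.
    apply: le_trans (gser_small (hE i j) c2 s'0 sr zs') _; rewrite rtoC_le expr1.
    rewrite -/K1 -/K2.
    have -> : s' / (r / 2 / 2) * K2 = K2 / (r / 2 / 2) * s' by ring.
    apply: ler_pM => //; lra.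
Qed.
End SmoothRemainder.

(** * Tangent and complex tangent spaces of graphs *)

Section RowLimits.
Variable R : realType.
Local Notation C := (CC R).
Variables (T : Type) (F : set_system T).
Hypothesis FF : Filter F.

Lemma cvg_dt N (f g : T -> 'rV[C]_N) (u v : 'rV[C]_N) :
  f x @[x --> F] --> u -> g x @[x --> F] --> v ->
  dt (f x) (g x) @[x --> F] --> dt u v.
Proof.
move=> /(cvg_rowP FF) fu /(cvg_rowP FF) gv.
rewrite (_ : (fun x => _) = fun x => \sum_i f x 0 i * g x 0 i); last first.
  by apply/funext => x; rewrite dtE.
by rewrite dtE; apply: cvgC_sum => i; apply: cvgM; [apply: fu|apply: gv].
Qed.

Lemma cvg_mulmx N m (f : T -> 'rV[C]_N) (A : T -> 'M[C]_(N, m))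
    (u : 'rV[C]_N) (B : 'M[C]_(N, m)) :
  f x @[x --> F] --> u ->
  (forall i j, A x i j @[x --> F] --> B i j) ->
  f x *m A x @[x --> F] --> u *m B.
Proof.
move=> /(cvg_rowP FF) fu AB; apply/(cvg_rowP FF) => j.
rewrite (_ : (fun x => _) = fun x => \sum_i f x 0 i * A x i j); last first.
  by apply/funext => x; rewrite mxE.
by rewrite mxE; apply: cvgC_sum => i; apply: cvgM; [apply: fu|apply: AB].
Qed.

Lemma cvg_mulmxl N m (f : T -> 'rV[C]_N) (A : 'M[C]_(N, m)) (u : 'rV[C]_N) :
  f x @[x --> F] --> u -> f x *m A @[x --> F] --> u *m A.
Proof. by move=> fu; apply: cvg_mulmx fu _ => i j; apply: cvg_cst. Qed.

Lemma cvg_cmx N (f : T -> 'rV[C]_N) (u : 'rV[C]_N) :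
  f x @[x --> F] --> u -> cmx (f x) @[x --> F] --> cmx u.
Proof.
move=> /(cvg_rowP FF) fu; apply/(cvg_rowP FF) => j.
rewrite (_ : (fun x => _) = fun x => (f x 0 j)^*); last first.
  by apply/funext => x; rewrite mxE.
by rewrite mxE; apply: cvg_conj; apply: fu.
Qed.

Lemma cvg_lsubmx N m (f : T -> 'rV[C]_(N + m)) (u : 'rV[C]_(N + m)) :
  f x @[x --> F] --> u -> lsubmx (f x) @[x --> F] --> lsubmx u.
Proof.
move=> /(cvg_rowP FF) fu; apply/(cvg_rowP FF) => j.
rewrite (_ : (fun x => _) = fun x => f x 0 (lshift m j)); last first.
  by apply/funext => x; rewrite mxE.
by rewrite mxE; apply: fu.
Qed.

Lemma cvg_rsubmx N m (f : T -> 'rV[C]_(N + m)) (u : 'rV[C]_(N + m)) :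
  f x @[x --> F] --> u -> rsubmx (f x) @[x --> F] --> rsubmx u.
Proof.
move=> /(cvg_rowP FF) fu; apply/(cvg_rowP FF) => j.
rewrite (_ : (fun x => _) = fun x => f x 0 (rshift N j)); last first.
  by apply/funext => x; rewrite mxE.
by rewrite mxE; apply: fu.
Qed.

Lemma cvg_row_mx N m (f : T -> 'rV[C]_N) (g : T -> 'rV[C]_m)
    (u : 'rV[C]_N) (v : 'rV[C]_m) :
  f x @[x --> F] --> u -> g x @[x --> F] --> v ->
  row_mx (f x) (g x) @[x --> F] --> row_mx u v.
Proof.
move=> /(cvg_rowP FF) fu /(cvg_rowP FF) gv; apply/(cvg_rowP FF) => i.
case: (splitP i) => j ij.
  have -> : i = lshift m j by apply: val_inj.
  rewrite row_mxEl (_ : (fun x => _) = fun x => f x 0 j); first exact: fu.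
  by apply/funext => x; rewrite row_mxEl.
have -> : i = rshift N j by apply: val_inj.
rewrite row_mxEr (_ : (fun x => _) = fun x => g x 0 j); first exact: gv.
by apply/funext => x; rewrite row_mxEr.
Qed.

Lemma cvg_scalar (f : T -> C) u : f x @[x --> F] --> u ->
  ((f x)%:M : 'rV[C]_1) @[x --> F] --> (u%:M : 'rV[C]_1).
Proof.
move=> fu; apply/(cvg_rowP FF) => i.
rewrite (_ : (fun x => _) = f); first by rewrite !ord1 mxE mulr1n.
by apply/funext => x; rewrite !ord1 mxE mulr1n.
Qed.

End RowLimits.

Section GraphGeometry.
Variables (R : realType) (n : nat).
Local Notation C := (CC R).
Implicit Types (M : set (Cn1 R n)) (p q v : Cn1 R n) (rho : 'rV[C]_n -> C).

Definition mkp (z : 'rV[C]_n) (w : C) : Cn1 R n := row_mx z w%:M.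

Lemma zpart_mkp z w : zpart (mkp z w) = z.
Proof. exact: row_mxKl. Qed.

Lemma wpart_mkp z w : wpart (mkp z w) = w.
Proof. by rewrite /wpart /mkp row_mxKr mxE mulr1n. Qed.

Lemma mkpK p : mkp (zpart p) (wpart p) = p.
Proof. by rewrite /mkp /wpart -mx11_scalar hsubmxK. Qed.

Lemma zpartD p q : zpart (p + q) = zpart p + zpart q.
Proof. exact: linearD. Qed.

Lemma wpartD p q : wpart (p + q) = wpart p + wpart q.
Proof. by rewrite /wpart linearD mxE. Qed.

Lemma zpartZ s p : zpart (s *: p) = s *: zpart p.
Proof. exact: linearZ. Qed.

Lemma wpartZ s p : wpart (s *: p) = s * wpart p.
Proof. by rewrite /wpart linearZ mxE. Qed.

Lemma zpartB p q : zpart (p - q) = zpart p - zpart q.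
Proof. exact: linearB. Qed.

Lemma wpartB p q : wpart (p - q) = wpart p - wpart q.
Proof. by rewrite /wpart linearB !mxE. Qed.

Lemma is_velocity_zpart (g : R -> Cn1 R n) v :
  is_velocity g v -> is_velocity (fun t => zpart (g t)) (zpart v).
Proof. exact: is_velocity_lsubmx. Qed.

Lemma svel_wpart (g : R -> Cn1 R n) v :
  is_velocity g v -> svel (fun t => wpart (g t)) (wpart v).
Proof. by move=> /is_velocity_rsubmx /is_velocityP; exact. Qed.

Lemma is_velocity_mkp (g : R -> 'rV[C]_n) (h : R -> C) u w :
  is_velocity g u -> svel h w -> is_velocity (fun t => mkp (g t) (h t)) (mkp u w).
Proof.
move=> gu hw; apply: is_velocity_row_mx; first by apply: gu.
by apply: is_velocity_scalar; apply: hw.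
Qed.

Lemma zpart_cvg p : zpart q @[q --> p] --> zpart p.
Proof.
have FF : Filter (nbhs p) by exact: nbhs_filter.
by apply: (cvg_lsubmx FF); apply: cvg_id.
Qed.

Definition graph_at M rho p := \forall q \near p, M q <-> wpart q = rho (zpart q).

Lemma near0_of_punctured (P : R -> Prop) :
  P 0 -> (\forall t \near (0 : R)^', P t) -> \forall t \near (0 : R), P t.
Proof.
move=> P0; rewrite near_withinE; apply: filterS => t H.
by have [->|/H] := eqVneq t 0.
Qed.

Section At.
Variables (M : set (Cn1 R n)) (rho : 'rV[C]_n -> C) (p : Cn1 R n).
Variable L : 'rV[C]_(n + n).
Hypothesis Mg : graph_at M rho p.
Hypothesis Mp : M p.
Hypothesis rL : rdiff rho (zpart p) L.

Let wp : wpart p = rho (zpart p).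
Proof. by have [H _] := nbhs_singleton Mg; apply: H. Qed.

Lemma svel_rho (g : R -> 'rV[C]_n) u : g 0 = zpart p -> is_velocity g u ->
  svel (fun t => rho (g t)) (dt (zz u) L).
Proof. by move=> g0 gu; apply: (rL g0 gu). Qed.

(** A curve in the graph over the line through [zpart p] in the direction
    [u]. *)
Definition lift_curve (u : 'rV[C]_n) (t : R) : Cn1 R n :=
  mkp (zpart p + rtoC t *: u) (rho (zpart p + rtoC t *: u)).

Lemma lift_curve0 u : lift_curve u 0 = p.
Proof. by rewrite /lift_curve rtoC0 scale0r addr0 -wp mkpK. Qed.

Lemma lift_curve_velocity u :
  is_velocity (lift_curve u) (mkp u (dt (zz u) L)).
Proof.
apply: is_velocity_mkp; first exact: is_velocity_line.
apply: svel_rho; last exact: is_velocity_line.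
by rewrite rtoC0 scale0r addr0.
Qed.

Lemma lift_curve_near u (P : Cn1 R n -> Prop) : (\forall q \near p, P q) ->
  \forall t \near (0 : R), P (lift_curve u t).
Proof.
move=> Pn; apply: near0_of_punctured.
  by rewrite lift_curve0; apply: nbhs_singleton Pn.
by have := is_velocity_cvg (@lift_curve_velocity u); rewrite lift_curve0 => /(_ _ Pn).
Qed.

Lemma lift_curve_in u : \forall t \near (0 : R), M (lift_curve u t).
Proof.
apply: filterS (lift_curve_near u Mg) => t; rewrite zpart_mkp wpart_mkp => H.
by apply/H.
Qed.

Lemma tangent_graph v : tangent M p v <-> wpart v = dt (zz (zpart v)) L.
Proof.
split=> [[_ [g [g0 Mgt gv]]]|vL].
  have zv := is_velocity_zpart gv; have wv := svel_wpart gv.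
  apply: (svel_unique wv); apply: svel_near (svel_rho _ zv); last by rewrite g0.
    by rewrite g0 wp.
  have H1 := is_velocity_cvg gv; rewrite g0 in H1.
  have H2 : \forall t \near (0 : R)^', M (g t).
    by rewrite near_withinE; move: Mgt; apply: filterS => t Mt _.
  have H3 : \forall t \near (0 : R)^', M (g t) <-> wpart (g t) = rho (zpart (g t)).
    exact: (H1 _ Mg).
  by move: H3 H2; apply: filterS2 => t H Mt; apply/esym/H.
split=> //; exists (lift_curve (zpart v)); split.
- exact: lift_curve0.
- exact: lift_curve_in.
- by have := @lift_curve_velocity (zpart v); rewrite -vL mkpK.
Qed.

Lemma zz_i (u : 'rV[C]_n) : dt (zz ('i *: u)) L =
  'i * (dt u (lsubmx L) - dt (cmx u) (rsubmx L)).
Proof. by rewrite dt_zz cmxZ conjCi !dtZl mulNr mulrBr. Qed.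

(** Both [v] and [- i v] are tangent: this separates the complex linear part
    of the derivative of [rho] from the antilinear part, which must vanish. *)
Lemma ctangent_graph v : ctangent M p v <->
  wpart v = dt (zpart v) (lsubmx L) /\ dt (cmx (zpart v)) (rsubmx L) = 0.
Proof.
have i0 := neq0Ci C; split.
  move=> [/tangent_graph H1 [u /tangent_graph H2 uv]].
  move: H1; rewrite -uv zpartZ wpartZ zz_i H2 dt_zz => /(mulfI i0) /eqP.
  rewrite addrC -subr_eq0 opprB addrACA subrr addr0 -mulr2n mulrn_eq0 /= => /eqP H3.
  by rewrite H3 add0r dtZl cmxZ dtZl H3 mulr0.
move=> [H1 H2]; split; first by apply/tangent_graph; rewrite dt_zz H2 addr0.
exists (- 'i *: v); last by rewrite scalerA mulrN -expr2 sqrCi opprK scale1r.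
apply/tangent_graph; rewrite scaleNr -scalerN zpartZ wpartZ zz_i.
by rewrite -scaleN1r zpartZ wpartZ cmxZ conjCN1 !dtZl H2 mulr0 subr0 H1.
Qed.

End At.

(** Where [rho_zbar] is nonzero, [T^c] is the common kernel of two independent
    linear forms on [C^{n+1}]. *)
Lemma ctangent_space M rho p (L : 'rV[C]_(n + n)) : graph_at M rho p -> M p ->
  rdiff rho (zpart p) L -> rsubmx L != 0 ->
  exists2 W : {vspace Cn1 R n}, \dim W = n.-1 & ctangent M p = [set` W].
Proof.
move=> Mg Mp rL L0; pose l := lsubmx L; pose m := rsubmx L.
pose f v : 'rV[C]_(1 + 1) :=
  row_mx (wpart v - dt (zpart v) l)%:M (dt (zpart v) (cmx m))%:M.
have f_lin : linear f.
  move=> s u v; rewrite /f zpartD wpartD zpartZ wpartZ !dtDl !dtZl.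
  rewrite scale_row_mx add_row_mx !scale_scalar_mx -!raddfD.
  by rewrite opprD mulrBr addrACA.
pose fl : {linear Cn1 R n -> 'rV[C]_(1 + 1)} :=
  HB.pack f (GRing.isLinear.Build _ _ _ _ f f_lin).
exists (lker (linfun fl)).
  have := limg_ker_dim (linfun fl) fullv; rewrite capfv.
  have -> : limg (linfun fl) = fullv.
    apply/eqP; rewrite eqEsubv subvf; apply/subvP => y _.
    have m0 : cmx m != 0 by apply: contra L0 => /eqP m0; rewrite -[rsubmx L]cmxK -/m m0 cmx0.
    have [w wm] := dt_dual m0.
    pose z := rsubmx y 0 0 *: w.
    apply/memv_imgP; exists (mkp z (lsubmx y 0 0 + dt z l)); first exact: memvf.
    rewrite lfunE /= /f zpart_mkp wpart_mkp addrK dtZl wm mulr1.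
    by rewrite -!mx11_scalar hsubmxK.
  rewrite !dimvf /= /dim /= !mul1n; move: (\dim (lker _)) => d; lia.
apply/seteqP; split => v.
  move/(ctangent_graph Mg Mp rL) => [H1 H2].
  suff : v \in lker (linfun fl) by [].
  rewrite memv_ker lfunE /= /f H1 subrr.
  have -> : dt (zpart v) (cmx m) = 0.
    by apply/eqP; rewrite -conjC_eq0 dt_conj cmxK H2.
  by rewrite raddf0 row_mx0.
move=> vW; have {vW} : v \in lker (linfun fl) by exact: vW.
rewrite memv_ker lfunE /= => /eqP fv; apply/(ctangent_graph Mg Mp rL).
have := congr1 lsubmx fv; have := congr1 rsubmx fv; rewrite /f row_mxKl row_mxKr.
rewrite !linear0 => /matrixP /(_ 0 0) H2 /matrixP /(_ 0 0) H1.
move: H1 H2; rewrite !mxE !mulr1n => /eqP; rewrite subr_eq0 => /eqP -> H2.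
by split=> //; apply/eqP; rewrite -conjC_eq0 dt_conj cmxK H2.
Qed.

End GraphGeometry.

(** * The Levi identity of a Levi-flat graph *)

Section QuadricGradient.
Variables (R : realType) (n : nat).
Local Notation C := (CC R).
Variables a b : 'M[C]_n.

(** The derivatives of the quadric in [z] and [zbar]; they are real-linear in
    [z], hence their own derivative. *)
Definition qgrad (z : 'rV[C]_n) : 'rV[C]_(n + n) :=
  row_mx (cmx z *m a) (ell a (b + b^T) z).

Lemma is_velocity_ell (g : R -> 'rV[C]_n) v B : is_velocity g v ->
  is_velocity (fun t => ell a B (g t)) (ell a B v).
Proof.
move=> gv; apply: is_velocityD; apply: is_velocity_mulmx; first by apply: gv.
by apply: is_velocity_cmx gv.
Qed.

Lemma is_velocity_qgrad (g : R -> 'rV[C]_n) v : is_velocity g v ->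
  is_velocity (fun t => qgrad (g t)) (qgrad v).
Proof.
move=> gv; apply: is_velocity_row_mx; last by apply: is_velocity_ell gv.
by apply: is_velocity_mulmx; apply: is_velocity_cmx gv.
Qed.

Lemma rdiff_qfun z : rdiff (qfun a b) z (qgrad z).
Proof.
move=> g v g0 gv; have cv := is_velocity_cmx gv.
have H1 := svel_dt (is_velocity_mulmx (A := a) cv) gv.
have H2 := svel_dt (is_velocity_mulmx (A := b) cv) cv.
rewrite (_ : (fun t => _) = fun t => dt (cmx (g t) *m a) (g t) +
  dt (cmx (g t) *m b) (cmx (g t))); last first.
  by apply/funext => t; rewrite /qfun A_formE B_formE.
rewrite (_ : dt _ _ = dt (cmx v *m a) (g 0) + dt (cmx (g 0) *m a) v +
  (dt (cmx v *m b) (cmx (g 0)) + dt (cmx (g 0) *m b) (cmx v))).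
  by apply: svelD; [apply: H1|apply: H2].
rewrite g0 dt_zz row_mxKl row_mxKr /ell mulmxDr !dtDr.
rewrite [dt v _]dtC [dt (cmx v) (cmx z *m b)]dtC [dt (cmx v *m b) _]dt_mulmx.
rewrite [dt (cmx v *m a) _]dt_mulmx.
move: (dt _ _) (dt _ _) (dt _ _) (dt _ _) => x1 x2 x3 x4; ring.
Qed.

End QuadricGradient.

Section FlatImpliesNull.
Variables (R : realType) (n : nat).
Local Notation C := (CC R).
Variables (a b : 'M[C]_n) (E : 'rV[C]_n -> C) (del K : R).
Variables (G : 'rV[C]_n -> 'rV[C]_(n + n)) (H : 'rV[C]_n -> 'M[C]_(n + n)).
Hypothesis del0 : 0 < del.

Let inD (z : 'rV[C]_n) := forall i, `|z 0 i| < rtoC del.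

Hypothesis rE : forall z, inD z -> rdiff E z (G z).
Hypothesis rG : forall z, inD z ->
  forall i, rdiff (fun y => G y 0 i) z (row i (H z)).
Hypothesis cG : forall z, inD z -> forall i, G y 0 i @[y --> z] --> G z 0 i.
Hypothesis cH : forall z, inD z -> forall i j, H y i j @[y --> z] --> H z i j.
Hypothesis bE : forall z, inD z -> forall s : R, 0 <= s ->
  (forall i, `|z 0 i| <= rtoC s) ->
  [/\ `|E z| <= rtoC (K * s), forall i, `|G z 0 i| <= rtoC (K * s ^+ 2)
    & forall i j, `|H z i j| <= rtoC (K * s)].

Let rho z := qfun a b z + E z.
Let L z : 'rV[C]_(n + n) := qgrad a b z + G z.
Let phi z := rsubmx (L z).
Let DL z u : 'rV[C]_(n + n) := qgrad a b u + zz u *m (H z)^T.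

Lemma rdiff_rho z : inD z -> rdiff rho z (L z).
Proof. by move=> zD; apply: rdiffD; [exact: rdiff_qfun|exact: rE]. Qed.

Lemma is_velocity_L (g : R -> 'rV[C]_n) z v : inD z -> g 0 = z ->
  is_velocity g v -> is_velocity (fun t => L (g t)) (DL z v).
Proof.
move=> zD g0 gv; apply: is_velocityD; first by apply: is_velocity_qgrad gv.
apply/is_velocityP => i; have := @rG z zD i g v g0 gv.
by rewrite (_ : (zz v *m (H z)^T) 0 i = dt (zz v) (row i (H z))) // -dt_delta
  dt_mulmx trmxK -rowE.
Qed.

Lemma qgrad_cont z : qgrad a b y @[y --> z] --> qgrad a b z.
Proof.
have FF : Filter (nbhs z) by exact: nbhs_filter.
have ci : cmx y @[y --> z] --> cmx z by apply: (cvg_cmx FF); apply: cvg_id.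
apply: (cvg_row_mx FF); first by apply: (cvg_mulmxl FF); apply: ci.
apply: cvgD; first by apply: (cvg_mulmxl FF); apply: cvg_id.
by apply: (cvg_mulmxl FF); apply: ci.
Qed.

Lemma L_cont z : inD z -> L y @[y --> z] --> L z.
Proof.
move=> zD; have FF : Filter (nbhs z) by exact: nbhs_filter.
apply: cvgD; first exact: qgrad_cont.
by apply/(cvg_rowP FF) => i; apply: cG.
Qed.

Lemma DL_cont z u : inD z -> DL y u @[y --> z] --> DL z u.
Proof.
move=> zD; have FF : Filter (nbhs z) by exact: nbhs_filter.
apply: cvgD; first by apply: cvg_cst.
apply: (cvg_mulmx FF); first by apply: cvg_cst.
move=> i j; rewrite mxE (_ : (fun y => _) = fun y => H y j i); first exact: cH.
by apply/funext => y; rewrite mxE.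
Qed.

Variable S : 'M[C]_n.
Hypothesis Sa : S^T = - S.

Definition field_z z := cmx (phi z *m S).
Definition Dfield_z z u := cmx (rsubmx (DL z u) *m S).

(** For [s = 1] and [s = i] these are the complex tangent fields [X] and [i X]
    attached to [S]; [Dfield] is their derivative. *)
Definition field s (p : Cn1 R n) : Cn1 R n := let z := zpart p in
  s *: mkp (field_z z) (dt (field_z z) (lsubmx (L z))).

Definition Dfield s (p v : Cn1 R n) : Cn1 R n :=
  let z := zpart p in let u := zpart v in
  s *: mkp (Dfield_z z u)
    (dt (Dfield_z z u) (lsubmx (L z)) + dt (field_z z) (lsubmx (DL z u))).

Lemma zpart_field s p : zpart (field s p) = s *: field_z (zpart p).
Proof. by rewrite /field zpartZ zpart_mkp. Qed.

Lemma zpart_Dfield s p v :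
  zpart (Dfield s p v) = s *: Dfield_z (zpart p) (zpart v).
Proof. by rewrite /Dfield zpartZ zpart_mkp. Qed.

Lemma near_inD (p : Cn1 R n) : inD (zpart p) -> \forall q \near p, inD (zpart q).
Proof. by move=> pD; apply: (zpart_cvg (near_polydisc pD)). Qed.

Lemma field_C1 s p : inD (zpart p) -> C1_field_at (field s) (Dfield s) p.
Proof.
move=> pD; apply: filterS (near_inD pD) => q qD v; split.
  apply: is_velocityZ; set g := fun t : R => zpart (q + rtoC t *: v).
  have g0 : g 0 = zpart q by rewrite /g rtoC0 scale0r addr0.
  have gv : is_velocity g (zpart v).
    by apply: is_velocity_zpart; apply: is_velocity_line.
  have LV := is_velocity_L qD g0 gv.
  have FV : is_velocity (fun t => field_z (g t)) (Dfield_z (zpart q) (zpart v)).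
    by apply: is_velocity_cmx; apply: is_velocity_mulmx; apply: is_velocity_rsubmx LV.
  apply: is_velocity_mkp; first by apply: FV.
  have := svel_dt FV (is_velocity_lsubmx LV); rewrite g0; apply.
have FF : Filter (nbhs q) by exact: nbhs_filter.
have cL : L (zpart y) @[y --> q] --> L (zpart q).
  by apply: cvg_comp (zpart_cvg (p := q)) (L_cont qD).
have cDL : DL (zpart y) (zpart v) @[y --> q] --> DL (zpart q) (zpart v).
  by apply: cvg_comp (zpart_cvg (p := q)) (@DL_cont _ (zpart v) qD).
have cF : field_z (zpart y) @[y --> q] --> field_z (zpart q).
  by apply: (cvg_cmx FF); apply: (cvg_mulmxl FF); apply: (cvg_rsubmx FF); apply: cL.
have cDF : Dfield_z (zpart y) (zpart v) @[y --> q] --> Dfield_z (zpart q) (zpart v).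
  by apply: (cvg_cmx FF); apply: (cvg_mulmxl FF); apply: (cvg_rsubmx FF); apply: cDL.
apply: cvgZ; first by apply: cvg_cst.
apply: (cvg_row_mx FF); first by apply: cDF.
apply: (cvg_scalar FF); apply: cvgD; apply: (cvg_dt FF).
- by apply: cDF.
- by apply: (cvg_lsubmx FF); apply: cL.
- by apply: cF.
- by apply: (cvg_lsubmx FF); apply: cDL.
Qed.

Variable M : set (Cn1 R n).

(** The point [p] ranges over a polydisc, so that the geometry of [M] may be
    used at points that tend to the origin. *)
Hypothesis Mg : forall p, inD (zpart p) -> `|wpart p| < rtoC del ->
  graph_at M rho p.
Hypothesis Mflat : forall p, inD (zpart p) -> `|wpart p| < rtoC del ->
  CR_points M p -> Levi_map_vanishes_at M p.

Lemma near_wpart (p : Cn1 R n) (d : R) : `|wpart p| < rtoC d ->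
  \forall q \near p, `|wpart q| < rtoC d.
Proof.
move=> pd; have FF : Filter (nbhs p) by exact: nbhs_filter.
have e0 : 0 < rtoC d - `|wpart p| by rewrite subr_gt0.
have wc : wpart q @[q --> p] --> wpart p.
  have /(cvg_rowP FF) : (rsubmx q : 'rV[C]_1) @[q --> p] --> (rsubmx p : 'rV[C]_1).
    by apply: (cvg_rsubmx FF); apply: cvg_id.
  by apply.
move/(cvgrPdist_lt (FF := FF)): wc => /(_ _ e0); apply: filterS => q qp.
rewrite -[wpart q](subrK (wpart p)) (le_lt_trans (ler_normD _ _)) // distrC.
by rewrite -ltrBrDr.
Qed.

Lemma field_tangent s p : inD (zpart p) -> `|wpart p| < rtoC del ->
  \forall q \near p, M q -> ctangent M q (field s q).
Proof.
move=> pD pw; apply: filterS2 (near_inD pD) (near_wpart pw) => q qD qw Mq.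
apply/(ctangent_graph (Mg qD qw) Mq (rdiff_rho qD)).
rewrite /field zpartZ wpartZ zpart_mkp wpart_mkp dtZl; split => //.
by rewrite cmxZ dtZl cmxK dt_alt // mulr0.
Qed.

(** For [v = conj (phi S)] the bracket of [X] and [i X] has first part
    [i Dv (v) - Dv (i v)] up to sign. Since [phi] is differentiated in [z] and
    in [zbar], the contributions of [rho_{zbar zbar}] cancel, those of
    [rho_{zbar z}] add up, and the condition for the bracket to be complex
    tangent is the vanishing of the Levi form at [v]. At the zeros of [phi],
    where [M] need not be CR, the identity is trivial. *)
Lemma levi_identity z : inD z -> `|rho z| < rtoC del ->
  sesq (a + dlsubmx (H z)) (phi z *m S) (phi z *m S) = 0.
Proof.
move=> zD zw; have [p0|p0] := eqVneq (phi z) 0.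
  by rewrite p0 mul0mx /sesq mul0mx dt0l.
pose p := mkp z (rho z).
have pz : zpart p = z by exact: zpart_mkp.
have pw : wpart p = rho z by exact: wpart_mkp.
have pD : inD (zpart p) by rewrite pz.
have pwd : `|wpart p| < rtoC del by rewrite pw.
have Mp : M p.
  by have [_ G'] := nbhs_singleton (Mg pD pwd); apply: G'; rewrite pz pw.
have pCR : CR_points M p.
  split=> //; exists n.-1.
  have phin : \forall q \near p, phi (zpart q) != 0.
    have FF : Filter (nbhs p) by exact: nbhs_filter.
    have cphi : phi (zpart y) @[y --> p] --> phi (zpart p).
      apply: (cvg_rsubmx FF); exact: cvg_comp (zpart_cvg (p := p)) (L_cont pD).
    rewrite pz in cphi; have /rV0Pn[i ipi] := p0.
    have ci : phi (zpart y) 0 i @[y --> p] --> phi z 0 i.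
      by move: i {ipi}; apply/(cvg_rowP FF).
    have e0 : 0 < `|phi z 0 i| by rewrite normr_gt0.
    move/(cvgrPdist_lt (FF := FF)): ci => /(_ _ e0); apply: filterS => q.
    by apply: contraTneq => ->; rewrite [X in _ - X]mxE subr0 ltxx.
  apply: filterS3 (near_inD pD) (near_wpart pwd) phin => q qD qw q0 Mq.
  exact: ctangent_space (Mg qD qw) Mq (rdiff_rho qD) q0.
have F1 : zpart (field 1 p) = field_z z.
  by apply: etrans (zpart_field 1 p) _; rewrite scale1r pz.
have Fi : zpart (field 'i p) = 'i *: field_z z.
  by apply: etrans (zpart_field 'i p) _; rewrite pz.
have D1 : zpart (Dfield 1 p (field 'i p)) = Dfield_z z ('i *: field_z z).
  apply: etrans (zpart_Dfield 1 p _) _.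
  by rewrite scale1r; exact: (f_equal2 Dfield_z pz Fi).
have Di : zpart (Dfield 'i p (field 1 p)) = 'i *: Dfield_z z (field_z z).
  apply: etrans (zpart_Dfield 'i p _) _.
  exact: (congr1 (fun w => 'i *: w) (f_equal2 Dfield_z pz F1)).
have /(ctangent_graph (Mg pD pwd) Mp (rdiff_rho pD))[_] := Mflat pD pwd pCR
  (field_C1 1 pD) (field_C1 'i pD) (field_tangent 1 pD pwd) (field_tangent 'i pD pwd).
have dE u : cmx (Dfield_z z u) = rsubmx (DL z u) *m S by apply: cmxK.
have vE : cmx (field_z z) = phi z *m S by apply: cmxK.
move: (Dfield 1 p (field 'i p)) (Dfield 'i p (field 1 p)) D1 Di => Y X D1 Di.
move: dE vE D1 Di => + + {F1 Fi}.
move: (field_z z) (Dfield_z z) => v Dv dE vE D1 Di.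
rewrite zpartB D1 Di pz -[rsubmx (L z)]/(phi z) cmxD cmxN cmxZ conjCi !dE.
have r u : rsubmx (DL z u) =
    u *m (a + dlsubmx (H z))^T + cmx u *m (b + b^T + (drsubmx (H z))^T).
  rewrite linearD /= row_mxKr /ell; have -> : rsubmx (zz u *m (H z)^T) =
    u *m (dlsubmx (H z))^T + cmx u *m (drsubmx (H z))^T.
    rewrite -{1}[H z]submxK tr_block_mx mul_row_block row_mxKr.
    by [].
  by rewrite addrACA -!mulmxDr [(a + _)^T]linearD.
rewrite (r v) (r ('i *: v)) (cmxZ 'i v) conjCi -(scalemxAl 'i v) -(scalemxAl _ (cmx v)).
set h := a + _; set k := (b + _ + _) => E0.
have {}E0 : dt (v *m h^T *m S) (phi z) = 0.
  have i0 : - (2 * 'i) != 0 :> C by rewrite oppr_eq0 mulf_neq0 ?neq0Ci ?pnatr_eq0.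
  apply: (mulfI i0); rewrite mulr0 -E0 -dtZl; congr (dt _ _).
  rewrite !mulmxDl -!scalemxAl.
  move: (v *m h^T *m S) (cmx v *m k *m S) => A A'.
  by apply/rowP => j; rewrite !mxE; ring.
move: E0; rewrite dt_mulmx Sa mulmxN dtNr -vE dt_mulmx trmxK dtC => /eqP.
by rewrite oppr_eq0 vE /sesq -vE cmxK => /eqP.
Qed.

Lemma cmx_rtoC (t : R) (z : 'rV[C]_n) : cmx (rtoC t *: z) = rtoC t *: cmx z.
Proof. by rewrite cmxZ conj_rtoC. Qed.

Lemma ell_rtoC B (t : R) (z : 'rV[C]_n) : ell a B (rtoC t *: z) = rtoC t *: ell a B z.
Proof. by rewrite /ell cmx_rtoC -!scalemxAl scalerDr. Qed.

Lemma qfun_rtoC (t : R) (z : 'rV[C]_n) :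
  qfun a b (rtoC t *: z) = rtoC t ^+ 2 * qfun a b z.
Proof.
rewrite /qfun !A_formE !B_formE cmx_rtoC -!scalemxAl !dtZl !dtZr; ring.
Qed.

Lemma row_bounded (z : 'rV[C]_n) :
  exists2 B : R, 0 <= B & forall i, `|z 0 i| <= rtoC B.
Proof.
exists (\sum_i complex.Re `|z 0 i|) => [|i].
  by rewrite sumr_ge0 // => j _; rewrite -rtoC_ge0 rtoC_Re ?normr_real.
rewrite (bigD1 i) // rtoCD rtoC_Re ?normr_real // lerDl rtoC_ge0 sumr_ge0 //.
by move=> j _; rewrite -rtoC_ge0 rtoC_Re ?normr_real.
Qed.

(** On the ray through [z], [phi (t z) / t] tends to [ell z] and
    [rho_{zbar z}] tends to [a]; the Levi identity is homogeneous in [phi]. *)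
Lemma levi_identity_quadric z :
  sesq a (ell a (b + b^T) z *m S) (ell a (b + b^T) z *m S) = 0.
Proof.
have [B B0 zB] := row_bounded z.
pose zt (t : R) := rtoC t *: z.
have ztB t i : `|zt t 0 i| <= rtoC (`|t| * B).
  by rewrite mxE normrM norm_rtoCE rtoCM ler_wpM2l // rtoC_ge0.
have B1 : 0 < B + 1 by rewrite ltr_wpDl.
have nD : \forall t \near (0 : R)^', inD (zt t).
  have e0 : 0 < del / (B + 1) by rewrite divr_gt0.
  apply: filterS (@dnbhs0_lt R R _ e0) => t; rewrite ltr_pdivlMr // => te i.
  rewrite (le_lt_trans (ztB t i)) // rtoC_lt (le_lt_trans _ te) //.
  by rewrite ler_wpM2l // lerDl.
have bnd t : inD (zt t) -> [/\ `|E (zt t)| <= rtoC (K * (`|t| * B)),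
    forall i, `|G (zt t) 0 i| <= rtoC (K * (`|t| * B) ^+ 2)
    & forall i j, `|H (zt t) i j| <= rtoC (K * (`|t| * B))].
  by move=> tD; apply: bE => //; rewrite mulr_ge0.
have nrho : \forall t \near (0 : R)^', `|rho (zt t)| < rtoC del.
  have c : rho (zt t) @[t --> (0 : R)^'] --> (0 : C).
    apply: (@cvg_Ot R _ (fun t => rtoC t ^+ 2 * qfun a b z) _ (K * B)).
      apply: filterS nD => t /bnd[Eb _ _].
      by rewrite /rho qfun_rtoC addrAC subrr add0r mulrCA.
    rewrite -(mul0r (qfun a b z)); apply: cvgMl.
    by rewrite -(mul0r (0 : C)); apply: cvgM; apply: rtoC_cvg0.
  have d0 : 0 < rtoC del by rewrite rtoC_gt0.
  move/cvgrPdist_lt: c => /(_ _ d0); apply: filterS => t.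
  by rewrite sub0r normrN.
pose u t := (rtoC t)^-1 *: phi (zt t).
have uc : u t @[t --> (0 : R)^'] --> ell a (b + b^T) z.
  apply/cvg_rowP => i.
  apply: (@cvg_Ot R _ (fun=> ell a (b + b^T) z 0 i) _ (K * B ^+ 2)).
    move: (@near_neq0 R) nD; apply: filterS2 => t t0 /bnd[_ Gb _].
    have tC0 : rtoC t != 0 by rewrite rtoC_eq0.
    have -> : u t 0 i = ell a (b + b^T) z 0 i + (rtoC t)^-1 * G (zt t) 0 (rshift n i).
      have -> : u t = ell a (b + b^T) z + (rtoC t)^-1 *: rsubmx (G (zt t)).
        rewrite /u /phi /L linearD /= row_mxKr ell_rtoC scalerDr scalerA.
        by rewrite mulVf // scale1r.
      by rewrite [LHS]mxE; congr (_ + _); rewrite !mxE.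
    rewrite addrAC subrr add0r normrM normfV ler_pdivrMl ?normr_gt0 //.
    rewrite (le_trans (Gb _)) // norm_rtoCE -rtoCM rtoC_le.
    by have -> : K * (`|t| * B) ^+ 2 = `|t| * (`|t| * (K * B ^+ 2)) by ring.
  exact: cvg_cst.
have hc i j : (a + dlsubmx (H (zt t))) i j @[t --> (0 : R)^'] --> a i j.
  apply: (@cvg_Ot R _ (fun=> a i j) _ (K * B)); last exact: cvg_cst.
  apply: filterS nD => t /bnd[_ _ Hb].
  rewrite mxE addrAC subrr add0r /dlsubmx !mxE (le_trans (Hb _ _)) //.
  by rewrite mulrCA.
have FF : Filter ((0 : R)^') by exact: dnbhs_filter.
have uS : u t *m S @[t --> (0 : R)^'] --> ell a (b + b^T) z *m S.
  by apply: (cvg_mulmxl FF); apply: uc.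
have lim : sesq (a + dlsubmx (H (zt t))) (u t *m S) (u t *m S) @[t --> (0 : R)^'] -->
    sesq a (ell a (b + b^T) z *m S) (ell a (b + b^T) z *m S).
  apply: (cvg_dt FF); last by apply: (cvg_cmx FF); apply: uS.
  by apply: (cvg_mulmx FF); [apply: uS|apply: hc].
have lim0 : sesq (a + dlsubmx (H (zt t))) (u t *m S) (u t *m S) @[t --> (0 : R)^']
    --> (0 : C).
  have zero : (fun=> 0 : C) t @[t --> (0 : R)^'] --> (0 : C) by apply: cvg_cst.
  apply: cvg_trans zero; apply: near_eq_cvg.
  move: nD nrho; apply: filterS2 => t tD tr; rewrite /u -scalemxAl sesqZl sesqZr.
  by rewrite levi_identity // !mulr0.
exact: (cvg_unique _ lim lim0).
Qed.

End FlatImpliesNull.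

Section FlatLeviNull.
Variables (R : realType) (n : nat).
Local Notation C := (CC R).

Lemma near0_parts (P : Cn1 R n -> Prop) : (\forall p \near (0 : Cn1 R n), P p) ->
  exists2 d : R, 0 < d & forall p, (forall i, `|zpart p 0 i| < rtoC d) ->
    `|wpart p| < rtoC d -> P p.
Proof.
move=> /near_rowP[d d0 H]; exists d => // p pz pw; apply: H => i.
rewrite [X in _ - X]mxE subr0; case: (splitP i) => j ij.
  have -> : i = lshift 1 j by apply: val_inj.
  by have := pz j; rewrite mxE.
have -> : i = rshift n j by apply: val_inj.
by move: pw; rewrite /wpart mxE !ord1.
Qed.

(** On a common polydisc where [M] is the graph, the remainder is smooth and
    the Levi-map vanishes, [levi_identity_quadric] applies for every [S]. *)
Lemma flat_levi_null (M : set (Cn1 R n)) (a b : 'M[C]_n) (E : 'rV[C]_n -> C) :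
  real_analytic_O 3 E ->
  same_germ0 M (graph_of (fun z => A_form a z + B_form b z + E z)) ->
  Levi_flat_germ0 M -> levi_null a (b + b^T).
Proof.
move=> /real_analytic_O3_C2[d1 [K [G [H [d10 EGH]]]]] Mg Mf S Sa z.
have [d2 d20 Mg2] := near0_parts Mg; have [d3 d30 Mf3] := near0_parts Mf.
pose d := Num.min d1 (Num.min d2 d3).
have d0 : 0 < d by rewrite !lt_min d10 d20.
have dd1 : d <= d1 by rewrite ge_min lexx.
have dd2 : d <= d2 by rewrite !ge_min lexx orbT.
have dd3 : d <= d3 by rewrite !ge_min lexx !orbT.
have wk (e : R) (x : C) : d <= e -> `|x| < rtoC d -> `|x| < rtoC e.
  by move=> de xd; rewrite (lt_le_trans xd) // rtoC_le.
have in1 y : (forall i, `|(y : 'rV[C]_n) 0 i| < rtoC d) ->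
    forall i, `|y 0 i| < rtoC d1 by move=> yd i; apply: wk.
apply: (@levi_identity_quadric R n a b E d K G H d0 _ _ _ _ _ S Sa M).
- by move=> y /in1 /EGH[].
- by move=> y /in1 /EGH[].
- by move=> y /in1 /EGH[].
- by move=> y /in1 /EGH[].
- by move=> y /in1 /EGH[].
- move=> p pD pw; have := near_inD pD; have := near_wpart pw.
  apply: filterS2 => q qw qD; apply: Mg2; last exact: wk.
  by move=> i; apply: wk.
- by move=> p pD pw; apply: Mf3 => [i|]; apply: wk.
Qed.

End FlatLeviNull.

(** * Continuously differentiable fields along curves *)

Section C1Fields.
Variables (R : realType) (N : nat).
Local Notation C := (CC R).
Local Notation V := 'rV[C]_N.

Lemma near_normP (p : V) (P : V -> Prop) : (\forall q \near p, P q) ->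
  exists2 d : R, 0 < d & forall q, `|q - p| < rtoC d -> P q.
Proof.
move=> /nbhs_normP[e /= e0 H]; have [d d0 ed] := posC e0.
by exists d => // q qp; apply: H; rewrite /= ed distrC.
Qed.

Lemma mean_value_le (h dh : R -> R) (K s : R) : 0 < s ->
  (forall t, 0 <= t -> t <= s -> is_derive t (1 : R) h (dh t)) ->
  (forall t, 0 <= t -> t <= s -> `|dh t| <= K) ->
  `|h s - h 0| <= K * s.
Proof.
move=> s0 hd dK.
have [||c] := @MVT R h dh 0 s s0.
- by move=> x; rewrite in_itv /= => /andP[/ltW x0 /ltW xs]; apply: hd.
- apply: derivable_within_continuous => x; rewrite in_itv /= => /andP[x0 xs].
  by case: (hd x x0 xs).
rewrite in_itv /= => /andP[/ltW c0 /ltW cs] ->.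
by rewrite subr0 normrM (gtr0_norm s0) ler_wpM2r ?dK // ltW.
Qed.

Lemma Re_rtoCM (s : R) (x : C) : complex.Re (rtoC s * x) = s * complex.Re x.
Proof. by case: x => u v /=; rewrite mul0r subr0. Qed.

Lemma cvg_Re (T : Type) (F : set_system T) (FF : Filter F) (f : T -> C) (l : C) :
  f x @[x --> F] --> l -> complex.Re (f x) @[x --> F] --> complex.Re l.
Proof.
move=> /cvgrPdist_lt ul; apply/cvgrPdist_lt => e e0.
have e0' : 0 < rtoC e by rewrite rtoC_gt0.
apply: filterS (ul _ e0') => x.
have [s s0 ss] := norm_rtoC (l - f x); rewrite ss rtoC_lt => se.
by rewrite -raddfB (le_lt_trans _ se) // Re_norm_le // ss.
Qed.

Lemma svel_is_derive (g : R -> C) (c d : C) (t : R) :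
  svel (fun e => g (t + e)) d ->
  is_derive t (1 : R) (fun e => complex.Re (c * g e)) (complex.Re (c * d)).
Proof.
move=> gd; pose u e := (rtoC e)^-1 * (c * g (t + e) - c * g (t + 0)).
have ul : u e @[e --> (0 : R)^'] --> c * d by apply: (svelZ (s := c) gd).
pose F (e : R) : R := e^-1 *: (((fun e => complex.Re (c * g e)) \o shift t) (e *: (1 : R)) -
  complex.Re (c * g t)).
have FE : F = fun e => complex.Re (u e).
  apply/funext => e; rewrite /F /u /= -rtoCV Re_rtoCM [complex.Re (_ - _)]raddfB addr0.
  by rewrite [e%:A]mulr1 [e + t]addrC.
have H : F e @[e --> (0 : R)^'] --> complex.Re (c * d).
  by rewrite FE; apply: (cvg_Re (dnbhs_filter (0 : R)) ul).
split; first exact: (cvgP _ H).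
exact: (cvg_lim _ H).
Qed.

Lemma norm_Re_Im_le (x : C) (K : R) : `|complex.Re x| <= K ->
  `|complex.Re (- 'i%C * x)| <= K -> `|x| <= rtoC (2 * K).
Proof.
move=> xr xi; rewrite [x]complexE mulrDl mul1r rtoCD.
apply: le_trans (ler_normD _ _) _; rewrite lerD //.
  by rewrite -[X in `|X|]/(rtoC _) norm_rtoCE rtoC_le.
rewrite normrM (_ : `|'i%C| = 1 :> C); last first.
  by rewrite normc_def /= expr0n add0r expr1n sqrtr1.
rewrite mul1r -[X in `|X|]/(rtoC _) norm_rtoCE rtoC_le.
by move: xi; rewrite mulNr raddfN /= mulrC ReiNIm opprK.
Qed.

Variables (f : V -> C) (Df : V -> V -> C) (p : V).

(** This is the condition that [C1_field_at] puts on each coordinate of a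
    field. *)
Hypothesis f_C1 : \forall q \near p, forall v,
  svel (fun t => f (q + rtoC t *: v)) (Df q v) /\
  Df q' v @[q' --> q] --> Df q v.

Definition lipschitz_along (v : V) (K d : R) := forall q s, `|q - p| < rtoC d ->
  `|s| < d -> `|f (q + rtoC s *: v) - f q| <= rtoC (K * `|s|).

(** The directional derivative is bounded near [p] by its continuity; the mean
    value theorem is applied to the real and to the imaginary part, whence the
    factor [2]. *)
Lemma C1_lipschitz_dir v : exists K d : R, [/\ 0 <= K, 0 < d & lipschitz_along v K d].
Proof.
have [_ cp] := nbhs_singleton f_C1 v.
have [m m0 mE] := norm_rtoC (Df p v).
have FF : Filter (nbhs p) by exact: nbhs_filter.
have bd : \forall q \near p, `|Df q v| <= rtoC (m + 1).
  move/(cvgrPdist_lt (FF := FF)): cp => /(_ 1 ltr01); apply: filterS => q /ltW qp.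
  rewrite -[Df q v](subrK (Df p v)) (le_trans (ler_normD _ _)) // addrC rtoCD rtoC1.
  by rewrite lerD ?mE // distrC.
have [r r0 Hr] := near_normP (filterI f_C1 bd).
have [w w0 wE] := nonneg_rtoC (normr_ge0 v).
(* keeps [q + t v] within [r] of [p] for [|q - p| < d] and [|t| < d] *)
pose d := r / (w + 2).
have w2 : 0 < w + 2 by rewrite ltr_wpDl.
have d0 : 0 < d by rewrite divr_gt0.
have key q s : `|q - p| < rtoC d -> 0 < s -> s < d ->
    `|f (q + rtoC s *: v) - f q| <= rtoC (2 * ((m + 1) * s)).
  move=> qp s0 sd.
  have inr t : 0 <= t -> t <= s -> `|q + rtoC t *: v - p| < rtoC r.
    move=> t0 ts; rewrite addrAC (le_lt_trans (ler_normD _ _)) //.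
    rewrite normrZ norm_rtoCE (ger0_norm t0) wE.
    have [u u0 uE] := nonneg_rtoC (normr_ge0 (q - p)); move: qp; rewrite uE rtoC_lt => ud.
    rewrite -rtoCM -rtoCD rtoC_lt.
    have tw : t * w <= d * w by rewrite ler_wpM2r // (le_trans ts) // ltW.
    have -> : r = d * (w + 2) by rewrite /d divfK // gt_eqF.
    by rewrite mulrDr; lra.
  have part c : `|c| = 1 ->
      `|complex.Re (c * (f (q + rtoC s *: v) - f q))| <= (m + 1) * s.
    move=> c1; pose h t := complex.Re (c * f (q + rtoC t *: v)).
    have -> : complex.Re (c * (f (q + rtoC s *: v) - f q)) = h s - h 0.
      by rewrite /h rtoC0 scale0r addr0 -raddfB mulrBr.
    apply: (@mean_value_le h (fun t => complex.Re (c * Df (q + rtoC t *: v) v))) => //.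
      move=> t t0 ts; apply: svel_is_derive.
      have [/(_ v) [H _] _] := Hr _ (inr t t0 ts).
      rewrite (_ : (fun e => _) = fun e => f (q + rtoC t *: v + rtoC e *: v)).
        by apply: H.
      by apply/funext => e; rewrite rtoCD scalerDl addrA.
    move=> t t0 ts; apply: Re_norm_le; rewrite normrM c1 mul1r.
    by have [_] := Hr _ (inr t t0 ts).
  apply: norm_Re_Im_le; last apply: part.
    by rewrite -[f _ - _]mul1r part // normr1.
  by rewrite normrN normc_def /= expr0n add0r expr1n sqrtr1.
(* a negative step is a positive one from the end point, which must still be
   within [d] of [p] *)
exists (2 * (m + 1)), (d / (w + 2)); split.
- by rewrite mulr_ge0 // addr_ge0.
- by rewrite divr_gt0.
have dd : d / (w + 2) * (1 + w) < d.
  by rewrite mulrAC -mulrA gtr_pMr // ltr_pdivrMr //; lra.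
have dd' : d / (w + 2) < d.
  by rewrite ltr_pdivrMr // ltr_pMr //; lra.
move=> q s qp sd; have [s0|s0|->] := ltrgt0P s.
- rewrite (gtr0_norm s0) in sd *; rewrite -mulrA; apply: key => //.
    by rewrite (lt_trans qp) // rtoC_lt.
  exact: lt_trans dd'.
- rewrite (ltr0_norm s0) in sd *; rewrite -mulrA distrC.
  have := key (q + rtoC s *: v) (- s); rewrite rtoCN scaleNr addrK; apply.
  + have [u u0 uE] := nonneg_rtoC (normr_ge0 (q - p)); move: qp; rewrite uE rtoC_lt => ud.
    rewrite addrAC (le_lt_trans (ler_normD _ _)) // normrZ norm_rtoCE wE uE.
    rewrite -rtoCM -rtoCD rtoC_lt (ltr0_norm s0) (le_lt_trans _ dd) //.
    by rewrite mulrDr mulr1 lerD ?(ltW ud) // ler_wpM2r // (ltW sd).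
  + by rewrite oppr_gt0.
  + exact: lt_trans dd'.
- by rewrite rtoC0 scale0r addr0 subrr !normr0 mulr0 rtoC0.
Qed.

Fixpoint lin_comb (vs : seq V) (ss : seq R) : V :=
  if vs is v :: vs' then
    if ss is s :: ss' then rtoC s *: v + lin_comb vs' ss' else 0
  else 0.

(** An increment is split into steps along the given directions, each of which
    starts near enough to [p] for the estimate in its direction. *)
Lemma C1_lipschitz_comb vs : exists K d : R, [/\ 0 <= K, 0 < d &
  forall q ss (eta : R), `|q - p| < rtoC d -> 0 <= eta -> eta < d ->
    all (fun s => `|s| <= eta) ss ->
    `|f (q + lin_comb vs ss) - f q| <= rtoC (K * eta)].
Proof.
elim: vs => [|v vs [K [d [K0 d0 IH]]]].
  exists 0, 1; split => // q ss eta _ _ _ _ /=.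
  by rewrite addr0 subrr normr0 mul0r rtoC0.
have [K1 [d1 [K10 d10 H1]]] := C1_lipschitz_dir v.
have [w w0 wE] := nonneg_rtoC (normr_ge0 v).
have w1 : 0 < w + 2 by rewrite ltr_wpDl.
exists (K + K1), (Num.min d1 (d / (w + 2))); split; first exact: addr_ge0.
  by rewrite lt_min d10 divr_gt0.
move=> q [|s ss] eta qp e0; rewrite lt_min => /andP[ed1 ed] /=.
  by move=> _; rewrite addr0 subrr normr0 rtoC_ge0 mulr_ge0 // addr_ge0.
move=> /andP[se sse].
have qd1 : `|q - p| < rtoC d1 by rewrite (lt_le_trans qp) // rtoC_le ge_min lexx.
have qd : `|q - p| < rtoC (d / (w + 2)).
  by rewrite (lt_le_trans qp) // rtoC_le ge_min lexx orbT.
have ed' : eta < d.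
  by apply: lt_trans ed _; rewrite ltr_pdivrMr // ltr_pMr //; lra.
have q'd : `|q + rtoC s *: v - p| < rtoC d.
  have [u u0 uE] := nonneg_rtoC (normr_ge0 (q - p)); move: qd; rewrite uE rtoC_lt => ud.
  rewrite addrAC (le_lt_trans (ler_normD _ _)) // normrZ norm_rtoCE wE uE.
  rewrite -rtoCM -rtoCD rtoC_lt.
  have sw : `|s| * w <= d / (w + 2) * w by rewrite ler_wpM2r // (le_trans se) // ltW.
  have -> : d = d / (w + 2) * (w + 2) by rewrite divfK // gt_eqF.
  by rewrite [ltRHS]mulrDr; have := divr_gt0 d0 w1; lra.
rewrite addrA -(subrK (f (q + rtoC s *: v)) (f (_ + _ + _))) -addrA.
apply: le_trans (ler_normD _ _) _; rewrite mulrDl rtoCD lerD //.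
  exact: IH.
apply: le_trans (H1 q s qd1 (le_lt_trans se ed1)) _.
by rewrite rtoC_le ler_wpM2l.
Qed.

Definition real_basis : seq V :=
  [seq delta_mx 0 j | j <- enum 'I_N] ++ [seq 'i%C *: delta_mx 0 j | j <- enum 'I_N].

Definition real_coords (u : V) : seq R :=
  [seq complex.Re (u 0 j) | j <- enum 'I_N] ++
  [seq complex.Im (u 0 j) | j <- enum 'I_N].

Lemma lin_comb_cat vs ws ss ts : size vs = size ss ->
  lin_comb (vs ++ ws) (ss ++ ts) = lin_comb vs ss + lin_comb ws ts.
Proof.
elim: vs ss => [|v vs IH] [|s ss] //= => [_|[E]]; first by rewrite add0r.
by rewrite IH // addrA.
Qed.

Lemma lin_comb_map (I : Type) (r : seq I) (v : I -> V) (s : I -> R) :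
  lin_comb [seq v i | i <- r] [seq s i | i <- r] = \sum_(i <- r) rtoC (s i) *: v i.
Proof. by elim: r => [|i r IH] /=; rewrite ?big_nil // big_cons IH. Qed.

Lemma lin_comb_basis u : lin_comb real_basis (real_coords u) = u.
Proof.
rewrite lin_comb_cat ?size_map // !lin_comb_map !big_enum /= -big_split /=.
rewrite [RHS]row_sum_delta; apply: eq_bigr => j _.
by rewrite scalerA -scalerDl mulrC -complexE.
Qed.

Lemma norm_coord (u : V) j : `|u 0 j| <= `|u|.
Proof.
have [t t0 tE] := nonneg_rtoC (normr_ge0 u); have [s s0 sE] := norm_rtoC (u 0 j).
rewrite tE sE rtoC_le leNgt; apply/negP => ts.
have : ball (0 : V) (rtoC s) u.
  by rewrite mx_norm_ball /ball_ /= sub0r normrN tE rtoC_lt.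
move=> [_ /(_ 0 j)]; rewrite /ball /= mxE sub0r normrN sE.
by rewrite ltxx.
Qed.

Lemma real_coords_le u (eta : R) : `|u| <= rtoC eta ->
  all (fun s => `|s| <= eta) (real_coords u).
Proof.
move=> ue; have uj j : `|u 0 j| <= rtoC eta by apply: le_trans (norm_coord u j) ue.
rewrite all_cat !all_map; apply/andP; split; apply/allP => j _ /=.
  exact: Re_norm_le.
have -> : complex.Im (u 0 j) = complex.Re (- 'i%C * u 0 j).
  by rewrite mulNr raddfN /= mulrC ReiNIm opprK.
apply: Re_norm_le; rewrite normrM (_ : `|- 'i%C| = 1 :> C) ?mul1r //.
by rewrite normrN normc_def /= expr0n add0r expr1n sqrtr1.
Qed.

(** A curve with velocity [v] differs from the line [p + t v] by [o(t)], and
    [f] is Lipschitz near [p], as one sees by moving in the [2N] real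
    coordinate directions one after the other. So the derivative along the
    curve is the derivative along the line. *)
Lemma C1_hdiff : hdiff f p (Df p).
Proof.
move=> g v g0 gv.
have [K [d [K0 d0 HK]]] := C1_lipschitz_comb real_basis.
have [line _] := nbhs_singleton f_C1 v.
pose q t : V := (rtoC t)^-1 *: (g t - g 0).
have qv : q t @[t --> (0 : R)^'] --> v by apply: gv.
pose u t : V := g t - (p + rtoC t *: v).
have nz := @near_neq0 R.
have uE t : t != 0 -> u t = rtoC t *: (q t - v).
  move=> t0; rewrite scalerBr /q scalerA divff ?rtoC_eq0 // scale1r g0 /u.
  by rewrite opprD addrA.
have qv0 (e : R) : 0 < e -> \forall t \near (0 : R)^', `|q t - v| < rtoC e.
  move=> e0; have e0' : 0 < rtoC e by rewrite rtoC_gt0.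
  move/cvgrPdist_lt: qv => /(_ _ e0'); apply: filterS => t.
  by rewrite distrC.
have [w w0 wE] := nonneg_rtoC (normr_ge0 v).
have smallt (e : R) : 0 < e -> \forall t \near (0 : R)^', `|t| < e.
  by move=> e0; apply: dnbhs0_lt.
have d1 : 0 < d / (w + 1) by rewrite divr_gt0 // ltr_wpDl.
have main : \forall t \near (0 : R)^', `|f (g t) - f (p + rtoC t *: v)| <=
    rtoC (K * `|t|) * `|q t - v|.
  near=> t.
  have q1 : `|q t - v| < rtoC 1 by near: t; apply: qv0.
  have t0 : t != 0 by near: t; apply: nz.
  have td1 : `|t| < d / (w + 1) by near: t; apply: smallt.
  have td : `|t| < d by near: t; apply: smallt.
  have [s s0 sE] := nonneg_rtoC (normr_ge0 (q t - v)).
  have us : `|u t| <= rtoC (`|t| * s).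
    by rewrite uE // normrZ norm_rtoCE sE rtoCM.
  have qd : `|p + rtoC t *: v - p| < rtoC d.
    rewrite addrAC subrr add0r normrZ norm_rtoCE wE -rtoCM rtoC_lt.
    move: td1; rewrite ltr_pdivlMr ?ltr_wpDl // => /(le_lt_trans _) -> //.
    by rewrite ler_wpM2l // lerDl.
  have s1 : s < 1 by rewrite -rtoC_lt rtoC1 -sE.
  have etad : `|t| * s < d.
    by apply: le_lt_trans td; rewrite ler_piMr // ltW.
  have := HK _ _ _ qd (mulr_ge0 (normr_ge0 t) s0) etad (real_coords_le us).
  have pu : p + rtoC t *: v + u t = g t by rewrite /u addrC subrK.
  rewrite lin_comb_basis pu => H.
  by rewrite sE -rtoCM -mulrA.
have quot : (rtoC t)^-1 * (f (g t) - f (p + rtoC t *: v)) @[t --> (0 : R)^'] --> (0 : C).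
  apply/cvgrPdist_lt => _ /posC[e e0 ->].
  have eK : 0 < e / (K + 1) by rewrite divr_gt0 // ltr_wpDl.
  near=> t.
  have qe : `|q t - v| < rtoC (e / (K + 1)) by near: t; apply: qv0.
  have t0 : t != 0 by near: t; apply: nz.
  have H : `|f (g t) - f (p + rtoC t *: v)| <= rtoC (K * `|t|) * `|q t - v|.
    by near: t; apply: main.
  have t1 : 0 < `|t| by rewrite normr_gt0.
  rewrite sub0r normrN normrM normfV norm_rtoCE ltr_pdivrMl ?rtoC_gt0 //.
  apply: le_lt_trans H _.
  have [s s0 sE] := nonneg_rtoC (normr_ge0 (q t - v)).
  move: qe; rewrite sE -!rtoCM !rtoC_lt ltr_pdivlMr ?ltr_wpDl // => se.
  rewrite mulrAC mulrC ltr_pM2l // (le_lt_trans _ se) // mulrC ler_wpM2l //.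
  by rewrite lerDl.
rewrite /svel (_ : (fun t => _) = fun t =>
  (rtoC t)^-1 * (f (g t) - f (p + rtoC t *: v)) +
  (rtoC t)^-1 * (f (p + rtoC t *: v) - f (p + rtoC 0 *: v))); last first.
  apply/funext => t; rewrite -mulrDr addrA subrK.
  by rewrite rtoC0 scale0r addr0 g0.
by rewrite -[Df p v]add0r; apply: cvgD; [apply: quot|apply: line].
Unshelve. all: by end_near.
Qed.
End C1Fields.

(** * Levi-flatness of quadrics satisfying the Levi condition *)

Section QuadricFlat.
Variables (R : realType) (n : nat).
Local Notation C := (CC R).

Lemma C1_field_velocity N (X : 'rV[C]_N -> 'rV[C]_N) DX p g v :
  C1_field_at X DX p -> g 0 = p -> is_velocity g v ->
  is_velocity (fun t => X (g t)) (DX p v).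
Proof.
move=> XC g0 gv; apply/is_velocityP => i.
apply: (@C1_hdiff R N (fun q => X q 0 i) (fun q v => DX q v 0 i) p _ g v g0 gv).
move: XC; apply: filterS => q Hq u; have [/is_velocityP H1 H2] := Hq u; split.
  by apply: H1.
have FF : Filter (nbhs q) by exact: nbhs_filter.
by move: i; apply/(cvg_rowP FF).
Qed.

(** Let [x] and [u] be the first parts of [X] and [Y] at [p]. Differentiating
    the two equations of [T^c] for [X] along a curve in the quadric with
    velocity [Y p], and conversely, shows that the bracket satisfies them iff
    [conj x a u = conj u a x]. Where [ell] is nonzero, both sides vanish
    by [levi_null_perp], as [conj x] and [conj u] are orthogonal to [ell].
    Where [ell = 0], the derivatives of the second equation reduce to
    [conj x . ell u = 0 = conj u . ell x], whose pure parts agree by the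
    symmetry of [B], hence so do the mixed parts. *)
Lemma levi_null_flat (a b : 'M[C]_n) : levi_null a (b + b^T) -> Levi_flat (quadric a b).
Proof.
set B := b + b^T => LN p [Qp _] X Y DX DY XC YC Xt Yt.
have Bs : B^T = B by rewrite /B linearD /= trmxK addrC.
have Qg q : graph_at (quadric a b) (qfun a b) q by apply: filterE.
have rQ q := @rdiff_qfun R n a b (zpart q).
pose z := zpart p.
have cP q v : quadric a b q -> ctangent (quadric a b) q v <->
    wpart v = dt (zpart v) (cmx (zpart q) *m a) /\
    dt (cmx (zpart v)) (ell a B (zpart q)) = 0.
  by move=> Qq; rewrite (ctangent_graph (Qg q) Qq (rQ q)) row_mxKl row_mxKr.
have deriv (Z W : Cn1 R n -> Cn1 R n) (DZ : Cn1 R n -> Cn1 R n -> Cn1 R n) :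
    C1_field_at Z DZ p ->
    (\forall q \near p, quadric a b q -> ctangent (quadric a b) q (Z q)) ->
    (\forall q \near p, quadric a b q -> ctangent (quadric a b) q (W q)) ->
    let x := zpart (Z p) in let u := zpart (W p) in
    let xi := DZ p (W p) in
    wpart xi = dt x (cmx u *m a) + dt (zpart xi) (cmx z *m a) /\
    0 = dt (cmx x) (ell a B u) + dt (cmx (zpart xi)) (ell a B z).
  move=> ZC Zt Wt x u xi.
  have Wp : ctangent (quadric a b) p (W p) by apply: (nbhs_singleton Wt).
  have /(tangent_graph (Qg p) Qp (rQ p)) Wv := Wp.1.
  pose g := lift_curve (qfun a b) p u.
  have g0 : g 0 = p := lift_curve0 (Qg p) Qp u.
  have gv : is_velocity g (W p).
    by have := lift_curve_velocity (rQ p) (u := u); rewrite -Wv mkpK.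
  have xiv : is_velocity (fun t => Z (g t)) xi by apply: C1_field_velocity ZC g0 gv.
  have zxi := is_velocity_zpart xiv; have wxi := svel_wpart xiv.
  have zg := is_velocity_zpart gv.
  have near_c : \forall t \near (0 : R),
      wpart (Z (g t)) = dt (zpart (Z (g t))) (cmx (zpart (g t)) *m a) /\
      0 = dt (cmx (zpart (Z (g t)))) (ell a B (zpart (g t))).
    have H1 := @lift_curve_near R n _ _ p _ (Qg p) Qp (rQ p) u _ Zt.
    have H2 := @lift_curve_in R n _ _ p _ (Qg p) Qp (rQ p) u.
    move: H1 H2; apply: filterS2 => t H1 H2.
    by have /(cP _ _ H2)[H3 ->] := H1 H2.
  have [c0 c0'] := nbhs_singleton near_c.
  have nc : \forall t \near (0 : R)^',
      wpart (Z (g t)) = dt (zpart (Z (g t))) (cmx (zpart (g t)) *m a) /\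
      0 = dt (cmx (zpart (Z (g t)))) (ell a B (zpart (g t))).
    by rewrite near_withinE; move: near_c; apply: filterS.
  have cg : is_velocity (fun t => cmx (zpart (g t)) *m a) (cmx u *m a).
    by apply: is_velocity_mulmx; apply: is_velocity_cmx zg.
  have D1 := svel_dt zxi cg.
  have D2 := svel_dt (is_velocity_cmx zxi) (is_velocity_ell (a := a) (B := B) zg).
  split.
    have W2 : svel (fun t => wpart (Z (g t))) (dt (zpart xi) (cmx z *m a) + dt x (cmx u *m a)).
      rewrite g0 in D1; apply: svel_near D1; first by apply: esym c0.
      by move: nc; apply: filterS => t [Et _]; apply: esym Et.
    by rewrite addrC; apply: (svel_unique wxi W2).
  have S0 := svel_cst (0 : C).
  have W2 : svel (fun=> 0 : C) (dt (cmx (zpart xi)) (ell a B z) + dt (cmx x) (ell a B u)).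
    rewrite g0 in D2; apply: svel_near D2; first by apply: esym c0'.
    by move: nc; apply: filterS => t [_ Et]; apply: esym Et.
  by rewrite addrC; apply: (svel_unique S0 W2).
set x := zpart (X p); set u := zpart (Y p).
have [xi1 xi2] := deriv X Y DX XC Xt Yt.
have [eta1 eta2] := deriv Y X DY YC Yt Xt.
rewrite -/x -/u in xi1 xi2 eta1 eta2.
have /(cP _ _ Qp)[_ xm] := nbhs_singleton Xt Qp; rewrite -/x -/z in xm.
have /(cP _ _ Qp)[_ um] := nbhs_singleton Yt Qp; rewrite -/u -/z in um.
have zE : zpart p = z by [].
apply/(cP _ _ Qp); rewrite zE.
move: (DX p (Y p)) (DY p (X p)) xi1 xi2 eta1 eta2 xm um => xi eta.
clear deriv cP XC YC Xt Yt; clearbody x u z => xi1 xi2 eta1 eta2 xm um.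
have Ell (v w : 'rV[C]_n) :
    dt (cmx v) (ell a B w) = dt (cmx v *m a) w + dt (cmx v *m B) (cmx w).
  rewrite (dt_mulmx (cmx v) a w) (dt_mulmx (cmx v) B (cmx w)) Bs.
  exact: (dtDr (cmx v) (w *m a^T) (cmx w *m B)).
have sym : dt (cmx x *m B) (cmx u) = dt (cmx u *m B) (cmx x) by apply: dt_symC.
have key : dt (cmx x *m a) u = dt (cmx u *m a) x.
  have [l0|l0] := eqVneq (ell a B z) 0.
    rewrite l0 (dt0r (cmx (zpart xi))) addr0 Ell sym in xi2.
    rewrite l0 (dt0r (cmx (zpart eta))) addr0 Ell in eta2.
    by apply: (@addIr _ (dt (cmx u *m B) (cmx x))); rewrite -xi2 -eta2.
  have E v w : dt (cmx v) (ell a B z) = 0 -> dt (cmx w) (ell a B z) = 0 ->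
      dt (cmx v *m a) w = 0.
    by move=> v0 w0; have := levi_null_perp LN v0 w0 l0; rewrite /sesq cmxK.
  by rewrite !E.
rewrite zpartB wpartB; split.
  rewrite eta1 xi1 dtDl dtNl [dt u _]dtC key [dt x _]dtC.
  by rewrite opprD addrACA subrr add0r.
rewrite cmxD cmxN dtDl dtNl; apply/eqP; rewrite subr_eq0; apply/eqP.
apply: (@addrI _ (dt (cmx x) (ell a B u))); rewrite -xi2 {1}Ell key sym -Ell.
by rewrite -eta2.
Qed.
End QuadricFlat.

(** * Second order expansion of holomorphic germs *)

Section SecondOrder.
Variables (R : realType) (N : nat).
Local Notation C := (CC R).
Implicit Types (x v : 'rV[C]_N).

Lemma cvgC_unique (T : Type) (F : set_system T) (FF : ProperFilter F)
    (f : T -> C) (l l' : C) :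
  f x @[x --> F] --> l -> f x @[x --> F] --> l' -> l = l'.
Proof. by move=> H H'; apply: cvg_unique H H'. Qed.

Lemma gser_mask c e (r K : R) (f : 'rV[C]_N -> C) (P : pred (mindex N)) :
  gser c e r K f ->
  exists g, gser (fun m => if P m then c m else 0) e r K g.
Proof.
move=> [r0 bK _].
have dom m : `|if P m then c m else 0| * rtoC (r ^+ mdegree (e m)) <=
    `|c m| * rtoC (r ^+ mdegree (e m)).
  by case: (P m) => //; rewrite normr0 mul0r mulr_ge0 // rtoC_ge0 exprn_ge0 // ltW.
have bound d : csum (fun m => `|if P m then c m else 0| *
    rtoC (r ^+ mdegree (e m))) d <= rtoC K.
  by apply: le_trans (bK d); apply: ler_sum => m _; apply: dom.
have cvgx x : exists l : C, (forall i, `|x 0 i| < rtoC r) ->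
    csum (fun m => (if P m then c m else 0) * monomial x (e m)) d @[d --> \oo] --> l.
  have [xr|xr] := pselect (forall i, `|x 0 i| < rtoC r); last by exists (0 : C).
  have dx m : `|(if P m then c m else 0) * monomial x (e m)| <=
      `|if P m then c m else 0| * rtoC (r ^+ mdegree (e m)).
    by rewrite normrM ler_wpM2l // monomial_le // => j; exact: ltW.
  by have [l Hl _] := csum_cvg dx bound; exists l.
have [g Hg] := choice cvgx; exists g; split => // x; exact: Hg.
Qed.

(** The homogeneous parts of a series are isolated by [gser_mask]. *)
Lemma gser_homog c (r K : R) (f : 'rV[C]_N -> C) k s x :
  gser c id r K f -> (forall m, mdegree m != k -> c m = 0) ->
  `|s| <= 1 -> (forall i, `|x 0 i| < rtoC r) -> f (s *: x) = s ^+ k * f x.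
Proof.
move=> [r0 _ fc] ck s1 xr.
have sxr i : `|(s *: x) 0 i| < rtoC r.
  by rewrite mxE normrM (le_lt_trans _ (xr i)) // ler_piMl.
have H1 := fc _ sxr; have H2 : s ^+ k * csum (fun m => c m * monomial x m) d
    @[d --> \oo] --> s ^+ k * f x by apply: cvgMr; apply: fc.
have E : csum (fun m => c m * monomial (s *: x) m) = fun d =>
    s ^+ k * csum (fun m => c m * monomial x m) d.
  apply/funext => d; rewrite -csumZ; apply: eq_bigr => m _ /=.
  have [<-|mk] := eqVneq (mdegree (mindex_of m)) k; last by rewrite ck // !mul0r mulr0.
  by rewrite monomialZ mulrCA.
by rewrite /= E in H1; apply: (cvgC_unique _ H1 H2).
Qed.

(** [d] is the gradient at the origin and [h] the quadratic part. Its
    homogeneity and continuity allow one to put [x = t y] and to pass to the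
    limit in [t] when [y] depends on [t]. *)
Lemma holomorphic_second_order (f : 'rV[C]_N -> C) : holomorphic_at0 f -> f 0 = 0 ->
  exists (d : 'rV[C]_N) (h : 'rV[C]_N -> C) (r K : R), [/\ 0 < r,
    hdiff f 0 (fun v => dt v d),
    forall s x, `|s| <= 1 -> (forall i, `|x 0 i| < rtoC r) ->
      h (s *: x) = s ^+ 2 * h x,
    forall x, (forall i, `|x 0 i| < rtoC r) -> h y @[y --> x] --> h x &
    forall (s : R) x, 0 <= s -> s < r -> (forall i, `|x 0 i| <= rtoC s) ->
      `|f x - (dt x d + h x)| <= rtoC (s ^+ 3 * K)].
Proof.
move=> [c [r Pf]] f0; have [K fE] := pseries_gser Pf.
have [r0 bK fc] := fE; have K0 := gser_K_ge0 fE.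
have [f_0 E0] := gser_mask (fun m => mdegree m == 0%N) fE.
have [f_1 E1] := gser_mask (fun m => mdegree m == 1%N) fE.
have [f_2 E2] := gser_mask (fun m => mdegree m == 2%N) fE.
have [f_3 E3] := gser_mask (fun m => (2 < mdegree m)%N) fE.
have split_f x : (forall i, `|x 0 i| < rtoC r) ->
    f x = f_0 x + f_1 x + f_2 x + f_3 x.
  move=> xr; have Hf := fc x xr.
  have [_ _ /(_ x xr) c0] := E0; have [_ _ /(_ x xr) c1] := E1.
  have [_ _ /(_ x xr) c2] := E2; have [_ _ /(_ x xr) c3] := E3.
  pose S P k := csum (fun m => (if P (mdegree m) then c m else 0) * monomial x m) k.
  have H : S (fun k => k == 0%N) k + S (fun k => k == 1%N) k + S (fun k => k == 2%N) k
      + S (fun k => (2 < k)%N) k @[k --> \oo] --> f_0 x + f_1 x + f_2 x + f_3 x.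
    apply: cvgD; last by apply: c3.
    apply: cvgD; last by apply: c2.
    by apply: cvgD; [apply: c0|apply: c1].
  have E : csum (fun m => c m * monomial x m) = fun k => S (fun k => k == 0%N) k +
      S (fun k => k == 1%N) k + S (fun k => k == 2%N) k + S (fun k => (2 < k)%N) k.
    apply/funext => k; rewrite /S -!csumD; apply: eq_bigr => m _.
    rewrite -!mulrDl; congr (_ * _).
    by case: (mdegree _) => [|[|[|j]]] /=; rewrite ?addr0 ?add0r.
  by rewrite /= E in Hf; apply: (cvgC_unique _ Hf H).
have h0 s x : `|s| <= 1 -> (forall i, `|x 0 i| < rtoC r) -> f_0 (s *: x) = s ^+ 0 * f_0 x.
  by apply: (gser_homog E0) => m /negPf ->.
have h1 s x : `|s| <= 1 -> (forall i, `|x 0 i| < rtoC r) -> f_1 (s *: x) = s ^+ 1 * f_1 x.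
  by apply: (gser_homog E1) => m /negPf ->.
have h2 s x : `|s| <= 1 -> (forall i, `|x 0 i| < rtoC r) -> f_2 (s *: x) = s ^+ 2 * f_2 x.
  by apply: (gser_homog E2) => m /negPf ->.
have h3 s x : 0 <= s -> s < r -> (forall i, `|x 0 i| <= rtoC s) ->
    `|f_3 x| <= rtoC ((s / r) ^+ 3 * K).
  apply: (gser_small E3) => m; rewrite ltnS leqNgt.
  by case: (2 < mdegree m)%N.
have [g1 G1] := choice (gser_partial E1).
have r20 : 0 < r / 2 by rewrite divr_gt0.
have z0 i : `|(0 : 'rV[C]_N) 0 i| < rtoC (r / 2) by rewrite mxE normr0 rtoC_gt0.
have D1 := gser_hdiff E1 G1 z0.
set d := \row_i g1 i 0 in D1.
have f1E x : (forall i, `|x 0 i| < rtoC r) -> f_1 x = dt x d.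
  move=> xr; have V : is_velocity (fun t => 0 + rtoC t *: x) x by apply: is_velocity_line.
  have S1 : svel (fun t => f_1 (0 + rtoC t *: x)) (dt x d).
    by apply: D1 V; rewrite rtoC0 scale0r addr0.
  have S2 : svel (fun t => f_1 (0 + rtoC t *: x)) (f_1 x).
    have S3 := svelM (@svel_id R) (svel_cst (f_1 x)).
    rewrite mulr0 addr0 mul1r in S3; apply: svel_near S3.
      by rewrite rtoC0 scale0r addr0 mul0r -(scale0r x) h1 ?normr0 // expr1 mul0r.
    have e1 : (0 : R) < 1 by [].
    have := @dnbhs0_lt R R _ e1; apply: filterS => t t1.
    by rewrite add0r h1 ?expr1 // norm_rtoCE -rtoC1 rtoC_le ltW.
  by apply: svel_unique S2 S1.
have zr i : `|(0 : 'rV[C]_N) 0 i| < rtoC r by rewrite mxE normr0 rtoC_gt0.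
have f30 : f_3 0 = 0.
  apply/eqP; rewrite -normr_le0; have := h3 0 0 (lexx _) r0.
  rewrite mul0r expr0n mul0r rtoC0; apply => i.
  by rewrite mxE normr0.
have f00 x : (forall i, `|x 0 i| < rtoC r) -> f_0 x = 0.
  move=> xr; have := h0 0 x; rewrite normr0 ler01 scale0r expr0 mul1r => <- //.
  have := split_f 0 zr; rewrite f0 f30 f1E // dt0l.
  have := h2 0 0; rewrite normr0 ler01 scaler0 expr0n mul0r => -> //.
  by rewrite !addr0 => <-.
have fE' x : (forall i, `|x 0 i| < rtoC r) -> f x - (dt x d + f_2 x) = f_3 x.
  by move=> xr; rewrite split_f // f00 // f1E // add0r addrC addKr.
have lr (s : R) (x : 'rV[C]_N) : s < r -> (forall i, `|x 0 i| <= rtoC s) ->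
    forall i, `|x 0 i| < rtoC r.
  by move=> sr xs i; rewrite (le_lt_trans (xs i)) // rtoC_lt.
have r2r : r / 2 < r by rewrite ltr_pdivrMr // ltr_pMr // ltr1n.
exists d, f_2, (r / 2), (K / r ^+ 3); split => //.
- apply: (@hdiff_taylor R N f 0 d (r / 2) (K + K)) => // u t ur t1.
  have ur' := lr _ _ r2r ur.
  have tur i : `|(t *: u) 0 i| <= rtoC (r / 2).
    by rewrite mxE normrM (le_trans _ (ur i)) // ler_piMl.
  rewrite add0r f0 subr0; have -> : f (t *: u) - t * dt u d = t ^+ 2 * f_2 u + f_3 (t *: u).
    rewrite -h2 // -fE' ?dtZl; last exact: lr r2r tur.
    move: (f _) (f_2 _) (dt _ _) => A A' D; ring.
  apply: le_trans (ler_normD _ _) _; rewrite rtoCD mulrDr lerD //.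
    rewrite normrM normrX ler_wpM2l ?exprn_ge0 //.
    have := gser_small (k := 0) E2 _ (ltW r20) r2r ur; rewrite expr0 mul1r; exact.
  have [s s0 sE] := norm_rtoC t.
  have s1 : s <= 1 by rewrite -rtoC_le -sE rtoC1.
  have sr : s * (r / 2) < r.
    by apply: le_lt_trans r2r; rewrite ler_piMl // ltW.
  have tus i : `|(t *: u) 0 i| <= rtoC (s * (r / 2)).
    by rewrite mxE normrM rtoCM -sE ler_wpM2l.
  apply: le_trans (h3 _ _ (mulr_ge0 s0 (ltW r20)) sr tus) _.
  rewrite sE -rtoCX -rtoCM rtoC_le ler_wpM2r //.
  have -> : s * (r / 2) / r = s / 2 by rewrite mulrA mulrAC mulfK // gt_eqF.
  have e1 : 0 <= s / 2 by rewrite divr_ge0.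
  apply: (@le_trans _ _ ((s / 2) ^+ 2)).
    by rewrite ler_wiXn2l //; lra.
  by rewrite lerXn2r ?nnegrE //; lra.
- by move=> s x s1 xr; apply: h2 => // i; rewrite (lt_trans (xr i)) // rtoC_lt.
- by move=> x xr; apply: gser_cont E2 xr.
- move=> s x s0 sr xs; have sr' := lt_trans sr r2r.
  rewrite fE'; last exact: lr sr' xs.
  apply: le_trans (h3 _ _ s0 sr' xs) _.
  by rewrite rtoC_le expr_div_n mulrAC -mulrA.
Qed.
End SecondOrder.

(** * Linear and local biholomorphic maps *)

Section LinearGerms.
Variables (R : realType) (N : nat).
Local Notation C := (CC R).

(** The exponent of the monomial [x_j]. *)
Definition munit (j : 'I_N) : mindex N := [ffun k => (k == j) : nat].

Lemma monomial_munit (x : 'rV[C]_N) j : monomial x (munit j) = x 0 j.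
Proof.
rewrite /monomial (bigD1 j) //= ffunE eqxx expr1 big1 ?mulr1 // => k kj.
by rewrite ffunE (negPf kj) expr0.
Qed.

Lemma csum_point (be : mindex N) (F : mindex N -> C) D :
  csum (fun al => if al == be then F al else 0) D =
  if [forall i, (be i < D)%N] then F be else 0.
Proof.
case: ifP => [/forallP H|/negP H]; last first.
  rewrite /csum big1 // => m _; case: eqP => // E; case: H.
  by apply/forallP => i; rewrite -E ffunE.
pose m0 : {ffun 'I_N -> 'I_D} := [ffun i => Ordinal (H i)].
have E0 : mindex_of m0 = be by apply/ffunP => i; rewrite !ffunE.
rewrite /csum (bigD1 m0) //= E0 eqxx big1 ?addr0 // => m mm0.
case: eqP => // E; case/eqP: mm0; apply/ffunP => i; apply: val_inj.
by move/ffunP: E => /(_ i); rewrite -E0 !ffunE.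
Qed.

Lemma linear_holomorphic (d : 'rV[C]_N) : holomorphic_at0 (fun x => dt x d).
Proof.
pose c (al : mindex N) : C := \sum_j (if al == munit j then d 0 j else 0).
have csE D (w : mindex N -> 'I_N -> C) :
    csum (fun al => \sum_j (if al == munit j then w al j else 0)) D =
    \sum_j (if [forall i, (munit j i < D)%N] then w (munit j) j else 0).
  rewrite /csum exchange_big /=; apply: eq_bigr => j _.
  exact: (csum_point (munit j) (fun al => w al j)).
exists c, 1; split; first exact: ltr01.
  exists (\sum_j complex.Re `|d 0 j|) => D.
  have KE : rtoC (\sum_j complex.Re `|d 0 j|) = \sum_j `|d 0 j|.
    rewrite /rtoC rmorph_sum; apply: eq_bigr => j _.
    exact: (rtoC_Re (normr_real _)).
  apply: (@le_trans _ _ (csum (fun al => \sum_j (if al == munit j then `|d 0 j| else 0)) D)).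
    apply: ler_sum => m _; rewrite expr1n rtoC1 mulr1.
    apply: le_trans (ler_norm_sum _ _ _) _; apply: ler_sum => j _.
    by case: ifP => // _; rewrite normr0.
  rewrite (csE D (fun _ j => `|d 0 j|)) KE; apply: ler_sum => j _.
  by case: ifP.
move=> x _.
have c0 : (fun=> dt x d) t @[t --> \oo] --> dt x d by apply: cvg_cst.
apply: cvg_trans c0; apply: near_eq_cvg; near=> D.
have D2 : (2 <= D)%N by near: D; exists 2%N.
have -> : psum c D x =
    csum (fun al => \sum_j (if al == munit j then d 0 j * monomial x al else 0)) D.
  apply: eq_bigr => m _; rewrite /c big_distrl /=; apply: eq_bigr => j _.
  by case: ifP => // _; rewrite mul0r.
rewrite (csE D (fun al j => d 0 j * monomial x al)) dtE; apply: eq_bigr => j _.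
rewrite monomial_munit mulrC ifT //; apply/forallP => i.
by rewrite ffunE; apply: leq_ltn_trans D2; case: (i == j).
Unshelve. all: by end_near.
Qed.

Lemma linear_biholomorphic (J : 'M[C]_N) : J \in unitmx ->
  biholomorphic_germ (fun x : 'rV[C]_N => x *m J).
Proof.
have lin (A : 'M[C]_N) : holomorphic_map_at0 (fun x : 'rV[C]_N => x *m A).
  move=> i; have [c [r H]] := linear_holomorphic (row i A^T); exists c, r.
  rewrite (_ : (fun x => _) = fun x : 'rV[C]_N => dt x (row i A^T)) //.
  by apply/funext => x; rewrite -dt_delta dt_mulmx -rowE.
move=> Ju; split; [exact: lin|exact: mul0mx|].
exists (fun x => x *m invmx J); split; [exact: lin|exact: mul0mx| |];
  by apply: filterE => x; rewrite ?mulmxK ?mulmxKV.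
Qed.

Lemma holomorphic_velocity (F : 'rV[C]_N -> 'rV[C]_N) :
  holomorphic_map_at0 F -> F 0 = 0 ->
  exists J : 'M[C]_N, forall g v, g 0 = 0 -> is_velocity g v ->
    is_velocity (fun t => F (g t)) (v *m J).
Proof.
move=> Fh F0.
have H i : exists d : 'rV[C]_N, hdiff (fun x => F x 0 i) 0 (fun v => dt v d).
  have [|d [h [r [K [_ Hd _ _ _]]]]] := holomorphic_second_order (Fh i).
    by rewrite F0 mxE.
  by exists d.
have [d Hd] := choice H; exists (\matrix_(i, j) d j 0 i) => g v g0 gv.
apply/is_velocityP => i; have := @Hd i g v g0 gv.
rewrite dtE mxE; under [X in svel _ X -> _]eq_bigr do idtac.
by congr svel; apply: eq_bigr => j _; rewrite mxE.
Qed.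

(** The Jacobian is invertible, by the chain rule for [G (F x) = x]; the chain
    rule is the transport of velocities along curves. *)
Lemma biholomorphic_velocity (F : 'rV[C]_N -> 'rV[C]_N) : biholomorphic_germ F ->
  exists2 J : 'M[C]_N, J \in unitmx & forall g v, g 0 = 0 -> is_velocity g v ->
    is_velocity (fun t => F (g t)) (v *m J).
Proof.
move=> [Fh F0 [G [Gh G0 GF _]]].
have [J HJ] := holomorphic_velocity Fh F0; have [J' HJ'] := holomorphic_velocity Gh G0.
exists J => //.
have JJ (v : 'rV[C]_N) : v *m (J *m J') = v.
  have L : is_velocity (fun t => 0 + rtoC t *: v) v by apply: is_velocity_line.
  have Lc := is_velocity_cvg L.
  have l0 : (0 : 'rV[C]_N) + rtoC 0 *: v = 0 by rewrite rtoC0 scale0r addr0.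
  have V1 := HJ _ _ l0 L; have V2 := HJ' _ _ _ V1; rewrite mulmxA.
  apply: (is_velocity_unique (V2 _)); first by rewrite l0 F0.
  apply: is_velocity_near L; first by rewrite l0 F0 G0.
  have near_id : \forall t \near (0 : R)^',
      G (F (0 + rtoC t *: v)) = 0 + rtoC t *: v.
    by move: Lc; rewrite l0 => /(_ _ GF).
  by move: near_id; apply: filterS => t Et; apply: esym Et.
have : J *m J' = 1%:M.
  by apply/row_matrixP => i; rewrite !rowE JJ mulmx1.
by case/mulmx1_unit.
Qed.

End LinearGerms.

(** * Local equivalence of quadrics is linear equivalence *)

Section LocalEquivalence.
Variables (R : realType) (n : nat).
Local Notation C := (CC R).
Implicit Types (a b : 'M[C]_n) (z : 'rV[C]_n) (q : normal_form R).

Lemma lin_equiv_locally a b (f : 'rV[C]_n -> C) :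
  lin_equiv (qfun a b) f -> locally_equivalent (quadric a b) (graph_of f).
Proof.
move=> [T [mu [Tu mu0 H]]].
pose J : 'M[C]_(n + 1) := block_mx T 0 0 mu%:M.
have Ju : J \in unitmx.
  by rewrite unitmxE det_ublock det_scalar1 unitrM -unitmxE Tu unitfE.
exists (fun p => p *m J); first exact: linear_biholomorphic.
apply: filterE => p.
have pJ : p *m J = mkp (zpart p *m T) (mu * wpart p).
  rewrite -{1}[p]mkpK /mkp /J mul_row_block !mulmx0 addr0 add0r.
  by rewrite -scalar_mxM mulrC.
rewrite /graph_of /quadric pJ /= zpart_mkp wpart_mkp H -/(qfun a b _).
split=> [->//|]; exact: mulfI.
Qed.

Lemma locally_equivalent_germ (M M' M'' : set (Cn1 R n)) :
  same_germ0 M M' -> locally_equivalent M' M'' <-> locally_equivalent M M''.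
Proof.
rewrite /same_germ0 => MM'; split=> -[F Fb FM]; exists F => //; move: MM' FM;
  by apply: filterS2 => p H1 H2; rewrite -H2 H1.
Qed.

Lemma cvg_zc (T : Type) (F : set_system T) (FF : Filter F)
    (f : T -> 'rV[C]_n) (l : 'rV[C]_n) j :
  f x @[x --> F] --> l -> zc (f x) j @[x --> F] --> zc l j.
Proof.
move=> /(cvg_rowP FF) fl; rewrite /zc.
have c0 : (fun=> 0 : C) x @[x --> F] --> (0 : C) by apply: cvg_cst.
case: j => [|j]; first by apply: c0.
by case: (insub j : option 'I_n) => [i|] /=; [apply: fl|apply: c0].
Qed.

Lemma cvg_nf_fun q (T : Type) (F : set_system T) (FF : Filter F)
    (f : T -> 'rV[C]_n) (l : 'rV[C]_n) :
  f x @[x --> F] --> l -> nf_fun q (f x) @[x --> F] --> nf_fun q l.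
Proof.
move=> fl; have c j : zc (f x) j @[x --> F] --> zc l j by apply: cvg_zc fl.
have cst (s : C) : (fun=> s) x @[x --> F] --> s by apply: cvg_cst.
have cc j : (zc (f x) j)^* @[x --> F] --> (zc l j)^* by apply: cvg_conj; apply: c.
have cc2 j : (zc (f x) j)^* ^+ 2 @[x --> F] --> (zc l j)^* ^+ 2.
  by apply: cvgM; apply: cc.
have cn j : `|zc (f x) j| ^+ 2 @[x --> F] --> `|zc l j| ^+ 2.
  by rewrite normCK (_ : (fun x => _) = fun x => zc (f x) j * (zc (f x) j)^*);
    [apply: cvgM; [apply: c|apply: cc]|apply/funext => x; rewrite normCK].
have HA : nfA q (f x) @[x --> F] --> nfA q l.
  case: q => [k|g||]; rewrite /nfA; first by apply: cst.
  - by apply: cn.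
  - by apply: cvgM; [apply: cc|apply: c].
  - by apply: cvgM; [apply: cc|apply: c].
have HB : nfB q (f x) @[x --> F] --> nfB q l.
  case: q {HA} => [k|g||]; rewrite /nfB.
  - by apply: cvgC_sum => j; apply: cc2.
  - by apply: cvgM; [apply: cst|apply: cc2].
  - by apply: cst.
  - by apply: cc2.
by apply: cvgD; [apply: HA|apply: HB].
Qed.

Lemma conj_rtoCM (s : R) (x : C) : (rtoC s * x)^* = rtoC s * x^*.
Proof. by rewrite -{2}(conj_rtoC s) -rmorphM. Qed.

Lemma nf_fun_rtoC q (s : R) z : nf_fun q (rtoC s *: z) = rtoC s ^+ 2 * nf_fun q z.
Proof.
rewrite /nf_fun nfB_rot conj_rtoC mulrDr; congr (_ + _).
case: q => [k|g||] /=; rewrite ?mulr0 // !zcZ.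
- by rewrite normrM exprMn [X in X * _]normCK conj_rtoC -expr2.
- by rewrite conj_rtoCM; ring.
- by rewrite conj_rtoCM; ring.
Qed.

Lemma qfun_types a b w z : `|w| = 1 ->
  qfun a b (w *: z) = A_form a z + w^* ^+ 2 * B_form b z.
Proof.
move=> w1; rewrite /qfun !A_formE !B_formE cmxZ -!scalemxAl !dtZl !dtZr.
by rewrite !mulrA -expr2 [w^* * w]mulrC -normCK w1 expr1n mul1r.
Qed.

(** Let [F] be the equivalence, with linear part [z T] at the points [(z, 0)]
    and with last component [d . x + h x + O(3)], and let [x t] be the point
    [(t z, t^2 w)] of the first quadric. Comparing the terms of order one in
    [t] in the equation of the second quadric at [F (x t)], [d . (z, 0) = 0];
    hence [d . x = mu w], and the terms of order two give
    [nf_fun q (z T) = mu (qfun a b z) + h (z, 0)]. Here [h (z, 0)] has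
    bidegree (2,0), which occurs in neither quadric, so it vanishes. The
    matrix [T] and the number [mu] are invertible because the Jacobian of [F]
    is block triangular with these diagonal blocks. *)
Lemma locally_lin_equiv a b q :
  locally_equivalent (quadric a b) (nf_quadric q) ->
  lin_equiv (qfun a b) (nf_fun q).
Proof.
rewrite nf_quadricE => -[F Fb near_eq].
have [J Ju HJ] := biholomorphic_velocity Fb.
have [Fh F0 _] := Fb.
pose f p := wpart (F p).
have fh : holomorphic_at0 f.
  have [c [r H]] := Fh (rshift n 0); exists c, r.
  by rewrite (_ : f = fun p => F p 0 (rshift n 0)) //; apply/funext => p; rewrite /f /wpart mxE.
have f0 : f 0 = 0 by rewrite /f F0 /wpart !mxE.
have [d [h [r [K [r0 fd hh hc hr]]]]] := holomorphic_second_order fh f0.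
pose mu := rsubmx d 0 0; pose T := ulsubmx J.
have Jw v : wpart (v *m J) = dt v d.
  have L : is_velocity (fun t => 0 + rtoC t *: v) v by apply: is_velocity_line.
  have l0 : (0 : Cn1 R n) + rtoC 0 *: v = 0 by rewrite rtoC0 scale0r addr0.
  exact: svel_unique (svel_wpart (HJ _ _ l0 L)) (fd _ _ l0 L).
have Jz z : zpart (mkp z 0 *m J) = z *m T.
  rewrite -[J]submxK /mkp mul_row_block raddf0 !mul0mx !addr0.
  by rewrite /zpart row_mxKl /T /ulsubmx.
have dE z w : dt (mkp z w) d = dt z (lsubmx d) + w * mu.
  rewrite -{1}[d]hsubmxK /mkp dt_row_mx; congr (_ + _).
  by rewrite dtE big_ord1 mxE mulr1n.
have main z : (forall i, `|z 0 i| < rtoC r) ->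
    dt z (lsubmx d) = 0 /\ nf_fun q (z *m T) = mu * qfun a b z + h (mkp z 0).
  move=> zr.
  pose y (t : R) := mkp z (rtoC t * qfun a b z).
  pose x (t : R) := mkp (rtoC t *: z) (rtoC t ^+ 2 * qfun a b z).
  have xy t : x t = rtoC t *: y t.
    by rewrite /x /y /mkp scale_row_mx scale_scalar_mx expr2 mulrA.
  have x0 : x 0 = 0 by rewrite xy rtoC0 scale0r.
  have y0r i : `|mkp z 0 0 i| < rtoC r.
    case: (splitP i) => j ij.
      have -> : i = lshift 1 j by apply: val_inj.
      by rewrite row_mxEl.
    have -> : i = rshift n j by apply: val_inj.
    by rewrite row_mxEr raddf0 mxE normr0 rtoC_gt0.
  have cst (s : C) : (fun=> s) t @[t --> (0 : R)^'] --> s by apply: cvg_cst.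
  have FF : Filter ((0 : R)^') by exact: dnbhs_filter.
  have yc : y t @[t --> (0 : R)^'] --> mkp z 0.
    apply: cvg_row_mx; first by apply: cvg_cst.
    apply: cvg_scalar; rewrite -(mul0r (qfun a b z)).
    by apply: cvgM; [apply: rtoC_cvg0|apply: cst].
  have xv : is_velocity x (mkp z 0).
    rewrite /is_velocity (_ : (fun t => _) = fun t => (rtoC t)^-1 *: x t); last first.
      by apply/funext => t; rewrite x0 subr0.
    apply: cvg_trans yc; apply: near_eq_cvg.
    move: (@near_neq0 R); apply: filterS => t t0.
    by rewrite xy scalerA mulVf ?rtoC_eq0 // scale1r.
  pose ze t := zpart (F (x t)).
  have zev : is_velocity ze (z *m T).
    by rewrite -Jz; apply: is_velocity_zpart; apply: HJ.
  have ze0 : ze 0 = 0 by rewrite /ze x0 F0; apply: linear0.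
  have zec : (rtoC t)^-1 *: ze t @[t --> (0 : R)^'] --> z *m T.
    have := zev; rewrite /is_velocity ze0 (_ : (fun t => _) = fun t => (rtoC t)^-1 *: ze t) //.
    by apply/funext => t; rewrite subr0.
  have nfc : nf_fun q ((rtoC t)^-1 *: ze t) @[t --> (0 : R)^'] --> nf_fun q (z *m T).
    by apply: cvg_nf_fun; apply: zec.
  have xq t : quadric a b (x t).
    rewrite /quadric /graph_of /x /= zpart_mkp wpart_mkp -/(qfun a b _).
    by rewrite qfun_rtoC.
  have fx : \forall t \near (0 : R)^', f (x t) = rtoC t ^+ 2 * nf_fun q ((rtoC t)^-1 *: ze t).
    have xc := is_velocity_cvg xv; rewrite x0 in xc.
    have H1 : \forall t \near (0 : R)^',
        quadric a b (x t) <-> graph_of (nf_fun q) (F (x t)) by exact: (xc _ near_eq).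
    move: (@near_neq0 R) H1; apply: filterS2 => t t0 [H1 _].
    rewrite -rtoCV nf_fun_rtoC mulrA -rtoCX -rtoCX -rtoCM exprVn divff ?expf_neq0 //.
    by rewrite rtoC1 mul1r; apply: H1.
  have [B B0 yB] : exists2 B : R, 0 < B & forall t, `|t| <= 1 ->
      forall i, `|y t 0 i| <= rtoC B.
    have [B1 B10 zB] := row_bounded z; have [B2 B20 qB] := norm_rtoC (qfun a b z).
    exists (B1 + B2 + 1); first by rewrite ltr_wpDl // addr_ge0.
    move=> t t1 i; case: (splitP i) => j ij.
      have -> : i = lshift 1 j by apply: val_inj.
      by rewrite row_mxEl (le_trans (zB j)) // rtoC_le; lra.
    have -> : i = rshift n j by apply: val_inj.
    rewrite row_mxEr mxE !ord1 mulr1n normrM norm_rtoCE qB -rtoCM rtoC_le.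
    by apply: (@le_trans _ _ (1 * B2)); [rewrite ler_wpM2r|lra].
  have near1 : \forall t \near (0 : R)^', `|t| <= 1.
    have e1 : (0 : R) < 1 by [].
    by have := @dnbhs0_lt R R _ e1; apply: filterS => t; apply: ltW.
  have rem : \forall t \near (0 : R)^',
      `|f (x t) - (rtoC t * dt z (lsubmx d) + rtoC t ^+ 2 * (qfun a b z * mu + h (y t)))|
        <= rtoC ((`|t| * B) ^+ 3 * K).
    have ny : \forall t \near (0 : R)^', forall i, `|y t 0 i| < rtoC r.
      exact: (yc _ (near_polydisc y0r)).
    have nB : \forall t \near (0 : R)^', `|t| < r / B.
      by apply: dnbhs0_lt; rewrite divr_gt0.
    near=> t.
    have t1 : `|t| <= 1 by near: t.
    have yr : forall i, `|y t 0 i| < rtoC r by near: t.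
    have tB : `|t| < r / B by near: t.
    have tC1 : `|rtoC t| <= 1 by rewrite norm_rtoCE -rtoC1 rtoC_le.
    have -> : rtoC t * dt z (lsubmx d) + rtoC t ^+ 2 * (qfun a b z * mu + h (y t)) =
        dt (x t) d + h (x t).
      by rewrite xy hh // dtZl dE; ring.
    apply: hr; first by rewrite mulr_ge0 // ltW.
      by rewrite -ltr_pdivlMr.
    move=> i; rewrite xy mxE normrM norm_rtoCE rtoCM ler_wpM2l ?rtoC_ge0 //.
    exact: yB.
  have hyc : h (y t) @[t --> (0 : R)^'] --> h (mkp z 0).
    by apply: cvg_comp yc (hc _ y0r).
  have gc : qfun a b z * mu + h (y t) @[t --> (0 : R)^'] --> qfun a b z * mu + h (mkp z 0).
    by apply: cvgD; [apply: cst|apply: hyc].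
  have remK (t : R) : (`|t| * B) ^+ 3 * K <= `|t| ^+ 3 * (B ^+ 3 * `|K|).
    by rewrite exprMn -mulrA ler_wpM2l ?exprn_ge0 // ler_wpM2l ?exprn_ge0 ?ler_norm // ltW.
  have M0 : 0 <= B ^+ 3 * `|K| by rewrite mulr_ge0 // exprn_ge0 // ltW.
  have d0 : dt z (lsubmx d) = 0.
    have l1 : (rtoC t)^-1 * f (x t) @[t --> (0 : R)^'] --> dt z (lsubmx d).
      apply: (@cvg_Ot R _ (fun t => dt z (lsubmx d) +
        rtoC t * (qfun a b z * mu + h (y t))) _ (B ^+ 3 * `|K|)).
        near=> t.
        have t0 : t != 0 by near: t; apply: near_neq0.
        have t1 : `|t| <= 1 by near: t.
        have tp : 0 < `|t| by rewrite normr_gt0.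
        have tC0 : rtoC t != 0 by rewrite rtoC_eq0.
        have H1 : `|f (x t) - (rtoC t * dt z (lsubmx d) +
            rtoC t ^+ 2 * (qfun a b z * mu + h (y t)))| <= rtoC ((`|t| * B) ^+ 3 * K).
          by near: t; apply: rem.
        have -> : (rtoC t)^-1 * f (x t) - (dt z (lsubmx d) +
            rtoC t * (qfun a b z * mu + h (y t))) =
            (rtoC t)^-1 * (f (x t) - (rtoC t * dt z (lsubmx d) +
            rtoC t ^+ 2 * (qfun a b z * mu + h (y t)))).
          by field.
        rewrite normrM normfV norm_rtoCE ler_pdivrMl ?rtoC_gt0 //.
        apply: le_trans H1 _; rewrite -rtoCM rtoC_le; apply: le_trans (remK t) _.
        rewrite [leRHS]mulrA ler_wpM2r // -expr2.
        by rewrite ler_wiXn2l // normr_ge0.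
      rewrite -[X in _ --> X]addr0 -[X in _ --> _ + X](mul0r (qfun a b z * mu + h (mkp z 0))).
      apply: cvgD; first by apply: cst.
      by apply: cvgM; [apply: rtoC_cvg0|apply: gc].
    have l2 : rtoC t * nf_fun q ((rtoC t)^-1 *: ze t) @[t --> (0 : R)^'] --> (0 : C).
      rewrite -(mul0r (nf_fun q (z *m T))).
      by apply: cvgM; [apply: rtoC_cvg0|apply: nfc].
    apply: (cvgC_unique _ l1); apply: cvg_trans l2; apply: near_eq_cvg.
    move: (@near_neq0 R) fx; apply: filterS2 => t t0 ->.
    by rewrite expr2 !mulrA mulVf ?rtoC_eq0 // mul1r.
  split=> //; apply: (cvgC_unique _ nfc); rewrite [mu * _]mulrC.
  apply: (@cvg_Ot R _ _ _ (B ^+ 3 * `|K|)) gc; near=> t.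
  have t0 : t != 0 by near: t; apply: near_neq0.
  have tp : 0 < `|t| by rewrite normr_gt0.
  have tC0 : rtoC t != 0 by rewrite rtoC_eq0.
  have H1 : `|f (x t) - (rtoC t * dt z (lsubmx d) +
      rtoC t ^+ 2 * (qfun a b z * mu + h (y t)))| <= rtoC ((`|t| * B) ^+ 3 * K).
    by near: t; apply: rem.
  have H2 : f (x t) = rtoC t ^+ 2 * nf_fun q ((rtoC t)^-1 *: ze t) by near: t; apply: fx.
  move: H1; rewrite H2 d0 mulr0 add0r -mulrBr normrM normrX norm_rtoCE => H1.
  have tq : 0 < rtoC `|t| ^+ 2 by rewrite exprn_gt0 // rtoC_gt0.
  rewrite -(ler_pM2l tq); apply: le_trans H1 _.
  rewrite -rtoCX -rtoCM rtoC_le mulrA -exprSr; exact: remK.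
have dl z : dt z (lsubmx d) = 0.
  have [B B0 zB] := row_bounded z.
  have B1 : 0 < B + 1 by rewrite ltr_wpDl.
  have s0 : 0 < r / (B + 1) by rewrite divr_gt0.
  have [|H _] := main (rtoC (r / (B + 1)) *: z).
    move=> i; rewrite mxE normrM norm_rtoCE (gtr0_norm s0).
    apply: le_lt_trans (ler_wpM2l _ (zB i)) _; first by rewrite rtoC_ge0 ltW.
    by rewrite -rtoCM rtoC_lt mulrAC ltr_pdivrMr // ltr_pM2l // ltrDl.
  move: H; rewrite dtZl => /eqP; rewrite mulf_eq0 rtoC_eq0 gt_eqF //=.
  by move=> /eqP.
have ur0 : ursubmx J = 0.
  apply/row_matrixP => i; rewrite row0 rowE.
  have := Jw (mkp (delta_mx 0 i) 0); rewrite dE dl mul0r addr0.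
  rewrite -{1}[J]submxK /mkp mul_row_block raddf0 !mul0mx !addr0 /wpart row_mxKr.
  by move=> H; rewrite [LHS]mx11_scalar H raddf0.
have dr : drsubmx J = mu%:M.
  have := Jw (mkp 0 1); rewrite dE dl mul1r add0r.
  rewrite -{1}[J]submxK /mkp mul_row_block !mul0mx !add0r !mul1mx /wpart row_mxKr.
  by move=> H; rewrite [LHS]mx11_scalar H.
have : \det J = \det T * mu.
  by rewrite -{1}[J]submxK ur0 dr det_lblock det_scalar1.
move=> detJ; move: Ju; rewrite unitmxE detJ unitrM => /andP[Tu muu].
exists T, mu; split; [by rewrite unitmxE|by rewrite -unitfE|move=> z].
have small (v : 'rV[C]_n) : (forall i, `|v 0 i| < rtoC r) -> nf_fun q (v *m T) = mu * qfun a b v.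
  move=> vr.
  have [|_ /eqP E1 /eqP E2] := @three_weights C (- h (mkp v 0))
    (nfA q (v *m T) - mu * A_form a v) (nfB q (v *m T) - mu * B_form b v).
    move=> w w1; have [|_ H] := main (w *: v).
      by move=> i; rewrite mxE normrM w1 mul1r.
    have hw : h (mkp (w *: v) 0) = w ^+ 2 * h (mkp v 0).
      rewrite -hh ?w1 //.
        by congr h; rewrite /mkp scale_row_mx raddf0 scaler0.
      move=> i; case: (splitP i) => j ij.
        have -> : i = lshift 1 j by apply: val_inj.
        by rewrite row_mxEl.
      have -> : i = rshift n j by apply: val_inj.
      by rewrite row_mxEr raddf0 mxE normr0 rtoC_gt0.
    move: H; rewrite -scalemxAl /nf_fun nfA_rot // nfB_rot qfun_types // hw => /eqP.
    rewrite -subr_eq0 => /eqP H; rewrite -[RHS]H; ring.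
  move: E1 E2; rewrite !subr_eq0 => /eqP E1 /eqP E2.
  by rewrite /nf_fun E1 E2 /qfun mulrDr.
have [B B0 zB] := row_bounded z.
have B1 : 0 < B + 1 by rewrite ltr_wpDl.
have s0 : 0 < r / (B + 1) by rewrite divr_gt0.
have := small (rtoC (r / (B + 1)) *: z).
rewrite -scalemxAl nf_fun_rtoC qfun_rtoC mulrCA => H.
have s2 : rtoC (r / (B + 1)) ^+ 2 != 0 by rewrite expf_neq0 // rtoC_eq0 gt_eqF.
apply: (mulfI s2); apply: H => i.
rewrite mxE normrM norm_rtoCE (gtr0_norm s0).
apply: le_lt_trans (ler_wpM2l _ (zB i)) _; first by rewrite rtoC_ge0 ltW.
by rewrite -rtoCM rtoC_lt mulrAC ltr_pdivrMr // ltr_pM2l // ltrDl.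
Unshelve. all: by end_near.
Qed.
End LocalEquivalence.

(** * Levi-flat quadrics and their normal forms *)

Theorem theorem1p1 (R : realType) (n : nat) (n_ge2 : (2 <= n)%N)
    (M : set (Cn1 R n)) (a b : 'M[CC R]_n) (E : 'rV[CC R]_n -> CC R)
    (E_O3 : real_analytic_O 3 E)
    (M_graph : same_germ0 M (graph_of (fun z => A_form a z + B_form b z + E z)))
    (M_CRsing : CR_singular_at M 0)
    (AB_neq0 : exists z : 'rV[CC R]_n, A_form a z + B_form b z != 0)
    (M_flat : Levi_flat_germ0 M) :
  (same_germ0 M (quadric a b) ->
     exists! q : normal_form R,
       in_list n q /\ locally_equivalent M (nf_quadric q))
  /\
  (Levi_flat (quadric a b) /\
     exists! q : normal_form R,
       in_list n q /\ locally_equivalent (quadric a b) (nf_quadric q)).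
Proof.
have LN := flat_levi_null E_O3 M_graph M_flat.
have [q qL qE] := levi_null_normal_form n_ge2 LN AB_neq0.
have unique_q : exists! q : normal_form R,
    in_list n q /\ locally_equivalent (quadric a b) (nf_quadric q).
  exists q; split.
    by split=> //; rewrite nf_quadricE; apply: lin_equiv_locally.
  move=> q' [q'L /locally_lin_equiv q'E]; apply: (nf_fun_inj n_ge2) => //.
  exact: lin_equiv_trans (lin_equiv_sym qE) q'E.
split; last by split=> //; apply: levi_null_flat.
move=> MQ; have [q0 [[q0L q0E] q0u]] := unique_q; exists q0; split.
  by split=> //; apply/(locally_equivalent_germ _ MQ).
by move=> q' [q'L q'E]; apply: q0u; split=> //; apply/(locally_equivalent_germ _ MQ).
Qed.
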